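(* Let $(X,d,\ll,\leq,\tau)$ be a strongly causal Lorentzian pre-length space with $\tau$ locally finite-valued and locally continuous and let $\alpha,\beta,\gamma\colon[0,B)\rightarrow X$ be timelike curves starting at $x:=\alpha(0)=\beta(0)=\gamma(0)$. (i) If $\alpha,\beta$ are future directed, $\gamma$ is past directed and the angle $\measuredangle_x(\alpha,\gamma)$ exists, then $$\measuredangle_x(\alpha,\gamma)\leq\measuredangle_x(\alpha,\beta)+\measuredangle_x(\beta,\gamma).$$ (ii) If $X$ is locally causally closed, has timelike curvature bounded below and satisfies geodesic prolongation, then the same inequality $\measuredangle_x(\alpha,\gamma)\leq\measuredangle_x(\alpha,\beta)+\measuredangle_x(\beta,\gamma)$ also holds when $\alpha,\gamma$ are future directed curves and $\beta$ is a past directed geodesic.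
   Context: A causal space is a set $X$ with two transitive relations $\ll,\leq$ such that $\leq$ is reflexive and $p\ll q$ implies $p\leq q$. Write $I(p,q)=\{r:p\ll r\ll q\}$. A Lorentzian pre-length space $(X,d,\ll,\leq,\tau)$ is a causal space with a metric $d$ and a map $\tau\colon X\times X\to[0,\infty]$ that is lower semicontinuous with respect to $d$, satisfies $\tau(p,r)\geq\tau(p,q)+\tau(q,r)$ for $p\leq q\leq r$, and $\tau(p,q)>0\Leftrightarrow p\ll q$. $\tau$ is locally finite-valued (locally continuous) if every point has a neighborhood $U$ with $\tau<\infty$ on $U\times U$ ($\tau$ continuous on $U\times U$). $X$ is locally causally closed if every point has a neighborhood $U$ such that $x_n,y_n\in U$, $x_n\leq y_n$, $x_n\to x\in\bar U$, $y_n\to y\in\bar U$ imply $x\leq y$. $X$ is strongly causal if the sets $I(p,q)$ form a subbase of the topology induced by $d$. A non-constant locally Lipschitz curve $\gamma\colon I\to X$ is future directed causal (timelike) if $\gamma(t_1)\leq\gamma(t_2)$ ($\gamma(t_1)\ll\gamma(t_2)$) for all $t_1<t_2$; past directed with relations reversed. $L_\tau(\gamma)$ is the infimum of $\sum_i\tau(\gamma(t_i),\gamma(t_{i+1}))$ over partitions. A future directed causal curve from $p$ to $q$ is a distance realizer (maximal) if $L_\tau(\gamma)=\tau(p,q)$ (past directed: after reversal). A causal curve $\gamma\colon I\to X$ is a geodesic if each $t\in I$ has a neighborhood $[a,b]$ in $I$ with $\gamma|_{[a,b]}$ a distance realizer. $X$ satisfies geodesic prolongation if every causal geodesic can be extended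 to a causal geodesic with open domain, i.e. a geodesic on $[b,c]$ can be prolonged as a geodesic to $(a,e)$ with $a<b<c<e$. An open set $U$ is strictly timelike geodesically connected if for all $x\ll y$ in $U$ there is a future directed maximal geodesic in $U$ from $x$ to $y$ and any such maximal geodesic in $U$ is timelike. Model spaces: $\mathbb{R}^n_m$ is $\mathbb{R}^n$ with $b(v,w)=-\sum_{i\leq m}v_iw_i+\sum_{i>m}v_iw_i$. $\mathbb{L}^2(K)$ is the universal cover of $\{v\in\mathbb{R}^3_1:b(v,v)=1/K\}$ for $K>0$, of $\{v\in\mathbb{R}^3_2:b(v,v)=-1/|K|\}$ for $K<0$, and $\mathbb{R}^2_1$ for $K=0$ (constant curvature $K$), with time separation $\bar\tau$. $D_K=\pi/\sqrt{-K}$ for $K<0$, $D_K=\infty$ for $K\geq0$. A triangle satisfies timelike size bounds for $K$ if its longest side-length is $<D_K$. A timelike triangle consists of $p_1\ll p_2\ll p_3$ with finite mutual time separations and distance realizers (sides) from $p_i$ to $p_j$, $i<j$. A comparison triangle in $\mathbb{L}^2(K)$ is a triple of points with the same causal order and time separations; a point $q$ on the side from $p_i$ to $p_j$ corresponds to $\bar q$ on the side from $\bar p_i$ to $\bar p_j$ with $\bar\tau(\bar p_i,\bar q)=\tau(p_i,q)$. $X$ has timelike curvature bounded below by $K\in\mathbb{R}$ if it is covered by open sets $U$ such that (1) $\tau$ is finite and continuous on $U\times U$; (2) $U$ is strictly timelike geodesically connected; (3) for every timelike triangle in $U$ satisfying timelike size bounds for $K$, all $q_1,q_2$ on its sides and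 corresponding points $\bar q_1,\bar q_2$ on a comparison triangle in $\mathbb{L}^2(K)$, $\tau(q_1,q_2)\leq\bar\tau(\bar q_1,\bar q_2)$. ''Timelike curvature bounded below'' means bounded below by some $K\in\mathbb{R}$. Comparison angle: if $x,y,z$ are pairwise causally related with finite time separations and $y,z$ are timelike related to $x$ (in either direction), then $\tilde\measuredangle_x(y,z)=\operatorname{arcosh}|\langle u,v\rangle|$, with $u,v$ the unit timelike initial velocities at $\bar x$ of the segments from $\bar x$ to $\bar y$ and $\bar z$ in a comparison triangle in the Minkowski plane $\mathbb{L}^2(0)=\mathbb{R}^2_1$. Upper angle: for (future or past directed) timelike curves $\alpha,\beta$ with $\alpha(0)=\beta(0)=x$, let $A_0$ be the set of $(s,t)$ with $s,t>0$ such that $\alpha(s)\leq\beta(t)$ or $\beta(t)\leq\alpha(s)$ and the time separations between $x,\alpha(s),\beta(t)$ are finite. Then $\measuredangle_x(\alpha,\beta):=\limsup_{(s,t)\in A_0;\,s,t\searrow0}\tilde\measuredangle_x(\alpha(s),\beta(t))\in[0,\infty]$. The angle exists if this limit superior is a limit and finite. *)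

(* Defs.v *)
From mathcomp Require Import all_boot all_order all_algebra.
From mathcomp Require Import all_classical all_reals all_analysis.

Set Implicit Arguments.
Unset Strict Implicit.
Unset Printing Implicit Defensive.

Import Order.TTheory GRing.Theory Num.Theory.
Import numFieldNormedType.Exports.

Local Open Scope classical_set_scope.
Local Open Scope ring_scope.

Record lorentzian_prelength_space (R : realType) := LorentzianPreLengthSpace {
  lpls_sort :> metricType R;
  chron : lpls_sort -> lpls_sort -> Prop;
  causal : lpls_sort -> lpls_sort -> Prop;
  tau : lpls_sort -> lpls_sort -> \bar R;
  chron_trans : forall p q r, chron p q -> chron q r -> chron p r;
  causal_trans : forall p q r, causal p q -> causal q r -> causal p r;
  causal_refl : forall p, causal p p;
  chron_causal : forall p q, chron p q -> causal p q;
  tau_ge0 : forall p q, (0 <= tau p q)%E;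
  tau_lsc : lower_semicontinuous
    (fun pq : (lpls_sort * lpls_sort)%type => tau pq.1 pq.2);
  tau_reverse_triangle : forall p q r, causal p q -> causal q r ->
    (tau p q + tau q r <= tau p r)%E;
  tau_gt0 : forall p q, (0 < tau p q)%E <-> chron p q
}.

Arguments chron {R l}.
Arguments causal {R l}.
Arguments tau {R l}.

Section causality.
Context {R : realType} (X : lorentzian_prelength_space R).
Implicit Types (p q x y : X) (U : set X).

Definition tau_finite_on U := forall p q, U p -> U q -> (tau p q < +oo)%E.

Definition tau_continuous_on U :=
  {within U `*` U, continuous (fun pq : (X * X)%type => tau pq.1 pq.2)}.

Definition locally_finite_valued :=
  forall x : X, exists2 U, nbhs x U & tau_finite_on U.

Definition locally_continuous :=
  forall x : X, exists2 U, nbhs x U & tau_continuous_on U.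

Definition locally_causally_closed :=
  forall z : X, exists2 U, nbhs z U &
    forall (u v : nat -> X) x y,
      (forall n, [/\ U (u n), U (v n) & causal (u n) (v n)]) ->
      closure U x -> closure U y ->
      u @ \oo --> x -> v @ \oo --> y -> causal x y.

Definition diamond p q : set X := [set r | chron p r /\ chron r q].

Definition strongly_causal :=
  forall A : set X, open A <->
    exists2 F : set (set X),
      F `<=` finI_from [set: (X * X)%type] (fun pq => diamond pq.1 pq.2) &
      A = \bigcup_(V in F) V.

End causality.

(* A curve on the interval I is a total function R -> X of which only the
   restriction to I matters. *)
Section curves.
Context {R : realType} {X : lorentzian_prelength_space R}.
Implicit Types (I : set R) (c : R -> X) (a b : R).

Definition locally_lipschitz I c :=
  forall t, I t -> exists2 e : R, 0 < e & exists k : R,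
    forall s u, I s -> I u -> `|s - t| < e -> `|u - t| < e ->
      mdist (c s) (c u) <= k * `|s - u|.

(* Non-constancy is required on every nondegenerate subinterval.  If it were
   only required globally, a maximal curve in Minkowski space that rests for
   a while would be a maximal causal curve that is not timelike, so that no open
   set containing chronologically related points would be strictly timelike
   geodesically connected; and every geodesic could be prolonged by resting
   at its endpoints. *)
Definition lorentzian_curve I c :=
  [/\ is_interval I,
      exists s t, [/\ I s, I t & s < t],
      forall s t, I s -> I t -> s < t ->
        exists2 u, s <= u <= t & c u <> c s
    & locally_lipschitz I c].

Definition fd_causal I c := lorentzian_curve I c /\
  forall s t, I s -> I t -> s < t -> causal (c s) (c t).

Definition pd_causal I c := lorentzian_curve I c /\
  forall s t, I s -> I t -> s < t -> causal (c t) (c s).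

Definition fd_timelike I c := lorentzian_curve I c /\
  forall s t, I s -> I t -> s < t -> chron (c s) (c t).

Definition pd_timelike I c := lorentzian_curve I c /\
  forall s t, I s -> I t -> s < t -> chron (c t) (c s).

Definition tau_length c a b : \bar R :=
  ereal_inf [set (\sum_(0 <= i < size s)
                    tau (c (nth b (a :: s) i)) (c (nth b s i)))%E
            | s in itv_partition a b].

Definition fd_realizer c a b :=
  fd_causal `[a, b] c /\ tau_length c a b = tau (c a) (c b).

Definition pd_realizer c a b :=
  pd_causal `[a, b] c /\ fd_realizer (fun t => c (- t)) (- b) (- a).

Definition fd_geodesic I c := fd_causal I c /\
  forall t, I t -> exists a b,
    [/\ `[a, b]%classic `<=` I,
        (\forall s \near t, I s -> a <= s <= b) & fd_realizer c a b].

Definition pd_geodesic I c := pd_causal I c /\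
  forall t, I t -> exists a b,
    [/\ `[a, b]%classic `<=` I,
        (\forall s \near t, I s -> a <= s <= b) & pd_realizer c a b].

Definition geodesic I c := fd_geodesic I c \/ pd_geodesic I c.

End curves.

Definition geodesic_prolongation {R : realType}
    (X : lorentzian_prelength_space R) :=
  forall (b c : R) (g : R -> X), geodesic `[b, c] g ->
    exists a e (h : R -> X), [/\ a < b, c < e, geodesic `]a, e[ h &
      forall t, b <= t <= c -> h t = g t].

Section strictly_timelike_geodesically_connected.
Context {R : realType} {X : lorentzian_prelength_space R}.

Definition maximal_from_to_in (U : set X) (x y : X) (c : R -> X) (a b : R) :=
  [/\ fd_realizer c a b, c a = x, c b = y &
      forall t, a <= t <= b -> U (c t)].

Definition strictly_timelike_geodesically_connected (U : set X) :=
  forall x y, U x -> U y -> chron x y ->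
    (exists c a b, maximal_from_to_in U x y c a b) /\
    (forall c a b, maximal_from_to_in U x y c a b -> fd_timelike `[a, b] c).

End strictly_timelike_geodesically_connected.

Section model_spaces.
Context {R : realType}.

Definition sinh (x : R) : R := (expR x - expR (- x)) / 2.
Definition cosh (x : R) : R := (expR x + expR (- x)) / 2.
Definition arcosh (x : R) : R := ln (x + Num.sqrt (x ^+ 2 - 1)).

(* the scalar product b of R^n_m *)
Definition bform (n m : nat) (v w : 'rV[R]_n) : R :=
  - (\sum_(i < n | (i < m)%N) v 0 i * w 0 i)
  + \sum_(i < n | (m <= i)%N) v 0 i * w 0 i.

(* The universal cover L^2(K) is realized on R^2 with coordinates (t, x).  The
   covering map onto {v | b(v,v) = 1/K} in R^3_1 (K > 0) or R^3_2 (K < 0) is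
   model_cover; for K = 0 it is the identity of R^2_1.  The ambient space is
   thus R^n_m with n = (K != 0).+2 and m = (K < 0).+1.  In all cases the
   coordinate field d/dt is timelike and defines the time orientation. *)
Definition model_pt := 'rV[R]_2.

Definition model_cover (K : R) (p : model_pt) : 'rV[R]_((K != 0)%R).+2 :=
  let t := p 0 0 in let x := p 0 1 in let r := (Num.sqrt `|K|)^-1 in
  \row_i nth 0
    (if K == 0 then [:: t; x]
     else if 0 < K then
       [:: r * sinh t; r * (cosh t * cos x); r * (cosh t * sin x)]
     else [:: r * (cosh x * cos t); r * (cosh x * sin t); r * sinh x]) i.

(* A C^1 curve on [0, 1] is given as the restriction of a C^1 map on R.
   Taking piecewise C^1 curves instead would not change the suprema. *)
Definition C1 (f : R -> R) :=
  (forall t, derivable f t 1) /\ continuous (derive1 f).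

Definition model_velocity (K : R) (c : R -> model_pt) (t : R) :
    'rV[R]_((K != 0)%R).+2 :=
  \row_i derive1 (fun s => model_cover K (c s) 0 i) t.

Definition model_speed2 (K : R) (c : R -> model_pt) (t : R) : R :=
  bform ((K < 0)%R).+1 (model_velocity K c t) (model_velocity K c t).

Definition model_future_curve (c : R -> model_pt) (p q : model_pt) :=
  [/\ c 0 = p, c 1 = q, forall i, C1 (fun t => c t 0 i) &
      forall t, 0 <= t <= 1 -> 0 < derive1 (fun s => c s 0 0) t].

Definition model_causal_curve (K : R) (c : R -> model_pt) (p q : model_pt) :=
  model_future_curve c p q /\
  forall t, 0 <= t <= 1 -> model_speed2 K c t <= 0.

Definition model_timelike_curve (K : R) (c : R -> model_pt) (p q : model_pt) :=
  model_future_curve c p q /\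
  forall t, 0 <= t <= 1 -> model_speed2 K c t < 0.

Definition model_ll (K : R) (p q : model_pt) :=
  exists c, model_timelike_curve K c p q.

Definition model_le (K : R) (p q : model_pt) :=
  p = q \/ exists c, model_causal_curve K c p q.

Definition model_length (K : R) (c : R -> model_pt) : \bar R :=
  (\int[lebesgue_measure]_(t in `[0%R, 1%R])
     (Num.sqrt (- model_speed2 K c t))%:E)%E.

Definition model_tau (K : R) (p q : model_pt) : \bar R :=
  maxe 0%E (ereal_sup
    [set model_length K c | c in [set c | model_causal_curve K c p q]]).

(* r lies on a side (a maximal segment) from p to q in L^2(K) *)
Definition model_on_side (K : R) (p q r : model_pt) :=
  exists c, [/\ model_causal_curve K c p q,
    model_length K c = model_tau K p q &
    exists2 t, 0 <= t <= 1 & c t = r].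

Definition model_diameter (K : R) : \bar R :=
  if K < 0 then (pi / Num.sqrt (- K))%:E else +oo%E.

End model_spaces.

Section comparison.
Context {R : realType} {X : lorentzian_prelength_space R}.

(* Causal relations are only required to be carried over, not reflected:
   two distinct null related vertices with the same time separations from
   the third one have the same comparison point. *)
Definition comparison_triangle (K : R) (p : 'I_3 -> X)
    (pb : 'I_3 -> @model_pt R) :=
  forall i j, [/\ chron (p i) (p j) -> model_ll K (pb i) (pb j),
                  causal (p i) (p j) -> model_le K (pb i) (pb j) &
                  model_tau K (pb i) (pb j) = tau (p i) (p j)].

(* vertices p; for i < j the side from p i to p j is c i j on [a i j, b i j] *)
Definition timelike_triangle (p : 'I_3 -> X) (c : 'I_3 -> 'I_3 -> R -> X)
    (a b : 'I_3 -> 'I_3 -> R) :=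
  (forall i j, (tau (p i) (p j) < +oo)%E) /\
  (forall i j : 'I_3, (i < j)%N ->
    [/\ chron (p i) (p j), fd_realizer (c i j) (a i j) (b i j),
        c i j (a i j) = p i & c i j (b i j) = p j]).

Definition triangle_in (U : set X) (p : 'I_3 -> X)
    (c : 'I_3 -> 'I_3 -> R -> X) (a b : 'I_3 -> 'I_3 -> R) :=
  (forall i, U (p i)) /\
  (forall i j : 'I_3, (i < j)%N ->
     forall t, a i j <= t <= b i j -> U (c i j t)).

Definition timelike_size_bounds (K : R) (p : 'I_3 -> X) :=
  forall i j : 'I_3, (i < j)%N -> (tau (p i) (p j) < model_diameter K)%E.

(* q lies on a side of the triangle and qb is the corresponding point *)
Definition corresponding_points (K : R) (p : 'I_3 -> X)
    (c : 'I_3 -> 'I_3 -> R -> X) (a b : 'I_3 -> 'I_3 -> R)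
    (pb : 'I_3 -> @model_pt R) (q : X) (qb : @model_pt R) :=
  exists i j : 'I_3, [/\ (i < j)%N,
    exists2 t, a i j <= t <= b i j & c i j t = q,
    model_on_side K (pb i) (pb j) qb &
    model_tau K (pb i) qb = tau (p i) q].

Definition curvature_comparison_set (K : R) (U : set X) :=
  [/\ open U, tau_finite_on U, tau_continuous_on U,
      strictly_timelike_geodesically_connected U &
      forall p c a b pb, timelike_triangle p c a b -> triangle_in U p c a b ->
        timelike_size_bounds K p -> comparison_triangle K p pb ->
        forall q1 q2 qb1 qb2,
          corresponding_points K p c a b pb q1 qb1 ->
          corresponding_points K p c a b pb q2 qb2 ->
          (tau q1 q2 <= model_tau K qb1 qb2)%E].

End comparison.

Definition timelike_curvature_bounded_below_by {R : realType}
    (X : lorentzian_prelength_space R) (K : R) :=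
  forall x : X, exists2 U, U x & curvature_comparison_set K U.

Definition timelike_curvature_bounded_below {R : realType}
    (X : lorentzian_prelength_space R) :=
  exists K : R, timelike_curvature_bounded_below_by X K.

Section angles.
Context {R : realType} {X : lorentzian_prelength_space R}.

Definition unit_velocity (p q : @model_pt R) : @model_pt R :=
  (Num.sqrt `|bform 1 (q - p) (q - p)|)^-1 *: (q - p).

Definition triple (x y z : X) (i : 'I_3) : X := nth x [:: x; y; z] i.

(* The value does not depend on the comparison triangle, which is unique up to
   isometry; xget picks it (0 is the junk value when there is none). *)
Definition comparison_angle (x y z : X) : R :=
  xget 0 [set w | exists2 pb, comparison_triangle 0 (triple x y z) pb &
    w = arcosh `|bform 1 (unit_velocity (pb 0) (pb 1))
                         (unit_velocity (pb 0) (pb 2))|].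

Definition finite_separations (x y z : X) :=
  forall i j, (tau (triple x y z i) (triple x y z j) < +oo)%E.

Definition angle_domain (alpha beta : R -> X) : set (R * R)%type :=
  [set st | [/\ 0 < st.1, 0 < st.2,
     causal (alpha st.1) (beta st.2) \/ causal (beta st.2) (alpha st.1) &
     finite_separations (alpha 0) (alpha st.1) (beta st.2)]].

(* s, t -> 0 inside angle_domain: only the germs of the curves at 0 matter *)
Definition angle_filter (alpha beta : R -> X) :=
  within (angle_domain alpha beta) (nbhs ((0, 0) : (R * R)%type)).

Definition angle_fun (alpha beta : R -> X) (st : (R * R)%type) : \bar R :=
  (comparison_angle (alpha 0) (alpha st.1) (beta st.2))%:E.

Definition upper_angle (alpha beta : R -> X) : \bar R :=
  limf_esup (angle_fun alpha beta) (angle_filter alpha beta).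

Definition angle_exists (alpha beta : R -> X) :=
  upper_angle alpha beta \is a fin_num /\
  angle_fun alpha beta @ angle_filter alpha beta --> upper_angle alpha beta.

End angles.

(* Main.v *)
Require Import Defs.
From mathcomp Require Import all_boot all_order all_algebra.
From mathcomp Require Import all_classical all_reals all_analysis.
From mathcomp Require Import measurable_realfun.
From mathcomp Require Import ring lra.

(** A comparison angle is the law of cosines of the Minkowski plane, evaluated on
    three time separations ([comparison_angleE]). An upper bound [w] for an upper
    angle is therefore an inequality between time separations along the two
    curves near [x] ([angle_bound], [mixed_bound]). Near [x] the time separation
    is finite and continuous, so that points at all small time separations from
    [x] can be chosen on each curve. Moreover, a bound on the angle of two future
    directed curves forces a point of one curve to precede a point of the other
    as soon as this is so in the corresponding Minkowski hinge
    ([angle_bound_chron]).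

    For the first inequality let [w1] and [w2] exceed the two angles on the right,
    and suppose that [w1 + w2] is less than the angle on the left. The latter is a
    limit, so the points may be chosen. In the Minkowski plane take vectors for
    [gamma], [alpha] and [beta], with the angle [w1 + w2] between the first two
    and [w1] between the last two, such that the end points are collinear and
    that of [alpha] is in the middle; and take points of the curves at the same
    distances from [x]. The three bounds say that the
    segment from [gamma] to [beta] is too short for the reverse triangle
    inequality with the point of [alpha] in the middle ([mixed_bound_add]).

    For the second inequality the geodesic [beta] is prolonged beyond [x] and run
    backwards, which gives a future directed curve [k] that is maximal near [x],
    and timelike because maximal curves are. Let [u], [s], [t] be small. The point
    [x] lies on the side from [beta u] to [k t] of a triangle with the third
    vertex [alpha s]. The curvature bound estimates the cevian from [x] to
    [alpha s] by that of the comparison triangle, for which Stewart's theorem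
    holds ([stewart_inequality]). In the first order in the time separation from
    [beta u] to [x] this is an inequality for the hinge of [alpha s] and [k t],
    and it says that the angle of [alpha] and [k] is at most that of [alpha] and
    [beta] ([stewart_first_order], [angle_bound_prolong]). The same holds for
    [gamma]. This reduces the claim to three future directed curves, the middle
    one being [k]: for points [alpha s] and [gamma u] with comparison angle greater
    than [w1 + w2], a point of [k] is chosen at the length where the hinge of angle
    [w1 + w2] is divided into the angles [w1] and [w2], and the reverse triangle
    inequality is violated ([angle_bound_add]).

    Triangle comparison needs the time separation of the model planes of every
    curvature. It is computed through the modified distance [mdK], for which
    everything is algebraic: along a causal curve the modified distance from a
    point in its past satisfies an eikonal inequality, which bounds the length of
    the curve ([eikonal], [causal_length_le]), and explicit geodesics attain the
    bound ([geodesicK]). Since the modified distances from the points of a timelike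
    geodesic depend affinely on two coordinates, thin triangles can be constructed
    by solving linear equations, and Stewart's theorem is the elimination of the
    coordinates ([thin_triangle]). *)

Set Implicit Arguments.
Unset Strict Implicit.
Unset Printing Implicit Defensive.

Import Order.TTheory GRing.Theory Num.Theory.
Import numFieldNormedType.Exports.

Local Open Scope classical_set_scope.
Local Open Scope ring_scope.

(** * Derivatives of explicit real functions *)

Section calculus.
Context {R : realType}.
Implicit Types (f g df dg : R -> R) (t a b c : R).

(** Sealed, because [is_derive] is a type class whose instances would be
    searched for goals with a derivative that is still to be determined. *)
Definition isder t f a : Prop := is_derive t 1 f a.

Lemma pos_below2 a b : 0 < a -> 0 < b -> exists2 e, 0 < e & e <= a /\ e <= b.
Proof.
by move=> a0 b0; exists (Num.min a b); [rewrite lt_min a0|rewrite !ge_min !lexx orbT].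
Qed.

Lemma pos_below3 a b c : 0 < a -> 0 < b -> 0 < c ->
  exists2 e, 0 < e & [/\ e <= a, e <= b & e <= c].
Proof.
move=> a0 b0 c0; have [d d0 [da db]] := pos_below2 a0 b0.
have [e e0 [ed ec]] := pos_below2 d0 c0.
by exists e => //; split => //; exact: le_trans ed _.
Qed.

Lemma isd_eq f t a b : isder t f a -> a = b -> isder t f b.
Proof. by move=> h <-. Qed.

Lemma isd_add f g t a b : isder t f a -> isder t g b ->
  isder t (fun s => f s + g s) (a + b).
Proof. by move=> hf hg; exact: (is_deriveD hf hg). Qed.

Lemma isd_opp f t a : isder t f a ->
  isder t (fun s => - f s) (- a).
Proof. by move=> hf; exact: (is_deriveN hf). Qed.

Lemma isd_mul f g t a b : isder t f a -> isder t g b ->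
  isder t (fun s => f s * g s) (a * g t + f t * b).
Proof.
move=> hf hg; have h := is_deriveM hf hg; apply: (isd_eq h).
by rewrite addrC /GRing.scale /= [g t * a]mulrC.
Qed.

Lemma isd_comp F g t a b : isder (g t) F a -> isder t g b ->
  isder t (fun s => F (g s)) (a * b).
Proof. by move=> hf hg; exact: (is_derive1_comp hf hg). Qed.

Lemma isd_inv f t a : f t != 0 -> isder t f a ->
  isder t (fun s => (f s)^-1) (- a / (f t) ^+ 2).
Proof.
move=> f0 hf; apply: (isd_eq (is_deriveV f0 hf)).
by rewrite /GRing.scale /= mulNr mulrC mulNr.
Qed.

Lemma isd_exp f n t a : isder t f a ->
  isder t (fun s => f s ^+ n) (n%:R * f t ^+ n.-1 * a).
Proof.
move=> hf; have -> : (fun s => f s ^+ n) = f ^+ n by rewrite exprfctE.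
have h := is_deriveX n hf; apply: (isd_eq h).
by rewrite /GRing.scale.
Qed.

Lemma isd_continuous f t a : isder t f a -> {for t, continuous f}.
Proof. by move=> h; apply/differentiable_continuous/derivable1_diffP; case: h. Qed.

Lemma isd_sqrt t : 0 < t -> isder t (@Num.sqrt R) (2 * Num.sqrt t)^-1.
Proof. exact: is_derive1_sqrt. Qed.

Lemma isd_derive1 f t a : isder t f a -> derive1 f t = a.
Proof. by move=> h; rewrite derive1E; case: h. Qed.

Lemma cts_mul f g t : {for t, continuous f} -> {for t, continuous g} ->
  {for t, continuous (fun s => f s * g s)}.
Proof. by move=> hf hg; exact: (continuousM hf hg). Qed.

Lemma cts_add f g t : {for t, continuous f} -> {for t, continuous g} ->
  {for t, continuous (fun s => f s + g s)}.
Proof. by move=> hf hg; exact: (continuousD hf hg). Qed.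

Lemma cts_opp f t : {for t, continuous f} -> {for t, continuous (fun s => - f s)}.
Proof. by move=> hf; exact: (continuousN hf). Qed.

Lemma cts_inv f t : f t != 0 -> {for t, continuous f} ->
  {for t, continuous (fun s => (f s)^-1)}.
Proof. by move=> f0 hf; exact: (continuousV f0 hf). Qed.

Lemma cts_comp (F : R -> R) f t : {for f t, continuous F} -> {for t, continuous f} ->
  {for t, continuous (fun s => F (f s))}.
Proof. by move=> hF hf; exact: (continuous_comp hf hF). Qed.

Lemma cts_exp f n t : {for t, continuous f} -> {for t, continuous (fun s => f s ^+ n)}.
Proof.
move=> hf; apply: (@cts_comp (fun x => x ^+ n)) => //; exact: exprn_continuous.
Qed.

Lemma isd_C1 f df : (forall t, isder t f (df t)) -> continuous df -> C1 f.
Proof.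
move=> hf cf; split=> [t|]; first by case: (hf t).
suff -> : derive1 f = df by [].
by apply/funext => t; exact: isd_derive1.
Qed.

Lemma C1_isd f : C1 f -> forall t, isder t f (derive1 f t).
Proof. by move=> [df _] t; rewrite derive1E; exact: derivableP. Qed.

Lemma C1_cts f : C1 f -> continuous f.
Proof. by move=> hf t; exact: isd_continuous (C1_isd hf t). Qed.

End calculus.

Ltac cts1 := match goal with
  | |- {for _, continuous (fun _ => ?c)} => exact: cst_continuous
  | |- {for _, continuous (fun x => x)} => exact: cvg_id
  | |- {for _, continuous (fun x => @?f x + @?g x)} => apply: (@cts_add _ f g)
  | |- {for _, continuous (fun x => - @?f x)} => apply: (@cts_opp _ f)
  | |- {for _, continuous (fun x => @?f x * @?g x)} => apply: (@cts_mul _ f g)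
  | |- {for _, continuous (fun x => (@?f x) ^+ ?n)} => apply: (@cts_exp _ f n)
  | |- {for _, continuous (fun x => (@?f x)^-1)} => apply: (@cts_inv _ f)
  | |- {for _, continuous (fun x => Num.sqrt (@?f x))} =>
      apply: (@cts_comp _ Num.sqrt f); [exact: sqrt_continuous|]
  | |- {for _, continuous (fun x => sin (@?f x))} =>
      apply: (@cts_comp _ sin f); [exact: continuous_sin|]
  | |- {for _, continuous (fun x => cos (@?f x))} =>
      apply: (@cts_comp _ cos f); [exact: continuous_cos|]
  | H : {for _, continuous _} |- {for _, continuous _} => solve [exact: H]
  | H : continuous _ |- {for _, continuous _} => solve [exact: H]
  end.
Ltac cts := repeat cts1.

Ltac isd1 := match goal with
  | |- isder _ (fun _ => ?c) _ => exact: (is_derive_cst c)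
  | |- isder _ (fun x => x) _ => exact: is_derive_id
  | |- isder _ (fun x => @?f x + @?g x) _ => apply: (@isd_add _ f g)
  | |- isder _ (fun x => - @?f x) _ => apply: (@isd_opp _ f)
  | |- isder _ (fun x => @?f x * @?g x) _ => apply: (@isd_mul _ f g)
  | |- isder _ (fun x => (@?f x) ^+ ?n) _ => apply: (@isd_exp _ f n)
  | |- isder _ (fun x => (@?f x)^-1) _ => apply: (@isd_inv _ f)
  | |- isder _ (fun x => expR (@?f x)) _ =>
      apply: (@isd_comp _ expR f); [exact: is_derive_expR|]
  | |- isder _ (fun x => sin (@?f x)) _ =>
      apply: (@isd_comp _ sin f); [exact: is_derive_sin|]
  | |- isder _ (fun x => cos (@?f x)) _ =>
      apply: (@isd_comp _ cos f); [exact: is_derive_cos|]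
  | |- isder _ (fun x => atan (@?f x)) _ =>
      apply: (@isd_comp _ atan f); [exact: is_derive1_atan|]
  | H : _ |- isder _ _ _ => solve [exact: H]
  end.
Ltac isd := repeat isd1.
Ltac isdeq := apply: isd_eq; [isd|cbv beta].

(** * Hyperbolic functions *)

Section hyperbolic.
Context {R : realType}.
Implicit Types x y t : R.

Lemma isd_sinh t : isder t (@sinh R) (cosh t).
Proof. by rewrite /sinh /cosh; isdeq; ring. Qed.

Lemma isd_cosh t : isder t (@cosh R) (sinh t).
Proof. by rewrite /sinh /cosh; isdeq; ring. Qed.

Lemma expR_mulN x : expR x * expR (- x) = 1 :> R.
Proof. by rewrite -expRD subrr expR0. Qed.

Lemma cosh2_sinh2 x : cosh x ^+ 2 = 1 + sinh x ^+ 2.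
Proof. by rewrite /cosh /sinh; have := expR_mulN x; lra. Qed.

Lemma sinhD x y : sinh (x + y) = sinh x * cosh y + cosh x * sinh y.
Proof. by rewrite /sinh /cosh opprD !expRD; field. Qed.

Lemma coshD x y : cosh (x + y) = cosh x * cosh y + sinh x * sinh y.
Proof. by rewrite /sinh /cosh opprD !expRD; field. Qed.

Lemma sinh0 : sinh 0 = 0 :> R.
Proof. by rewrite /sinh oppr0 subrr mul0r. Qed.

Lemma cosh0 : cosh 0 = 1 :> R.
Proof. by rewrite /cosh oppr0 expR0 -[1 + 1]/(2%:R) divff. Qed.

Lemma sinhN x : sinh (- x) = - sinh x.
Proof. by rewrite /sinh opprK; field. Qed.

Lemma coshN x : cosh (- x) = cosh x.
Proof. by rewrite /cosh opprK addrC. Qed.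

Lemma cosh_gt0 x : 0 < cosh x.
Proof. by rewrite divr_gt0 // addr_gt0 ?expR_gt0. Qed.

Lemma cosh_ge1 x : 1 <= cosh x.
Proof.
have h0 := cosh_gt0 x; have := cosh2_sinh2 x; have := sqr_ge0 (sinh x).
by nra.
Qed.

Lemma sinh_gt0 x : 0 < x -> 0 < sinh x.
Proof.
by move=> x0; rewrite divr_gt0 // subr_gt0 ltr_expR; lra.
Qed.

Lemma sinh_ge0 x : 0 <= x -> 0 <= sinh x.
Proof.
by rewrite le_eqVlt => /predU1P[<-|/sinh_gt0/ltW //]; rewrite sinh0.
Qed.

Lemma expR_coshDsinh x : expR x = cosh x + sinh x.
Proof. by rewrite /cosh /sinh; field. Qed.

Lemma ler_cosh x y : 0 <= x -> (x <= y) -> cosh x <= cosh y.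
Proof.
move=> x0 xy; have -> : y = x + (y - x) by ring.
rewrite coshD; have h1 := cosh_ge1 (y - x).
have h2 : 0 <= sinh (y - x) by apply: sinh_ge0; lra.
have := sinh_ge0 x0; have := cosh_gt0 x; nra.
Qed.

Lemma ltr_cosh x y : 0 <= x -> (x < y) -> cosh x < cosh y.
Proof.
move=> x0 xy; have -> : y = x + (y - x) by ring.
rewrite coshD; have h2 : 0 < sinh (y - x) by apply: sinh_gt0; lra.
have h3 := cosh2_sinh2 (y - x); have h4 := cosh_gt0 (y - x).
have h1 : 1 < cosh (y - x) by nra.
have := sinh_ge0 x0; have := cosh_gt0 x; nra.
Qed.

Lemma arcosh_aux y : 1 <= y -> 0 < y + Num.sqrt (y ^+ 2 - 1).
Proof. by move=> y1; have := sqrtr_ge0 (y ^+ 2 - 1); lra. Qed.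

Lemma cosh_arcosh y : 1 <= y -> cosh (arcosh y) = y.
Proof.
move=> y1; have h := arcosh_aux y1; rewrite /cosh /arcosh expRN lnK ?posrE //.
have h0 : 0 <= y ^+ 2 - 1 by nra.
have := sqr_sqrtr h0; move: (Num.sqrt _) h => s h hs.
have -> : (y + s)^-1 = y - s.
  by apply: (mulfI (lt0r_neq0 h)); rewrite divff ?lt0r_neq0 //; lra.
by field.
Qed.

Lemma arcosh_ge0 y : 1 <= y -> 0 <= arcosh y.
Proof.
by move=> y1; apply: ln_ge0; have := sqrtr_ge0 (y ^+ 2 - 1); lra.
Qed.

Lemma arcosh_lt y w : 1 <= y -> 0 <= w -> (arcosh y < w) = (y < cosh w).
Proof.
move=> y1 w0; apply/idP/idP => h.
  by rewrite -[y]cosh_arcosh //; apply: ltr_cosh => //; exact: arcosh_ge0.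
rewrite ltNge; apply/negP => h2; move: h; rewrite ltNge => /negP; apply.
by rewrite -[y]cosh_arcosh //; exact: ler_cosh.
Qed.

Lemma arcosh_gt y w : 1 <= y -> 0 <= w -> (w < arcosh y) = (cosh w < y).
Proof.
move=> y1 w0; apply/idP/idP => h.
  by rewrite -[y]cosh_arcosh //; apply: ltr_cosh.
rewrite ltNge; apply/negP => h2; move: h; rewrite ltNge => /negP; apply.
by rewrite -[y]cosh_arcosh //; apply: ler_cosh => //; exact: arcosh_ge0.
Qed.

Lemma isd_arcosh y : 1 < y ->
  isder y (@arcosh R) (Num.sqrt (y ^+ 2 - 1))^-1.
Proof.
move=> y1; have h0 : 0 < y ^+ 2 - 1 by nra.
have h := arcosh_aux (ltW y1).
rewrite /arcosh; apply: isd_eq.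
  apply: (@isd_comp _ (@ln R) (fun x => x + Num.sqrt (x ^+ 2 - 1))).
    exact: is_derive1_ln.
  apply: isd_add; first by isd.
  apply: (@isd_comp _ (@Num.sqrt R) (fun x => x ^+ 2 - 1)).
    exact: isd_sqrt.
  by isd.
have := sqrtr_gt0 (y ^+ 2 - 1); rewrite h0 => s0; move: (Num.sqrt _) h s0 => s h s0.
rewrite /= expr1; field; apply/andP; split; apply: lt0r_neq0 => //; lra.
Qed.

End hyperbolic.

Ltac isd2 := first [ isd1 | match goal with
  | |- isder _ (fun x => sinh (@?f x)) _ =>
      apply: (@isd_comp _ sinh f); [exact: isd_sinh|]
  | |- isder _ (fun x => cosh (@?f x)) _ =>
      apply: (@isd_comp _ cosh f); [exact: isd_cosh|] end ].
Ltac isd ::= repeat isd2.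

Ltac cts2 := first [ cts1 | match goal with
  | |- {for _, continuous (fun x => sinh (@?f x))} =>
      apply: (@cts_comp _ sinh f); [exact: isd_continuous (isd_sinh _)|]
  | |- {for _, continuous (fun x => cosh (@?f x))} =>
      apply: (@cts_comp _ cosh f); [exact: isd_continuous (isd_cosh _)|] end ].
Ltac cts ::= repeat cts2.

(** * Trigonometry of constant curvature *)

Section constant_curvature_trigonometry.
Context {R : realType} (K : R).
Let k : R := Num.sqrt `|K|.
Implicit Types x y t : R.

(** The solutions of [f'' = K f] with initial values [(0, 1)] and [(1, 0)],
    and the primitive [mdK] of [snK], the modified distance. In it all formulas
    below are algebraic, and uniform in the sign of [K]. *)
Definition snK t : R :=
  if K == 0 then t else if 0 < K then sinh (k * t) / k else sin (k * t) / k.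
Definition csK t : R :=
  if K == 0 then 1 else if 0 < K then cosh (k * t) else cos (k * t).
Definition mdK t : R := if K == 0 then t ^+ 2 / 2 else (csK t - 1) / K.

Lemma k_sq : k ^+ 2 = `|K|.
Proof. by rewrite sqr_sqrtr. Qed.

Lemma k_gt0 : K != 0 -> 0 < k.
Proof. by move=> K0; rewrite sqrtr_gt0 normr_gt0. Qed.

Lemma k_ge0 : 0 <= k.
Proof. exact: sqrtr_ge0. Qed.

Lemma K_pos : 0 < K -> K = k ^+ 2.
Proof. by move=> K0; rewrite k_sq gtr0_norm. Qed.

Lemma K_neg : K < 0 -> K = - k ^+ 2.
Proof. by move=> K0; rewrite k_sq ltr0_norm ?opprK. Qed.

Lemma csKE t : csK t = 1 + K * mdK t.
Proof. by rewrite /csK /mdK; case: eqP => [->|/eqP K0]; [ring|rewrite /csK; case: eqP K0 => // ? _; field; apply/eqP]. Qed.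

Lemma isd_snK t : isder t snK (csK t).
Proof.
rewrite /snK /csK; case: eqP => [_|/eqP K0]; first exact: is_derive_id.
by have k0 := k_gt0 K0; case: ifP => _; isdeq; field; exact: lt0r_neq0.
Qed.

Lemma isd_csK t : isder t csK (K * snK t).
Proof.
rewrite /snK /csK; case: eqP => [->|/eqP K0].
  by rewrite mul0r; exact: is_derive_cst.
have k0 := k_gt0 K0; have [Kp|Kp|/eqP] := ltgtP K 0; last by rewrite (negbTE K0).
- by rewrite {1}(K_neg Kp); isdeq; field; exact: lt0r_neq0.
- by rewrite {1}(K_pos Kp); isdeq; field; exact: lt0r_neq0.
Qed.

Lemma isd_mdK t : isder t mdK (snK t).
Proof.
have [K0|K0] := eqVneq K 0.
  by rewrite /mdK /snK K0 eqxx; isdeq; field.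
have hc := isd_csK; rewrite /mdK (negbTE K0); isdeq.
by field.
Qed.

Lemma snK0 : snK 0 = 0.
Proof.
rewrite /snK; case: ifP => // _; case: ifP => _;
by rewrite mulr0 ?sinh0 ?sin0 mul0r.
Qed.

Lemma csK0 : csK 0 = 1.
Proof.
rewrite /csK; case: ifP => // _; case: ifP => _;
by rewrite mulr0 ?cosh0 ?cos0.
Qed.

Lemma mdK0 : mdK 0 = 0.
Proof.
rewrite /mdK csK0 subrr mul0r; case: ifP => // _; ring.
Qed.

Lemma snKN t : snK (- t) = - snK t.
Proof.
rewrite /snK; case: ifP => // _; case: ifP => _;
by rewrite mulrN ?sinhN ?sinN mulNr.
Qed.

Lemma csKN t : csK (- t) = csK t.
Proof.
rewrite /csK; case: ifP => // _; case: ifP => _;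
by rewrite mulrN ?coshN ?cosN.
Qed.

Lemma mdKN t : mdK (- t) = mdK t.
Proof. by rewrite /mdK csKN sqrrN. Qed.

Lemma snKD x y : snK (x + y) = snK x * csK y + csK x * snK y.
Proof.
rewrite /snK /csK; case: ifP => [_|/negbT K0]; first by ring.
have k0 := k_gt0 K0; case: ifP => _; rewrite mulrDr ?sinhD ?sinD; field;
exact: lt0r_neq0.
Qed.

Lemma csKD x y : csK (x + y) = csK x * csK y + K * snK x * snK y.
Proof.
rewrite /snK /csK; case: eqP => [->|/eqP K0]; first by ring.
have k0 := k_gt0 K0; have [Kp|Kp|/eqP] := ltgtP K 0; last by rewrite (negbTE K0).
- by rewrite {1}(K_neg Kp) mulrDr cosD; field; exact: lt0r_neq0.
- by rewrite {1}(K_pos Kp) mulrDr coshD; field; exact: lt0r_neq0.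
Qed.

Lemma mdKD x y : mdK (x + y) = mdK x * csK y + snK x * snK y + mdK y.
Proof.
have [K0|K0] := eqVneq K 0.
  by rewrite /mdK /snK /csK K0 eqxx; field.
apply: (mulfI K0); rewrite !mulrDr; have := csKD x y.
by rewrite !csKE; lra.
Qed.

Lemma snK_sq t : snK t ^+ 2 = 2 * mdK t + K * mdK t ^+ 2.
Proof.
have := mdKD t (- t); rewrite subrr mdK0 csKN snKN mdKN csKE; lra.
Qed.

Lemma csK_sq t : csK t ^+ 2 = 1 + K * snK t ^+ 2.
Proof. by rewrite snK_sq csKE; ring. Qed.

(** Less than a quarter of the period for [K < 0]. For nonnegative [t] in this
    range [csK] is positive and [mdK] is increasing. *)
Definition smallK t := K < 0 -> k * t < pi / 2.

Lemma smallKW x y : x <= y -> smallK y -> smallK x.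
Proof. by move=> xy h /h; apply: le_lt_trans; rewrite ler_wpM2l // k_ge0. Qed.

Lemma smallK0 : smallK 0.
Proof. by move=> _; rewrite mulr0 divr_gt0 // pi_gt0. Qed.

Lemma csK_gt0 t : smallK t -> smallK (- t) -> 0 < csK t.
Proof.
rewrite /smallK /csK => h1 h2; have [Kp|Kp|//] := ltgtP K 0; last exact: cosh_gt0.
apply: cos_gt0_pihalf; move: (h1 Kp) (h2 Kp); lra.
Qed.

Lemma snK_gt0 t : 0 < t -> smallK t -> 0 < snK t.
Proof.
rewrite /smallK /snK => t0 h; case: ifP => // /negbT K0; have k0 := k_gt0 K0.
have [Kp|Kp|/eqP] := ltgtP K 0; last (by rewrite (negbTE K0)); rewrite divr_gt0 //; last by apply/sinh_gt0/mulr_gt0.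
by apply: sin_gt0_pi; rewrite mulr_gt0 //=; have := pi_gt0 R; move: (h Kp); lra.
Qed.

Lemma snK_ge0 t : 0 <= t -> smallK t -> 0 <= snK t.
Proof.
by rewrite le_eqVlt => /predU1P[<- _|t0 /(snK_gt0 t0)/ltW //]; rewrite snK0.
Qed.

Lemma smallKN t : 0 <= t -> smallK (- t).
Proof. by move=> t0; apply: smallKW smallK0; rewrite oppr_le0. Qed.

Lemma mdK_ltr x y : 0 <= x -> x < y -> smallK y -> mdK x < mdK y.
Proof.
move=> x0 xy hy.
have [|c] := @MVT R mdK snK x y xy (fun z _ => isd_mdK z).
  by apply: continuous_subspaceT => z; exact: isd_continuous (isd_mdK z).
rewrite in_itv /= => /andP[c1 c2] h.
rewrite -subr_gt0 h mulr_gt0 ?subr_gt0 // snK_gt0 //; first lra.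
by apply: smallKW hy; exact: ltW.
Qed.

Lemma mdK_ler x y : 0 <= x -> x <= y -> smallK y -> mdK x <= mdK y.
Proof.
move=> x0; rewrite le_eqVlt => /predU1P[-> //|xy hy]; exact/ltW/mdK_ltr.
Qed.

Lemma mdK_lerI x y : 0 <= y -> smallK x -> mdK x <= mdK y -> x <= y.
Proof.
move=> y0 hx h; rewrite leNgt; apply/negP => yx.
by have := mdK_ltr y0 yx hx; rewrite ltNge h.
Qed.

Lemma mdK_gt0 x : 0 < x -> smallK x -> 0 < mdK x.
Proof. by move=> x0 hx; rewrite -mdK0; exact: mdK_ltr. Qed.

(** The inverse of [mdK] on the range [smallK]. *)
Definition invmdK (f : R) : R :=
  if K == 0 then Num.sqrt (2 * f) else
  if 0 < K then arcosh (1 + K * f) / k else acos (1 + K * f) / k.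

Lemma isd_invmdK f : 0 < f -> 0 < 1 + K * f ->
  isder f invmdK (Num.sqrt (2 * f + K * f ^+ 2))^-1.
Proof.
move=> f0 h; rewrite /invmdK; case: eqP => [->|/eqP K0].
  rewrite mul0r addr0; apply: isd_eq.
    apply: (@isd_comp _ (@Num.sqrt R) (fun x => 2 * x)); first by apply: isd_sqrt; lra.
    by isd.
  have := sqrtr_gt0 (2 * f); rewrite (_ : 0 < 2 * f); last by lra.
  by move: (Num.sqrt _) => s s0; field; exact: lt0r_neq0.
have k0 := k_gt0 K0; have [Kp|Kp|/eqP] := ltgtP K 0; last by rewrite (negbTE K0).
- have Kf : K * f < 0 by rewrite nmulr_rlt0.
  have hK : 0 < 1 - (1 + K * f) ^+ 2 by nra.
  apply: isd_eq.
    apply: (@isd_mul _ (fun x => acos (1 + K * x)) (fun=> k^-1)); last by isd.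
    apply: (@isd_comp _ (@acos R) (fun x => 1 + K * x)); last by isd.
    by apply: is_derive1_acos; nra.
  have -> : 1 - (1 + K * f) ^+ 2 = k ^+ 2 * (2 * f + K * f ^+ 2) by rewrite (K_neg Kp); ring.
  rewrite sqrtrM ?sqr_ge0 // sqrtr_sqr ger0_norm ?k_ge0 //.
  have -> : 0 + (0 * f + K * 1) = - k ^+ 2 by rewrite -(K_neg Kp); ring.
  have : 0 < Num.sqrt (2 * f + K * f ^+ 2) by rewrite sqrtr_gt0; nra.
  by move: (Num.sqrt (2 * f + _)) => s s0; field; rewrite !lt0r_neq0.
- apply: isd_eq.
    apply: (@isd_mul _ (fun x => arcosh (1 + K * x)) (fun=> k^-1)); last by isd.
    apply: (@isd_comp _ (@arcosh R) (fun x => 1 + K * x)); last by isd.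
    by apply: isd_arcosh; nra.
  have -> : (1 + K * f) ^+ 2 - 1 = k ^+ 2 * (2 * f + K * f ^+ 2) by rewrite (K_pos Kp); ring.
  rewrite sqrtrM ?sqr_ge0 // sqrtr_sqr ger0_norm ?k_ge0 //.
  have -> : 0 + (0 * f + K * 1) = k ^+ 2 by rewrite -(K_pos Kp); ring.
  have : 0 < Num.sqrt (2 * f + K * f ^+ 2) by rewrite sqrtr_gt0; nra.
  by move: (Num.sqrt (2 * f + _)) => s s0; field; rewrite !lt0r_neq0.
Qed.

Lemma invmdK_ge0 f : 0 <= f -> 0 < 1 + K * f -> 0 <= invmdK f.
Proof.
move=> f0 h; rewrite /invmdK; case: ifP => [_|/negbT K0]; first exact: sqrtr_ge0.
have k0 := k_gt0 K0; have [Kp|Kp|/eqP] := ltgtP K 0; last (by rewrite (negbTE K0)); rewrite divr_ge0 ?k_ge0 //.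
- by apply: acos_ge0; nra.
- by apply: arcosh_ge0; nra.
Qed.

Lemma invmdKK f : 0 <= f -> 0 < 1 + K * f -> mdK (invmdK f) = f.
Proof.
move=> f0 h; rewrite /invmdK /mdK /csK.
case: eqP => [K0|/eqP K0]; first by rewrite sqr_sqrtr; [field|lra].
have k0 := k_gt0 K0; have kk z : k * (z / k) = z by field; exact: lt0r_neq0.
have [Kp|Kp|] := ltgtP K 0; last by move/eqP; rewrite (negbTE K0).
- by rewrite kk acosK; [field|rewrite in_itv /=; nra].
- by rewrite kk cosh_arcosh; [field|nra].
Qed.

Lemma smallK_invmdK f : 0 <= f -> 0 < 1 + K * f -> smallK (invmdK f).
Proof.
move=> f0 h Kn; rewrite /invmdK; have K0 : K != 0 by lra.
rewrite (negbTE K0) [0 < K]lt_gtF //; have k0 := k_gt0 K0.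
have -> : k * (acos (1 + K * f) / k) = acos (1 + K * f) by field; exact: lt0r_neq0.
rewrite ltNge; apply/negP => hp.
have hb : -1 <= 1 + K * f <= 1 by nra.
have := acosK (x := 1 + K * f); rewrite in_itv /= => /(_ hb) ha.
have : cos (acos (1 + K * f)) <= cos (pi / 2).
    have hpi := pi_gt0 R; rewrite leNgt; apply/negP.
  by rewrite ltr_cos ?in_itv /= ?acos_ge0 ?acos_lepi //; lra.
by rewrite cos_pihalf ha; lra.
Qed.

(** [snK t / t] tends to [1] because [csK 0 = 1]. *)
Lemma near0_snK (e : R) : 0 < e -> exists2 d : R, 0 < d &
  smallK d /\ forall t, 0 <= t -> t <= d ->
    t <= (1 + e) * snK t /\ snK t <= (1 + e) * t.
Proof.
move=> e0; have e1 : (1 + e)^-1 < 1 by rewrite invf_lt1; lra.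
have cc : {for 0, continuous csK} by exact: isd_continuous (isd_csK 0).
have [d d0 hd] : exists2 d : R, 0 < d & forall t, `|t| < d ->
    (1 + e)^-1 < csK t < 1 + e.
  have : \forall t \near 0, (1 + e)^-1 < csK t < 1 + e.
    have [h1 h2] : (\forall t \near 0, csK t > (1 + e)^-1) /\
                   (\forall t \near 0, csK t < 1 + e).
      split; first by apply: (cvgr_gt (csK 0) cc); rewrite csK0.
      by apply: (cvgr_lt (csK 0) cc); rewrite csK0; lra.
    by near=> t; apply/andP; split; near: t.
  move=> /nbhs_ballP [d /= d0 hd]; exists d => // t td; apply: hd.
  by rewrite /ball /= sub0r normrN.
have [d' d'0 hd'] : exists2 d' : R, 0 < d' & smallK d'.
  exists (pi / 2 / (k + 1)).
    by rewrite !divr_gt0 ?pi_gt0 // ltr_wpDl // k_ge0.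
  move=> _; have := pi_gt0 R; have := k_ge0 => h1 h2.
  by rewrite mulrA ltr_pdivrMr; [nra|lra].
exists (Num.min (d / 2) d'); first by rewrite lt_min d'0 andbT; lra.
split; first by apply: smallKW hd'; rewrite ge_min lexx orbT.
move=> t t0; rewrite le_min => /andP[td _].
have [->|tn0] := eqVneq t 0; first by rewrite snK0 !mulr0 lexx.
have {}t0 : 0 < t by rewrite lt_def tn0.
have [|c] := @MVT R snK csK 0 t t0 (fun z _ => isd_snK z).
  by apply: continuous_subspaceT => z; exact: isd_continuous (isd_snK z).
rewrite in_itv /= => /andP[c1 c2]; rewrite snK0 !subr0 => ->.
have : `|c| < d by rewrite gtr0_norm //; lra.
move=> /hd /andP[h1 h2]; have h3 : 1 < (1 + e) * csK c by rewrite -ltr_pdivrMl ?mulr1; lra.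
by split; nra.
Unshelve. all: by end_near.
Qed.

(** To leading order the law of cosines of curvature [K] is that of the
    Minkowski plane. This holds uniformly in the ratio of the sides, because
    [mdK (a - b) - mdK c] is compared with [((a - b)^2 - c^2) / 2] as a whole
    and the product of the two sides is estimated separately; the errors are
    absorbed by the gap between [W'] and [W]. *)
Lemma law_of_cosines_small (W' W : R) : 1 <= W' -> W' < W ->
  exists2 d : R, 0 < d & smallK d /\ forall a b c, 0 <= a -> a <= d ->
    0 <= b -> b <= d -> 0 <= c ->
    mdK (a - b) - snK a * snK b * (W' - 1) <= mdK c ->
    a ^+ 2 + b ^+ 2 - 2 * a * b * W <= c ^+ 2.
Proof.
(* [snK] and [mdK] are distorted by at most [1 + e]; three such factors are
   bounded by [1 + 7 e], which is at most [W / W']. *)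
move=> W1 W'W; pose e := Num.min 1 ((W - W') / (7 * W')).
have e0 : 0 < e by rewrite lt_min ltr01 divr_gt0 ?mulr_gt0; lra.
have e1 : e <= 1 by rewrite ge_min lexx.
have e2 : 7 * e * W' <= W - W'.
  have : e <= (W - W') / (7 * W') by rewrite ge_min lexx orbT.
  by rewrite ler_pdivlMr; [lra|lra].
have [d d0 [sd hd]] := near0_snK e0; exists d => //; split => // a b c a0 ad b0 bd c0.
wlog ab : a b a0 ad b0 bd / b <= a.
  move=> hw h; have [ba|ab] := leP b a; first exact: (hw a b).
  have := hw b a b0 bd a0 ad (ltW ab); rewrite -mdKN opprB => h'.
  have {}h' : b ^+ 2 + a ^+ 2 - 2 * b * a * W <= c ^+ 2.
    by apply: h'; rewrite [snK b * _]mulrC.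
  by lra.
move=> h; have [cd|dc] := leP (a - b) c.
  have : (a - b) ^+ 2 <= c ^+ 2 by rewrite ler_pXn2r ?nnegrE //; lra.
  have h1 : 0 <= a * b * (W - 1).
    by apply: mulr_ge0; [exact: mulr_ge0|lra].
  by lra.
have hS : snK a * snK b <= (1 + e) ^+ 2 * (a * b).
  have [_ h1] := hd a a0 ad; have [_ h2] := hd b b0 bd.
  have h3 : 0 <= snK a by apply: snK_ge0 => //; exact: smallKW ad sd.
  have h4 : 0 <= snK b by apply: snK_ge0 => //; exact: smallKW bd sd.
  by have := ler_pM h3 h4 h1 h2; lra.
have hM : ((a - b) ^+ 2 - c ^+ 2) / 2 <= (1 + e) * (mdK (a - b) - mdK c).
  have hm := isd_mdK.
  have [||z] := @MVT R (fun t => (1 + e) * mdK t - t ^+ 2 / 2)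
    (fun t => (1 + e) * snK t - t) c (a - b) dc.
  - by move=> z _; change (isder z (fun t => (1 + e) * mdK t - t ^+ 2 / 2)
      ((1 + e) * snK z - z)); isdeq; field.
  - apply: continuous_subspaceT => z; apply: isd_continuous; isd.
  rewrite in_itv /= => /andP[z1 z2] hz.
  have [||h1 _] := hd z; [lra|lra|].
  by have := @mulr_ge0 R ((1 + e) * snK z - z) (a - b - c); lra.
have he3 : (1 + e) ^+ 3 <= 1 + 7 * e by nra.
have h5 : (1 + e) * (snK a * snK b * (W' - 1)) <= (1 + e) ^+ 3 * (a * b) * (W' - 1).
  have := @ler_wpM2r R ((1 + e) * (W' - 1)) _ _ _ hS; rewrite mulr_ge0; lra.
have h6 : (1 + e) ^+ 3 * (W' - 1) <= W - 1.
  by have := @ler_wpM2r R (W' - 1) _ _ _ he3; nra.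
have h7 : (1 + e) ^+ 3 * (W' - 1) * (a * b) <= (W - 1) * (a * b).
  by apply: ler_wpM2r => //; exact: mulr_ge0.
by nra.
Qed.

End constant_curvature_trigonometry.

(** * Speed and length in the model planes *)

Section model_plane.
Context {R : realType} (K : R).
Let k : R := Num.sqrt `|K|.
Notation model_pt := (@model_pt R).
Implicit Types (p q : model_pt) (c : R -> model_pt) (s t x : R).

Lemma bform21 (v w : 'rV[R]_2) :
  bform 1 v w = - (v 0 0 * w 0 0) + v 0 1 * w 0 1.
Proof.
rewrite /bform [X in - X + _]big_mkcond [X in _ + X]big_mkcond /=.
rewrite !big_ord_recl !big_ord0 /= !addr0 !add0r.
by congr (- (v 0 _ * w 0 _) + v 0 _ * w 0 _); exact: val_inj.
Qed.

Lemma bform_row n m (F G : nat -> R) :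
  bform m (\row_(i < n) F i) (\row_(i < n) G i) =
  - (\sum_(i < n | (i < m)%N) F i * G i) + \sum_(i < n | (m <= i)%N) F i * G i.
Proof. by congr (- _ + _); apply: eq_bigr => i _; rewrite !mxE. Qed.

(** Squared speed in the coordinates: the metric is [-dt^2 + dx^2],
    [r^2 (-dt^2 + cosh^2 t dx^2)] or [r^2 (-cosh^2 x dt^2 + dx^2)]. *)
Definition time_part c s (t' x' : R) : R :=
  if K == 0 then t' else if 0 < K then t' / k else cosh (c s 0 1) * t' / k.
Definition space_part c s (t' x' : R) : R :=
  if K == 0 then x' else if 0 < K then cosh (c s 0 0) * x' / k else x' / k.

Lemma model_speed2E c s t' x' :
  isder s (fun u => c u 0 0) t' -> isder s (fun u => c u 0 1) x' ->
  model_speed2 K c s = space_part c s t' x' ^+ 2 - time_part c s t' x' ^+ 2.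
Proof.
move=> ht hx; rewrite /model_speed2 /model_velocity.
pose l p : seq R := if K == 0 then [:: p 0 0; p 0 1]
     else if 0 < K then [:: k^-1 * sinh (p 0 0);
       k^-1 * (cosh (p 0 0) * cos (p 0 1)); k^-1 * (cosh (p 0 0) * sin (p 0 1))]
     else [:: k^-1 * (cosh (p 0 1) * cos (p 0 0));
       k^-1 * (cosh (p 0 1) * sin (p 0 0)); k^-1 * sinh (p 0 1)].
have -> : (\row_i derive1 (fun u => model_cover K (c u) 0 i) s) =
    \row_(i < (K != 0).+2) derive1 (fun u => nth 0 (l (c u)) i) s.
  by apply/rowP => i; rewrite !mxE; congr (derive1 _ s); apply/funext => u; rewrite mxE.
rewrite (bform_row (K != 0).+2 _ (fun i => derive1 (fun u => nth 0 (l (c u)) i) s)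
  (fun i => derive1 (fun u => nth 0 (l (c u)) i) s)).
rewrite [X in - X + _]big_mkcond [X in _ + X]big_mkcond /=.
rewrite /time_part /space_part /l; have [K0|K0] := eqVneq K 0.
  rewrite K0 ltxx !big_ord_recl !big_ord0 /=.
  by rewrite (isd_derive1 ht) (isd_derive1 hx); ring.
have k0 := k_gt0 K0; rewrite !big_ord_recl !big_ord0 /=.
have [Kp|Kp|/eqP] := ltgtP K 0; last by rewrite (negbTE K0).
- rewrite /bump /=.
  have h0 : isder s (fun u => k^-1 * (cosh (c u 0 1) * cos (c u 0 0)))
    (k^-1 * (sinh (c s 0 1) * x' * cos (c s 0 0) - cosh (c s 0 1) * sin (c s 0 0) * t')).
    by isdeq; ring.
  have h1 : isder s (fun u => k^-1 * (cosh (c u 0 1) * sin (c u 0 0)))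
    (k^-1 * (sinh (c s 0 1) * x' * sin (c s 0 0) + cosh (c s 0 1) * cos (c s 0 0) * t')).
    by isdeq; ring.
  have h2 : isder s (fun u => k^-1 * sinh (c u 0 1)) (k^-1 * (cosh (c s 0 1) * x')).
    by isdeq; ring.
  rewrite (isd_derive1 h0) (isd_derive1 h1) (isd_derive1 h2).
  have := cosh2_sinh2 (c s 0 1); have := cos2Dsin2 (c s 0 0).
  move: (sinh _) (cosh _) (sin _) (cos _) => S C A B e1 e2.
  rewrite [RHS](_ : _ = k^-1 ^+ 2 * (x' ^+ 2 - C ^+ 2 * t' ^+ 2)); last by ring.
  rewrite [LHS](_ : _ = k^-1 ^+ 2 * (C ^+ 2 * x' ^+ 2 -
    (B ^+ 2 + A ^+ 2) * (S ^+ 2 * x' ^+ 2 + C ^+ 2 * t' ^+ 2))); last by ring.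
  by rewrite e1 e2; ring.
- rewrite /bump /=.
  have h0 : isder s (fun u => k^-1 * sinh (c u 0 0)) (k^-1 * (cosh (c s 0 0) * t')).
    by isdeq; ring.
  have h1 : isder s (fun u => k^-1 * (cosh (c u 0 0) * cos (c u 0 1)))
    (k^-1 * (sinh (c s 0 0) * t' * cos (c s 0 1) - cosh (c s 0 0) * sin (c s 0 1) * x')).
    by isdeq; ring.
  have h2 : isder s (fun u => k^-1 * (cosh (c u 0 0) * sin (c u 0 1)))
    (k^-1 * (sinh (c s 0 0) * t' * sin (c s 0 1) + cosh (c s 0 0) * cos (c s 0 1) * x')).
    by isdeq; ring.
  rewrite (isd_derive1 h0) (isd_derive1 h1) (isd_derive1 h2).
  have := cosh2_sinh2 (c s 0 0); have := cos2Dsin2 (c s 0 1).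
  move: (sinh _) (cosh _) (sin _) (cos _) => S C A B e1 e2.
  rewrite [RHS](_ : _ = k^-1 ^+ 2 * (C ^+ 2 * x' ^+ 2 - t' ^+ 2)); last by ring.
  rewrite [LHS](_ : _ = k^-1 ^+ 2 * ((B ^+ 2 + A ^+ 2) *
    (S ^+ 2 * t' ^+ 2 + C ^+ 2 * x' ^+ 2) - C ^+ 2 * t' ^+ 2)); last by ring.
  by rewrite e1 e2; ring.
Qed.

Lemma invmdK_mdK (e : R) : 0 < e -> smallK K e -> invmdK K (mdK K e) = e.
Proof.
move=> e0 se; have m0 := ltW (mdK_gt0 e0 se).
have h : 0 < 1 + K * mdK K e.
  by rewrite -csKE; apply: csK_gt0 => //; apply: smallKN; exact: ltW.
have eqm := invmdKK m0 h; have g0 := invmdK_ge0 m0 h; have sg := smallK_invmdK m0 h.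
apply: le_anti; apply/andP; split; apply: (@mdK_lerI _ K) => //; rewrite ?eqm //; exact: ltW.
Qed.

Lemma integral_isd (F f : R -> R) :
  (forall s, 0 <= s <= 1 -> isder s F (f s)) ->
  {within `[0, 1], continuous f} ->
  (\int[lebesgue_measure]_(s in `[0%R, 1%R]) (f s)%:E)%E = (F 1 - F 0)%:E.
Proof.
move=> hF cf; rewrite (@continuous_FTC2 _ f F) //.
- split => [s|| ].
  + by rewrite in_itv /= => /andP[s0 s1]; case: (hF s); rewrite ?ltW.
  + by apply/cvg_at_right_filter/isd_continuous/hF; rewrite lexx ler01.
  + by apply/cvg_at_left_filter/isd_continuous/hF; rewrite lexx ler01.
- move=> s; rewrite in_itv /= => /andP[s0 s1].
  by apply: isd_derive1; apply: hF; rewrite !ltW.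
Qed.

(** The function [m] stands for the modified distance from a point at time
    [e] before the start of a curve of speed [w]. The last inequality says that
    the distance [invmdK (m s)] grows at least with speed [w]; the square root
    in the derivative of [invmdK] is harmless since [m] is positive. *)
Lemma length_bound (w m m' : R -> R) (e : R) :
  0 < e -> smallK K e -> m 0 = mdK K e ->
  continuous w -> continuous m' -> (forall s, isder s m (m' s)) ->
  (forall s, 0 <= s <= 1 -> [/\ 0 < m s, 0 < 1 + K * m s, 0 <= w s, 0 <= m' s &
     w s ^+ 2 * (2 * m s + K * m s ^+ 2) <= m' s ^+ 2]) ->
  exists L : R, [/\ 0 <= L, smallK K (L + e),
    (\int[lebesgue_measure]_(s in `[0%R, 1%R]) (w s)%:E)%E = L%:E &
    mdK K (L + e) <= m 1].
Proof.
move=> e0 se m0 cw cm' dm h.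
have h2 s : 0 <= s <= 1 -> 0 < 2 * m s + K * m s ^+ 2.
  by move=> /h[a b _ _ _]; nra.
pose rho' s := (Num.sqrt (2 * m s + K * m s ^+ 2))^-1 * m' s.
have dr s : 0 <= s <= 1 -> isder s (fun u => invmdK K (m u)) (rho' s).
  by move=> s01; have [a b _ _ _] := h s s01; apply: isd_comp => //; exact: isd_invmdK.
have cr : {within `[0, 1], continuous rho'}.
  apply: continuous_in_subspaceT => s; rewrite inE /= in_itv /= => s01.
  have cms : {for s, continuous m} by exact: isd_continuous (dm s).
  change {for s, continuous rho'}; rewrite /rho'; cts; by rewrite lt0r_neq0 // sqrtr_gt0 h2.
have Ir := integral_isd dr cr.
have wr s : 0 <= s <= 1 -> w s <= rho' s.
  move=> s01; have [_ _ w0 m'0 ineq] := h s s01; have hs := h2 s s01.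
  rewrite /rho' mulrC ler_pdivlMr ?sqrtr_gt0 //.
  rewrite -(@ler_pXn2r _ 2) ?nnegrE ?mulr_ge0 ?sqrtr_ge0 //.
  by rewrite exprMn sqr_sqrtr // ltW.
have iw : (\int[lebesgue_measure]_(s in `[0%R, 1%R]) (w s)%:E <=
          (invmdK K (m 1) - invmdK K (m 0))%:E)%E.
  rewrite -Ir; apply: ge0_le_integral => //.
  - by move=> s /=; rewrite in_itv /= lee_fin => /h[].
  - by apply/measurable_EFinP; apply: subspace_continuous_measurable_fun => //; exact: continuous_subspaceT.
  - by apply/measurable_EFinP; exact: subspace_continuous_measurable_fun.
have iw0 : (0 <= \int[lebesgue_measure]_(s in `[0%R, 1%R]) (w s)%:E)%E.
  by apply: integral_ge0 => s /=; rewrite in_itv /= lee_fin => /h[].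
have fw : (\int[lebesgue_measure]_(s in `[0%R, 1%R]) (w s)%:E)%E \is a fin_num.
  by rewrite ge0_fin_numE //; apply: le_lt_trans iw _; rewrite ltry.
exists (fine (\int[lebesgue_measure]_(s in `[0%R, 1%R]) (w s)%:E)%E).
have [a b _ _ _] : [/\ 0 < m 1, 0 < 1 + K * m 1, 0 <= w 1, 0 <= m' 1 &
     w 1 ^+ 2 * (2 * m 1 + K * m 1 ^+ 2) <= m' 1 ^+ 2] by apply: h; rewrite lexx ler01.
have L0 : 0 <= fine (\int[lebesgue_measure]_(s in `[0%R, 1%R]) (w s)%:E)%E by exact: fine_ge0.
have hL : fine (\int[lebesgue_measure]_(s in `[0%R, 1%R]) (w s)%:E)%E + e <= invmdK K (m 1).
  by move: iw; rewrite -[X in (X <= _)%E]fineK // lee_fin m0 invmdK_mdK //; lra.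
have sm := smallK_invmdK (ltW a) b.
split => //; [exact: smallKW hL sm|by rewrite fineK|].
rewrite -[m 1](invmdKK (ltW a) b); apply: mdK_ler => //; lra.
Qed.

End model_plane.

(** * The modified distance from a point along causal curves *)

Section gudermannian.
Context {R : realType}.
Implicit Types x g s : R.

(** In the variable [g], the Gudermannian of a coordinate, light rays of the
    curved model planes have slope one, so that the cone condition can be
    integrated. *)
Lemma gd_trig x : let g := atan (sinh x) in
  [/\ - (pi / 2) < g < pi / 2, 0 < cos g, cosh x = (cos g)^-1 & sinh x = sin g / cos g].
Proof.
move=> g; have hg : - (pi / 2) < g < pi / 2 by rewrite atan_gtNpi2 atan_ltpi2.
have cg : 0 < cos g by exact: cos_gt0_pihalf.
have st : sinh x = sin g / cos g by rewrite -[LHS]atanK.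
split => //; have := cosh2_sinh2 x; rewrite st => h.
have e : cosh x ^+ 2 = (cos g)^-1 ^+ 2.
  by rewrite h expr_div_n sin2cos2; field; exact: lt0r_neq0.
apply/eqP; rewrite -(@eqrXn2 _ 2) ?e //; first exact: ltW (cosh_gt0 x).
by rewrite invr_ge0 ltW.
Qed.

Lemma isd_gd x : isder x (fun u => atan (sinh u)) (cosh x)^-1.
Proof.
isdeq; rewrite -cosh2_sinh2; field; exact: lt0r_neq0 (cosh_gt0 x).
Qed.

Lemma gd0 : atan (sinh 0) = 0 :> R.
Proof. by rewrite sinh0 atan0. Qed.

Lemma ltr_sinh x y : x < y -> sinh x < sinh y.
Proof.
move=> xy; rewrite /sinh ltr_pM2r // ltrD //; first by rewrite ltr_expR.
by rewrite ltrN2 ltr_expR ltrN2.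
Qed.

Lemma ltr_gd x y : x < y -> atan (sinh x) < atan (sinh y).
Proof. by move=> xy; apply: lt_atan; exact: ltr_sinh. Qed.

Lemma mono01 (F F' : R -> R) :
  (forall s, isder s F (F' s)) ->
  (forall s, 0 <= s <= 1 -> 0 <= F' s) ->
  forall s u, 0 <= s -> s <= u -> u <= 1 -> F s <= F u.
Proof.
move=> hF F'0 s u s0; rewrite le_eqVlt => /predU1P[-> //|su] u1.
have [||c] := @MVT R F F' s u su.
- by move=> z _; exact: hF.
- by apply: continuous_subspaceT => z; exact: isd_continuous (hF z).
rewrite in_itv /= => /andP[c1 c2] h; rewrite -subr_ge0 h mulr_ge0 //; last lra.
by apply: F'0; lra.
Qed.

Lemma abs_mono01 (F F' G G' : R -> R) :
  (forall s, isder s F (F' s)) -> (forall s, isder s G (G' s)) ->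
  (forall s, 0 <= s <= 1 -> `|F' s| <= G' s) ->
  forall s, 0 <= s <= 1 -> `|F s - F 0| <= G s - G 0.
Proof.
move=> hF hG h s /andP[s0 s1].
have hp : forall u, isder u (fun u => G u - F u) (G' u - F' u) by move=> u; isd.
have hm : forall u, isder u (fun u => G u + F u) (G' u + F' u) by move=> u; isd.
have := @mono01 _ _ hp _ 0 s (lexx 0) s0 s1.
have := @mono01 _ _ hm _ 0 s (lexx 0) s0 s1 => h1 h2.
have {}h1 : G 0 + F 0 <= G s + F s.
  by apply: h1 => u /h; rewrite ler_norml; lra.
have {}h2 : G 0 - F 0 <= G s - F s.
  by apply: h2 => u /h; rewrite ler_norml; lra.
by rewrite ler_norml; lra.
Qed.

End gudermannian.

Section distance_from_the_axis.
Context {R : realType} (K : R).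
Let k : R := Num.sqrt `|K|.
Notation model_pt := (@model_pt R).
Implicit Types (p q : model_pt) (c : R -> model_pt) (s t x tau : R).

Definition mkpt (t x : R) : model_pt := \row_i nth 0 [:: t; x] i.

Lemma mkpt0 t x : mkpt t x 0 0 = t. Proof. by rewrite mxE. Qed.
Lemma mkpt1 t x : mkpt t x 0 1 = x. Proof. by rewrite mxE. Qed.

Lemma model_pt_eq p q : p 0 0 = q 0 0 -> p 0 1 = q 0 1 -> p = q.
Proof.
move=> h0 h1; apply/rowP => -[[|[|//]] hi].
- by rewrite [Ordinal hi](_ : _ = 0) //; exact: val_inj.
- by rewrite [Ordinal hi](_ : _ = 1) //; exact: val_inj.
Qed.

(** A timelike geodesic parametrized by arc length. *)
Definition axisK tau : model_pt := mkpt (if K == 0 then tau else k * tau) 0.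

(** The modified distance from [axisK tau]. For nonzero [K] it is the scalar
    product of the ambient position vectors, normalized so that it vanishes at
    [axisK tau] and does not degenerate as [K] tends to [0]. *)
Definition poleK tau p : R :=
  if K == 0 then ((p 0 0 - tau) ^+ 2 - p 0 1 ^+ 2) / 2 else
  if 0 < K then (cosh (k * tau) * (cosh (p 0 0) * cos (p 0 1)) -
                 sinh (k * tau) * sinh (p 0 0) - 1) / K
  else (cosh (p 0 1) * cos (p 0 0 - k * tau) - 1) / K.

(** Beyond this bound [mdK] would no longer be increasing in the distance. *)
Definition poleK_bound tau p := K < 0 -> p 0 0 - k * tau < pi / 2.

Lemma time_part_gt0 c s t' x' : 0 < t' -> 0 < time_part K c s t' x'.
Proof.
move=> t0; rewrite /time_part; case: ifP => // /negbT /k_gt0 k0.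
case: ifP => _; apply: divr_gt0 => //; apply: mulr_gt0 => //; exact: cosh_gt0.
Qed.

(** The gradient [(A, B)] of the modified distance from a point [axisK sigma]
    in the past of a causal curve, in an orthonormal frame. It is timelike, and
    its square is [snK^2] of the distance, by [snK_sq]: this is the eikonal
    equation of the distance. The curve stays in the future of that point
    because the cone condition bounds its deviation from the axis. *)
Lemma eikonal c tau sigma Q s (t' := derive1 (fun u => c u 0 0) s)
    (x' := derive1 (fun u => c u 0 1) s) :
  model_causal_curve K c (axisK tau) Q -> sigma < tau ->
  poleK_bound sigma Q -> 0 <= s <= 1 ->
  exists A B, [/\ isder s (fun u => poleK sigma (c u))
    (A * time_part K c s t' x' + B * space_part K c s t' x'),
    0 < poleK sigma (c s) /\ 0 < 1 + K * poleK sigma (c s), `|B| <= A &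
    A ^+ 2 - B ^+ 2 = 2 * poleK sigma (c s) + K * poleK sigma (c s) ^+ 2].
Proof.
move=> [[c0 c1 hC t0] hsp] st hb s01.
have ht u := C1_isd (hC 0) u; have hx u := C1_isd (hC 1) u.
have cone u : 0 <= u <= 1 ->
    `|space_part K c u (derive1 (fun v => c v 0 0) u) (derive1 (fun v => c v 0 1) u)|
    <= time_part K c u (derive1 (fun v => c v 0 0) u) (derive1 (fun v => c v 0 1) u).
  move=> u01; have := hsp u u01; rewrite (model_speed2E K (ht u) (hx u)) subr_le0.
  have := time_part_gt0 c u (derive1 (fun v => c v 0 1) u) (t0 u u01).
  move: (space_part _ _ _ _ _) (time_part _ _ _ _ _) => a b b0.
  by rewrite -(real_normK (num_real a)) ler_pXn2r ?nnegrE // ltW.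
have tmono : forall u, 0 <= u <= 1 -> c u 0 0 <= Q 0 0.
  move=> u /andP[u0 u1]; rewrite -c1.
  by apply: (mono01 ht) => // v /t0 /ltW.
move: cone; rewrite /space_part /time_part /poleK -/k.
move: c0 hb; rewrite /axisK /poleK_bound.
have [K0|K0] := eqVneq K 0; [|have k0 : 0 < k := k_gt0 K0; have [Kp|Kp|/eqP] := ltgtP K 0;
  last (by rewrite (negbTE K0))] => c0 hb cone.
- exists (c s 0 0 - sigma), (- c s 0 1); rewrite K0 !mul0r !addr0.
  have := abs_mono01 hx ht cone s01.
  rewrite c0 mkpt0 mkpt1 subr0 ler_norml => /andP[h1 h2]; split.
  + by have ht' : isder s (fun u => c u 0 0) t' := ht s; have hx' : isder s (fun u => c u 0 1) x' := hx s; isdeq; field.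
  + by split => //; nra.
  + by rewrite normrN ler_norml; lra.
  + by field.
- pose g u := atan (sinh (c u 0 1)).
  have hg u : isder u g ((cosh (c u 0 1))^-1 * derive1 (fun v => c v 0 1) u).
    by apply: (@isd_comp _ (fun v => atan (sinh v)) (fun v => c v 0 1)); [exact: isd_gd|exact: hx].
  have := abs_mono01 hg ht _ s01.
  rewrite {2}/g c0 mkpt0 mkpt1 gd0 subr0 => hgt.
  have {}hgt : `|g s| <= c s 0 0 - k * tau.
    apply: hgt => u u01; rewrite normrM gtr0_norm ?invr_gt0 ?cosh_gt0 //.
    rewrite ler_pdivrMl ?cosh_gt0 //; have := cone u u01.
    by rewrite normrM [`|k^-1|]gtr0_norm ?invr_gt0 // ler_pM2r ?invr_gt0.
  have kst : k * sigma < k * tau by rewrite ltr_pM2l.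
  pose th := c s 0 0 - k * sigma; have gth : `|g s| < th by rewrite /th; lra.
  have thp : th < pi / 2 by have := tmono s s01; have := hb isT; rewrite /th; lra.
  have th0 : 0 < th by have := normr_ge0 (g s); lra.
  have cth : 0 < cos th by apply: cos_gt0_pihalf; lra.
  have [hgb cg che she] := gd_trig (c s 0 1); rewrite -/(g s) in hgb cg che she.
  have cosg : cos th < cos (g s).
    have -> : cos (g s) = cos `|g s| by rewrite cos_norm.
    by rewrite ltr_cos // in_itv /= ?normr_ge0; have := pi_gt0 R; lra.
  have KE := K_neg Kp; rewrite -/k in KE.
  have mE : 1 + K * ((cosh (c s 0 1) * cos (c s 0 0 - k * sigma) - 1) / K) = cosh (c s 0 1) * cos th.
    by rewrite /th; field.
  have FE : cosh (c s 0 1) * cos th < 1 by rewrite che mulrC ltr_pdivrMr ?mul1r.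
  have F0 : 0 < cosh (c s 0 1) * cos th by rewrite mulr_gt0 ?cosh_gt0.
  exists (sin th / k), (- (sinh (c s 0 1) * cos th / k)); split.
  + have ht' : isder s (fun u => c u 0 0) t' := ht s; have hx' : isder s (fun u => c u 0 1) x' := hx s; isdeq; rewrite -/th {1}KE; field.
    exact: lt0r_neq0.
  + by split; rewrite ?mE // -/th nmulr_lgt0 ?invr_lt0 // subr_lt0.
  + rewrite normrN normrM [`|k^-1|]gtr0_norm ?invr_gt0 // ler_pM2r ?invr_gt0 //.
    rewrite she normrM [`|cos th|]gtr0_norm // normrM [`|(cos _)^-1|]gtr0_norm ?invr_gt0 //.
    rewrite mulrAC ler_pdivrMr // -subr_ge0.
    have -> : cos (g s) = cos `|g s| by rewrite cos_norm.
    have -> : `|sin (g s)| = sin `|g s|.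
      have [g0|g0] := leP 0 (g s); first by rewrite !ger0_norm // sin_ge0_pi //; lra.
      rewrite [`|g s|]ltr0_norm // sinN ler0_norm // -oppr_ge0 -sinN.
      by rewrite sin_ge0_pi //; lra.
    rewrite [sin _ * cos th]mulrC -sinB sin_ge0_pi //.
    by have := normr_ge0 (g s); have := pi_gt0 R; lra.
  + rewrite [RHS](_ : _ = ((1 + K * ((cosh (c s 0 1) * cos (c s 0 0 - k * sigma) - 1) / K)) ^+ 2 - 1) / K); last by field.
    have e : sin th ^+ 2 - (sinh (c s 0 1) * cos th) ^+ 2 = 1 - (cosh (c s 0 1) * cos th) ^+ 2.
      have := cosh2_sinh2 (c s 0 1); move: (cosh _) (sinh _) => C S e.
      by rewrite !exprMn e sin2cos2; ring.
    rewrite mE [LHS](_ : _ = (sin th ^+ 2 - (sinh (c s 0 1) * cos th) ^+ 2) / k ^+ 2); last first.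
      by field; exact: lt0r_neq0.
    by rewrite e {1}KE; field; exact: lt0r_neq0.
- pose g u := atan (sinh (c u 0 0)).
  have hg u : isder u g ((cosh (c u 0 0))^-1 * derive1 (fun v => c v 0 0) u).
    by apply: (@isd_comp _ (fun v => atan (sinh v)) (fun v => c v 0 0)); [exact: isd_gd|exact: ht].
  have := abs_mono01 hx hg _ s01.
  rewrite {2}/g c0 mkpt0 mkpt1 subr0 => hgt.
  have {}hgt : `|c s 0 1| <= g s - atan (sinh (k * tau)).
    apply: hgt => u u01; have := cone u u01.
    rewrite normrM [`|k^-1|]gtr0_norm ?invr_gt0 // normrM [`|cosh _|]gtr0_norm ?cosh_gt0 //.
    by rewrite ler_pM2r ?invr_gt0 // ler_pdivlMl ?cosh_gt0.
  have kst : k * sigma < k * tau by rewrite ltr_pM2l.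
  have [hgb cg che she] := gd_trig (c s 0 0); rewrite -/(g s) in hgb cg che she.
  have [] := gd_trig (k * sigma); have := ltr_gd kst.
  move: (atan (sinh (k * sigma))) => g0 g0t hg0 cg0 che0 she0.
  have KE := K_pos Kp; rewrite -/k in KE.
  have xg : `|c s 0 1| < g s - g0 by lra.
  have m0 : 0 < (cosh (k * sigma) * (cosh (c s 0 0) * cos (c s 0 1)) -
                 sinh (k * sigma) * sinh (c s 0 0) - 1) / K.
    rewrite divr_gt0 // che0 che she0 she.
    rewrite [X in 0 < X](_ : _ = (cos (c s 0 1) - cos (g s - g0)) / (cos g0 * cos (g s))); last first.
      by rewrite cosB; field; rewrite !lt0r_neq0.
    rewrite divr_gt0 ?mulr_gt0 // subr_gt0.
    have -> : cos (c s 0 1) = cos `|c s 0 1| by rewrite cos_norm.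
    have := normr_ge0 (c s 0 1) => n0.
    by rewrite ltr_cos // in_itv /=; lra.
  exists ((cosh (k * sigma) * (sinh (c s 0 0) * cos (c s 0 1)) - sinh (k * sigma) * cosh (c s 0 0)) / k),
    (- (cosh (k * sigma) * sin (c s 0 1) / k)); split.
  + have ht' : isder s (fun u => c u 0 0) t' := ht s; have hx' : isder s (fun u => c u 0 1) x' := hx s; isdeq; rewrite {1}KE; field.
    exact: lt0r_neq0.
  + by split => //; rewrite ltr_wpDr // mulr_ge0 // ltW.
  + rewrite normrN normrM [`|k^-1|]gtr0_norm ?invr_gt0 // ler_pM2r ?invr_gt0 //.
    have -> : `|cosh (k * sigma) * sin (c s 0 1)| = cosh (k * sigma) * sin `|c s 0 1|.
      rewrite normrM gtr0_norm ?cosh_gt0 //; congr (_ * _).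
      have := normr_ge0 (c s 0 1) => n0.
      have [x0|x0] := leP 0 (c s 0 1).
        by rewrite !ger0_norm // sin_ge0_pi //; move: xg; rewrite ger0_norm //; lra.
      rewrite [`|c s 0 1|]ltr0_norm // sinN ler0_norm // -oppr_ge0 -sinN.
      by rewrite sin_ge0_pi //; move: xg; rewrite ltr0_norm //; lra.
    have -> : cos (c s 0 1) = cos `|c s 0 1| by rewrite cos_norm.
    rewrite che0 che she0 she -subr_ge0.
    rewrite [X in 0 <= X](_ : _ = (sin (g s - `|c s 0 1|) - sin g0) / (cos g0 * cos (g s))); last first.
      by rewrite sinB; field; rewrite !lt0r_neq0.
    rewrite divr_ge0 ?mulr_ge0 ?ltW // subr_gt0.
    have := normr_ge0 (c s 0 1) => n0.
    by rewrite ltr_sin // ?in_itv /=; lra.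
  + rewrite [RHS](_ : _ = ((1 + K * ((cosh (k * sigma) * (cosh (c s 0 0) * cos (c s 0 1)) -
                 sinh (k * sigma) * sinh (c s 0 0) - 1) / K)) ^+ 2 - 1) / K); last by field.
    have := cosh2_sinh2 (k * sigma); have := cosh2_sinh2 (c s 0 0).
    have := cos2Dsin2 (c s 0 1).
    move: (cosh (c s 0 0)) (sinh (c s 0 0)) (cosh (k * sigma)) (sinh (k * sigma))
      (cos _) (sin _) => C S C0 S0 a b e1 e2 e3.
    rewrite [in RHS](_ : 1 + K * _ = C0 * (C * a) - S0 * S); last by field.
    have e4 : (C0 * (S * a) - S0 * C) ^+ 2 - (C0 * b) ^+ 2 = (C0 * (C * a) - S0 * S) ^+ 2 - 1.
      have -> : (C0 * (S * a) - S0 * C) ^+ 2 - (C0 * b) ^+ 2 = (C0 * (C * a) - S0 * S) ^+ 2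
        - (C ^+ 2 - S ^+ 2) * (C0 ^+ 2 * a ^+ 2 - S0 ^+ 2) - C0 ^+ 2 * b ^+ 2 by ring.
      have e2' : C ^+ 2 - S ^+ 2 = 1 by rewrite e2; ring.
      have e1' : b ^+ 2 = 1 - a ^+ 2 by rewrite -e1; ring.
      by rewrite e2' e1' e3; ring.
    by rewrite -e4 {1}KE; field; exact: lt0r_neq0.
Qed.

End distance_from_the_axis.

(** * Continuously differentiable functions *)

Section C1_closure.
Context {R : realType}.
Implicit Types (f g F : R -> R).

Lemma C1_cst (a : R) : C1 (fun=> a).
Proof. by apply: (@isd_C1 _ _ (fun=> 0)) => t; [isd|exact: cst_continuous]. Qed.

Lemma C1_id : C1 (fun x : R => x).
Proof. by apply: (@isd_C1 _ _ (fun=> 1)) => t; [isd|exact: cst_continuous]. Qed.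

Lemma C1_add f g : C1 f -> C1 g -> C1 (fun t => f t + g t).
Proof.
move=> hf hg; have df := C1_isd hf; have dg := C1_isd hg.
apply: (@isd_C1 _ _ (fun t => derive1 f t + derive1 g t)) => t; first by isd.
by have cf := hf.2 t; have cg := hg.2 t; exact: (continuousD cf cg).
Qed.

Lemma C1_opp f : C1 f -> C1 (fun t => - f t).
Proof.
move=> hf; have df := C1_isd hf.
apply: (@isd_C1 _ _ (fun t => - derive1 f t)) => t; first by isd.
by have cf := hf.2 t; exact: (continuousN cf).
Qed.

Lemma C1_mul f g : C1 f -> C1 g -> C1 (fun t => f t * g t).
Proof.
move=> hf hg; have df := C1_isd hf; have dg := C1_isd hg.
apply: (@isd_C1 _ _ (fun t => derive1 f t * g t + f t * derive1 g t)) => t; first by isd.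
have cf := hf.2 t; have cg := hg.2 t.
have c0f : {for t, continuous f} by exact: C1_cts.
have c0g : {for t, continuous g} by exact: C1_cts.
exact: (continuousD (continuousM cf c0g) (continuousM c0f cg)).
Qed.

Lemma C1_exp f n : C1 f -> C1 (fun t => f t ^+ n).
Proof.
move=> hf; elim: n => [|n ih]; first exact: C1_cst.
by under eq_fun do rewrite exprS; exact: C1_mul.
Qed.

(** The outer function need only be smooth along the values of the inner one. *)
Lemma C1_comp_on F dF f : C1 f -> (forall t, isder (f t) F (dF (f t))) ->
  (forall t, {for f t, continuous dF}) -> C1 (fun t => F (f t)).
Proof.
move=> hf hF cF; have df := C1_isd hf.
apply: (@isd_C1 _ _ (fun t => dF (f t) * derive1 f t)) => t.
  by apply: isd_comp; [exact: hF|exact: df].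
have cf := hf.2 t; have c0f : {for t, continuous f} by exact: C1_cts.
exact: (continuousM (continuous_comp c0f (cF t)) cf).
Qed.

Lemma C1_inv f : (forall t, f t != 0) -> C1 f -> C1 (fun t => (f t)^-1).
Proof.
move=> f0 hf; apply: (@C1_comp_on (fun x => x^-1) (fun x => - 1 / x ^+ 2)) => // t.
  by isd.
by cts; rewrite sqrf_eq0.
Qed.

Lemma C1_sqrt f : (forall t, 0 < f t) -> C1 f -> C1 (fun t => Num.sqrt (f t)).
Proof.
move=> f0 hf; apply: (@C1_comp_on Num.sqrt (fun x => (2 * Num.sqrt x)^-1)) => // t.
  exact: isd_sqrt.
by cts; rewrite mulf_neq0 // lt0r_neq0 // sqrtr_gt0.
Qed.

Lemma C1_ln f : (forall t, 0 < f t) -> C1 f -> C1 (fun t => ln (f t)).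
Proof.
move=> f0 hf; apply: (@C1_comp_on (@ln R) (fun x => x^-1)) => // t.
  exact: is_derive1_ln.
by cts; rewrite lt0r_neq0.
Qed.

Lemma C1_sin f : C1 f -> C1 (fun t => sin (f t)).
Proof.
move=> hf; apply: (@C1_comp_on sin cos) => // t; first exact: is_derive_sin.
exact: continuous_cos.
Qed.

Lemma C1_cos f : C1 f -> C1 (fun t => cos (f t)).
Proof.
move=> hf; apply: (@C1_comp_on cos (fun x => - sin x)) => // t; first exact: is_derive_cos.
by cts.
Qed.

Lemma C1_sinh f : C1 f -> C1 (fun t => sinh (f t)).
Proof.
move=> hf; apply: (@C1_comp_on sinh cosh) => // t; first exact: isd_sinh.
exact: isd_continuous (isd_cosh _).
Qed.

Lemma C1_cosh f : C1 f -> C1 (fun t => cosh (f t)).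
Proof.
move=> hf; apply: (@C1_comp_on cosh sinh) => // t; first exact: isd_cosh.
exact: isd_continuous (isd_sinh _).
Qed.

Lemma C1_atan f : C1 f -> C1 (fun t => atan (f t)).
Proof.
move=> hf; apply: (@C1_comp_on atan (fun x => (1 + x ^+ 2)^-1)) => // t; first exact: is_derive1_atan.
by cts; rewrite lt0r_neq0 // ltr_pwDl // sqr_ge0.
Qed.

End C1_closure.

Ltac c1step := match goal with
  | |- C1 (fun _ => ?c) => exact: C1_cst
  | |- C1 (fun x => x) => exact: C1_id
  | |- C1 (fun x => @?f x + @?g x) => apply: (@C1_add _ f g)
  | |- C1 (fun x => - @?f x) => apply: (@C1_opp _ f)
  | |- C1 (fun x => @?f x * @?g x) => apply: (@C1_mul _ f g)
  | |- C1 (fun x => (@?f x) ^+ ?n) => apply: (@C1_exp _ f n)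
  | |- C1 (fun x => (@?f x)^-1) => apply: (@C1_inv _ f)
  | |- C1 (fun x => sin (@?f x)) => apply: (@C1_sin _ f)
  | |- C1 (fun x => cos (@?f x)) => apply: (@C1_cos _ f)
  | |- C1 (fun x => sinh (@?f x)) => apply: (@C1_sinh _ f)
  | |- C1 (fun x => cosh (@?f x)) => apply: (@C1_cosh _ f)
  | |- C1 (fun x => atan (@?f x)) => apply: (@C1_atan _ f)
  | |- C1 (fun x => Num.sqrt (@?f x)) => apply: (@C1_sqrt _ f)
  | |- C1 (fun x => ln (@?f x)) => apply: (@C1_ln _ f)
  | H : C1 _ |- C1 _ => solve [exact: H]
  end.
Ltac c1tac := repeat c1step.

(** * An upper bound for the length of causal curves *)

Section causal_length.
Context {R : realType} (K : R).
Let k : R := Num.sqrt `|K|.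
Notation model_pt := (@model_pt R).
Implicit Types (p q : model_pt) (c : R -> model_pt) (s t x tau : R).

Lemma C1_coordinates c : C1 (fun t => c t 0 0) -> C1 (fun t => c t 0 1) ->
  forall i, C1 (fun t => c t 0 i).
Proof.
move=> h0 h1 [[|[|//]] hi].
- by rewrite (_ : Ordinal hi = 0) //; exact: val_inj.
- by rewrite (_ : Ordinal hi = 1) //; exact: val_inj.
Qed.

Lemma C1_poleK c tau : (forall i, C1 (fun t => c t 0 i)) ->
  C1 (fun t => poleK K tau (c t)).
Proof.
move=> hc; have h0 := hc 0; have h1 := hc 1; rewrite /poleK.
by case: (K == 0); [|case: (0 < K)]; c1tac.
Qed.

Lemma cts_model_speed2 c : (forall i, C1 (fun t => c t 0 i)) ->
  continuous (model_speed2 K c).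
Proof.
move=> hc; have h0 := C1_isd (hc 0); have h1 := C1_isd (hc 1).
have c0 := C1_cts (hc 0); have c1 := C1_cts (hc 1).
have c0' := (hc 0).2; have c1' := (hc 1).2.
have -> : model_speed2 K c = (fun s =>
  space_part K c s (derive1 (fun u => c u 0 0) s) (derive1 (fun u => c u 0 1) s) ^+ 2 -
  time_part K c s (derive1 (fun u => c u 0 0) s) (derive1 (fun u => c u 0 1) s) ^+ 2).
  by apply/funext => s; exact: model_speed2E.
have key (T X T' X' : R -> R) : continuous T -> continuous X ->
    continuous T' -> continuous X' -> forall s, {for s, continuous (fun s =>
    (if K == 0 then X' s else if 0 < K then cosh (T s) * X' s / k else X' s / k) ^+ 2 -
    (if K == 0 then T' s else if 0 < K then T' s / k else cosh (X s) * T' s / k) ^+ 2)}.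
  by move=> ? ? ? ? s; case: (K == 0); [|case: (0 < K)]; cts.
by move=> s; exact: (key _ _ _ _ c0 c1 c0' c1' s).
Qed.

Lemma right_limit_ge (g : R -> R) (a e0 : R) : 0 < e0 -> {for 0, continuous g} ->
  (forall e, 0 < e -> e < e0 -> a <= g e) -> a <= g 0.
Proof.
move=> e00 cg h; rewrite leNgt; apply/negP => ga.
have : \forall t \near 0, g t < a by exact: (cvgr_lt (g 0) cg).
move=> /nbhs_ballP [d /= d0 hd].
have [m m0 [m1 m2]] := pos_below2 d0 e00.
have h1 : a <= g (m / 2) by apply: h; lra.
have h2 : g (m / 2) < a.
  by apply: hd; rewrite /ball /= sub0r normrN gtr0_norm; lra.
lra.
Qed.

(** By the reverse Cauchy-Schwarz inequality for the gradient of [eikonal], the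
    distance from [axisK (tau - e)] grows at least as fast as the length. The
    pole is moved back by [e] since the distance is not differentiable at the
    pole itself; then [e] tends to [0]. *)
Lemma causal_length_le c tau Q :
  model_causal_curve K c (axisK K tau) Q -> poleK_bound K tau Q ->
  exists L, [/\ 0 <= L, smallK K L, model_length K c = L%:E &
    mdK K L <= poleK K tau Q].
Proof.
move=> hc hb; have [[c0 c1 hC t0] hsp] := hc.
have [e0 e00 [se hbe]] : exists2 e0 : R, 0 < e0 & smallK K e0 /\
    forall e, e < e0 -> poleK_bound K (tau - e) Q.
  have [K0|K0] := leP 0 K.
    by exists 1 => //; split=> [|e _]; rewrite /smallK /poleK_bound ltNge K0.
  have k0 : 0 < k by apply: k_gt0; rewrite lt_eqF.
  have hp := pi_gt0 R; have hb' := hb K0; rewrite -/k in hb'.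
  pose e0 := Num.min (pi / 2 - (Q 0 0 - k * tau)) (pi / 4) / k.
  have e00 : 0 < e0 by rewrite divr_gt0 // lt_min; apply/andP; split; lra.
  have ke : k * e0 = Num.min (pi / 2 - (Q 0 0 - k * tau)) (pi / 4).
    by rewrite /e0 mulrC divfK // lt0r_neq0.
  exists e0 => //; split=> [_|e ee _]; rewrite -/k.
    by rewrite ke; apply: (@le_lt_trans _ _ (pi / 4)); [rewrite ge_min lexx orbT|lra].
  have : k * e < k * e0 by rewrite ltr_pM2l.
  have : k * e0 <= pi / 2 - (Q 0 0 - k * tau) by rewrite ke ge_min lexx.
  by rewrite mulrBr; lra.
pose w s := Num.sqrt (- model_speed2 K c s).
have cw : continuous w.
  move=> s; have cs : {for s, continuous (model_speed2 K c)} by exact: cts_model_speed2.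
  by change {for s, continuous w}; rewrite /w; cts.
have step e : 0 < e -> e < e0 -> exists L : R, [/\ 0 <= L, smallK K (L + e),
    model_length K c = L%:E & mdK K (L + e) <= poleK K (tau - e) Q].
  move=> ep ee0; rewrite -c1.
  have Cm := C1_poleK (tau - e) hC.
  apply: (@length_bound _ K w (fun s => poleK K (tau - e) (c s)) _ e ep _ _ cw Cm.2 (C1_isd Cm)).
  - exact: smallKW (ltW ee0) se.
  - rewrite c0 /axisK /poleK /mdK /csK; case: eqP => [_|/eqP K0].
      by rewrite mkpt0 mkpt1; field.
    rewrite !mkpt0 !mkpt1 cosh0 cos0 mulr1 mul1r -/k; case: ifP => _.
      have -> : k * e = k * tau + - (k * (tau - e)) by ring.
      by rewrite coshD coshN sinhN; congr ((_ - 1) / K); ring.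
    by congr ((cos _ - 1) / K); ring.
  - move=> s s01; have lt : tau - e < tau by lra.
    have [A [B [hd [hp0 hp1] hAB hE]]] := eikonal hc lt (hbe e ee0) s01.
    have tp := time_part_gt0 K c s (derive1 (fun u => c u 0 1) s) (t0 s s01).
    rewrite (isd_derive1 hd).
    have := hsp s s01; rewrite /w (model_speed2E K (C1_isd (hC 0) s) (C1_isd (hC 1) s)).
    move: tp; move: (time_part _ _ _ _ _) (space_part _ _ _ _ _) => p q p0 hpq.
    have hq : `|q| <= p.
      have n0 := normr_ge0 q; have : `|q| ^+ 2 <= p ^+ 2 by rewrite real_normK ?num_real //; lra.
      by rewrite ler_pXn2r ?nnegrE // ltW.
    split => //.
      have h1 : `|B| * `|q| <= A * p by apply: ler_pM.
      by have := ler_norm (- (B * q)); rewrite normrN normrM; lra.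
    (* the defect in the reverse Cauchy-Schwarz inequality is a square *)
    rewrite sqr_sqrtr; last by lra.
    rewrite -hE -subr_ge0.
    have -> : (A * p + B * q) ^+ 2 - - (q ^+ 2 - p ^+ 2) * (A ^+ 2 - B ^+ 2) =
      (A * q + B * p) ^+ 2 by ring.
    exact: sqr_ge0.
have [||L [L0 sL hL _]] := step (e0 / 2); [lra|lra|].
exists L; split => //; first by apply: smallKW sL; lra.
have -> : poleK K tau Q = poleK K (tau - 0) Q by rewrite subr0.
apply: (right_limit_ge e00 (g := fun e => poleK K (tau - e) Q)).
  by rewrite /poleK; case: (K == 0); [|case: (0 < K)]; cts.
move=> e ep ee; have [L' [L'0 sL' hL' hm]] := step e ep ee.
have -> : L = L' by apply: EFin_inj; rewrite -hL -hL'.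
by apply: le_trans hm; apply: mdK_ler => //; lra.
Qed.

End causal_length.

(** * Geodesics of the model planes *)

Section arsinh.
Context {R : realType}.
Implicit Types u x : R.

Definition arsinh u : R := ln (u + Num.sqrt (1 + u ^+ 2)).

Lemma sqrt1D_gt u : 0 < Num.sqrt (1 + u ^+ 2) /\ 0 < u + Num.sqrt (1 + u ^+ 2).
Proof.
have h : 0 < 1 + u ^+ 2 by rewrite ltr_pwDl // sqr_ge0.
have s0 : 0 < Num.sqrt (1 + u ^+ 2) by rewrite sqrtr_gt0.
split => //; have := sqr_sqrtr (ltW h); nra.
Qed.

Lemma sinh_arsinh u : sinh (arsinh u) = u.
Proof.
have [s0 p0] := sqrt1D_gt u; rewrite /sinh /arsinh expRN lnK ?posrE //.
have h : 0 <= 1 + u ^+ 2 by rewrite addr_ge0 // sqr_ge0.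
have := sqr_sqrtr h; move: (Num.sqrt _) s0 p0 => s s0 p0 hs.
have -> : (u + s)^-1 = s - u.
  by apply: (mulfI (lt0r_neq0 p0)); rewrite divff ?lt0r_neq0 //; lra.
by field.
Qed.

Lemma cosh_arsinh u : cosh (arsinh u) = Num.sqrt (1 + u ^+ 2).
Proof.
apply/eqP; rewrite -(@eqrXn2 _ 2) ?sqrtr_ge0 ?ltW ?cosh_gt0 //.
by rewrite cosh2_sinh2 sinh_arsinh sqr_sqrtr // addr_ge0 // sqr_ge0.
Qed.

Lemma arsinh_sinh x : arsinh (sinh x) = x.
Proof.
have h := sinh_arsinh (sinh x).
have [hl|hl|//] := ltgtP (arsinh (sinh x)) x.
- by have := ltr_sinh hl; rewrite h ltxx.
- by have := ltr_sinh hl; rewrite h ltxx.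
Qed.

Lemma isd_arsinh u : isder u arsinh (Num.sqrt (1 + u ^+ 2))^-1.
Proof.
have [s0 p0] := sqrt1D_gt u; rewrite /arsinh; apply: isd_eq.
  apply: (@isd_comp _ (@ln R) (fun x => x + Num.sqrt (1 + x ^+ 2))).
    exact: is_derive1_ln.
  apply: isd_add; first by isd.
  apply: (@isd_comp _ (@Num.sqrt R) (fun x => 1 + x ^+ 2)).
    by apply: isd_sqrt; rewrite ltr_pwDl // sqr_ge0.
  by isd.
move: (Num.sqrt _) s0 p0 => s s0 p0.
by rewrite /= expr1; field; rewrite !lt0r_neq0.
Qed.

Lemma C1_arsinh (f : R -> R) : C1 f -> C1 (fun t => arsinh (f t)).
Proof.
move=> hf; apply: (@C1_comp_on _ arsinh (fun x => (Num.sqrt (1 + x ^+ 2))^-1)) => // t.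
  exact: isd_arsinh.
by cts; rewrite lt0r_neq0 //; case: (sqrt1D_gt (f t)).
Qed.

End arsinh.

Lemma sinh_lt_cosh {R : realType} (x : R) : - cosh x < sinh x < cosh x.
Proof.
by rewrite /cosh /sinh; have := expR_gt0 x; have := expR_gt0 (- x); lra.
Qed.

Section geodesics.
Context {R : realType} (K : R).
Let k : R := Num.sqrt `|K|.
Notation model_pt := (@model_pt R).
Implicit Types (p q Q : model_pt) (c : R -> model_pt) (s t x tau : R).

Lemma model_length_unit c (sg sg' : R -> R) :
  (forall s, isder s sg (sg' s)) -> continuous sg' ->
  (forall s, 0 <= s <= 1 -> 0 < sg' s /\ model_speed2 K c s = - sg' s ^+ 2) ->
  model_length K c = (sg 1 - sg 0)%:E.
Proof.
move=> hd cd h; rewrite /model_length -(integral_isd (f := sg')) //; last first.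
  exact: continuous_subspaceT.
apply: eq_integral => s; rewrite inE /= in_itv /= => /h[s0 ->].
by rewrite opprK sqrtr_sqr gtr0_norm.
Qed.

(** Curves on [[0, 1]] are restrictions of curves on the whole line, and for
    [K < 0] the chart only covers a bounded piece of a geodesic. Hence geodesics
    are run through with a bounded parameter instead of [T * s]. *)
Definition ramp (T s : R) : R := T * sin (pi / 4 * s) / sin (pi / 4).

Lemma sin_pi4 : 2^-1 <= sin (pi / 4 : R).
Proof.
have e : pi / 4 + pi / 4 = pi / 2 :> R by field.
have := sinD (pi / 4) (pi / 4 : R); rewrite e sin_pihalf.
have := cos_le1 (pi / 4 : R); have hp := pi_gt0 R.
have : 0 < sin (pi / 4 : R) by apply: sin_gt0_pi; lra.
have : 0 < cos (pi / 4 : R) by apply: cos_gt0_pihalf; lra.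
by nra.
Qed.

Definition ramp' (T s : R) : R := T * (pi / 4) * cos (pi / 4 * s) / sin (pi / 4).

Lemma rampP T : 0 < T -> [/\ ramp T 0 = 0, ramp T 1 = T, C1 (ramp T),
  forall s, isder s (ramp T) (ramp' T s) & continuous (ramp' T)] /\
  (forall s, 0 <= s <= 1 -> 0 < ramp' T s) /\ forall s, `|ramp T s| <= 2 * T.
Proof.
move=> T0; have h := sin_pi4; have h0 : 0 < sin (pi / 4 : R) by lra.
have hp := pi_gt0 R; split; [split|split].
- by rewrite /ramp mulr0 sin0 mulr0 mul0r.
- by rewrite /ramp mulr1 mulfK // lt0r_neq0.
- by rewrite /ramp; c1tac.
- by move=> s; rewrite /ramp /ramp'; isdeq; field; exact: lt0r_neq0.
- move=> s; change {for s, continuous (ramp' T)}; rewrite /ramp'; cts.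
- move=> s /andP[s0 s1]; rewrite divr_gt0 // !mulr_gt0 ?divr_gt0 //.
  by apply: cos_gt0_pihalf; nra.
- move=> s; rewrite /ramp normrM normfV [`|sin (pi / 4)|]gtr0_norm //.
  rewrite ler_pdivrMr // normrM gtr0_norm //.
  by have := sin_max (pi / 4 * s); nra.
Qed.

(** Together with [1 + K * poleK K tau p], the numbers [yK tau p] and [zK p]
    are the ambient coordinates of [p] in the frame at [axisK tau]: along the
    point itself, the axis and the normal of the axis. *)
Definition yK tau p : R :=
  if K == 0 then p 0 0 - tau else
  if 0 < K then (sinh (p 0 0) * cosh (k * tau) - cosh (p 0 0) * cos (p 0 1) * sinh (k * tau)) / k
  else cosh (p 0 1) * sin (p 0 0 - k * tau) / k.

Definition zK p : R :=
  if K == 0 then p 0 1 else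
  if 0 < K then cosh (p 0 0) * sin (p 0 1) / k else sinh (p 0 1) / k.

Lemma quadricK tau p :
  yK tau p ^+ 2 - zK p ^+ 2 = 2 * poleK K tau p + K * poleK K tau p ^+ 2.
Proof.
rewrite /yK /zK /poleK -/k.
have [K0|K0] := eqVneq K 0; [|have k0 : 0 < k := k_gt0 K0; have [Kp|Kp|/eqP] := ltgtP K 0;
  last (by rewrite (negbTE K0))].
- by rewrite K0; field.
- rewrite [RHS](_ : _ = ((cosh (p 0 1) * cos (p 0 0 - k * tau)) ^+ 2 - 1) / K); last by field.
  have := cosh2_sinh2 (p 0 1); have := sin2cos2 (p 0 0 - k * tau).
  move: (cosh _) (sinh _) (sin _) (cos _) => C S a b e1 e2.
  have KE := K_neg Kp; rewrite -/k in KE.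
  rewrite [LHS](_ : _ = (C ^+ 2 * a ^+ 2 - S ^+ 2) / k ^+ 2); last by field; exact: lt0r_neq0.
  by rewrite e1 exprMn e2 {1}KE; field; exact: lt0r_neq0.
- rewrite [RHS](_ : _ = ((cosh (k * tau) * (cosh (p 0 0) * cos (p 0 1)) -
     sinh (k * tau) * sinh (p 0 0)) ^+ 2 - 1) / K); last by field.
  have := cosh2_sinh2 (p 0 0); have := sin2cos2 (p 0 1); have := cosh2_sinh2 (k * tau).
  move: (cosh (k * _)) (sinh (k * _)) => C0 S0 e0.
  move: (cosh _) (sinh _) (sin _) (cos _) => C S a b e1 e2.
  have KE := K_pos Kp; rewrite -/k in KE.
  rewrite [LHS](_ : _ = ((S * C0 - C * b * S0) ^+ 2 - C ^+ 2 * a ^+ 2) / k ^+ 2); last by field; exact: lt0r_neq0.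
  rewrite e1 -KE; congr (_ / K).
  rewrite [LHS](_ : _ = S ^+ 2 * C0 ^+ 2 - 2 * S * C0 * C * b * S0 + C ^+ 2 * b ^+ 2 * (S0 ^+ 2 + 1) - C ^+ 2); last by ring.
  rewrite [RHS](_ : _ = C0 ^+ 2 * C ^+ 2 * b ^+ 2 - 2 * S * C0 * C * b * S0 + S0 ^+ 2 * S ^+ 2 - 1); last by ring.
  by rewrite e0 e2; ring.
Qed.

(** Half of the range [smallK], since [ramp T] is only bounded by [2 * T]. *)
Definition tinyK (T : R) := K < 0 -> k * T < pi / 4.

(** In this range [p] is recovered from its ambient coordinates. *)
Definition in_chartK tau Q := (K < 0 -> `|Q 0 0 - k * tau| < pi / 2) /\
  (0 < K -> `|Q 0 1| < pi).

(** [(E, Z)] is the direction at [axisK tau] of the geodesic to [Q]. *)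
Lemma frameK tau Q T : 0 < T -> tinyK T -> poleK K tau Q = mdK K T -> 0 < yK tau Q ->
  exists E Z, [/\ 0 < E, E ^+ 2 - Z ^+ 2 = 1, yK tau Q = E * snK K T & zK Q = Z * snK K T].
Proof.
move=> T0 hT hp y0.
have sT : smallK K T by move=> /hT; have := pi_gt0 R; rewrite -/k; lra.
have S0 := snK_gt0 T0 sT; exists (yK tau Q / snK K T), (zK Q / snK K T); split.
- exact: divr_gt0.
- rewrite !expr_div_n -mulrBl quadricK hp -snK_sq divff //.
  by rewrite expf_neq0 // lt0r_neq0.
- by rewrite divfK // lt0r_neq0.
- by rewrite divfK // lt0r_neq0.
Qed.

Lemma geodesic_flat tau Q T : K = 0 -> 0 < T -> poleK K tau Q = mdK K T -> 0 < yK tau Q ->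
  exists c, model_timelike_curve K c (axisK K tau) Q /\ model_length K c = T%:E.
Proof.
move=> K0 T0 hp y0; have hT : tinyK T by rewrite /tinyK K0 ltxx.
have [E [Z [E0 EZ]]] := frameK T0 hT hp y0.
have [[r0 r1 C1r dr cr] [r'0 _]] := rampP T0.
rewrite /yK /zK /snK K0 eqxx => hy hz.
pose c s := mkpt (tau + E * ramp T s) (Z * ramp T s).
have e0 : (fun s => c s 0 0) = (fun s => tau + E * ramp T s).
  by apply/funext => s; rewrite mkpt0.
have e1 : (fun s => c s 0 1) = (fun s => Z * ramp T s).
  by apply/funext => s; rewrite mkpt1.
have d0 s : isder s (fun s => c s 0 0) (E * ramp' T s).
  by rewrite e0; isdeq; ring.
have d1 s : isder s (fun s => c s 0 1) (Z * ramp' T s).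
  by rewrite e1; isdeq; ring.
have sp s : model_speed2 0 c s = - ramp' T s ^+ 2.
  rewrite (model_speed2E 0 (d0 s) (d1 s)) /space_part /time_part eqxx.
  rewrite [LHS](_ : _ = - (E ^+ 2 - Z ^+ 2) * ramp' T s ^+ 2); last by ring.
  by rewrite EZ; ring.
exists c; rewrite -K0 in sp *; split; last first.
  rewrite (model_length_unit dr cr) ?r1 ?r0 ?subr0 //.
  by move=> s s01; split; [exact: r'0|exact: sp].
split; last by move=> s /r'0 h; rewrite sp oppr_lt0 exprn_gt0.
split.
- by apply: model_pt_eq; rewrite /c /axisK K0 eqxx ?mkpt0 ?mkpt1 r0 mulr0 ?addr0.
- by apply: model_pt_eq; rewrite /c ?mkpt0 ?mkpt1 r1 // -hy; ring.
- apply: C1_coordinates.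
  + by rewrite e0; c1tac.
  + by rewrite e1; c1tac.
- by move=> s s01; rewrite (isd_derive1 (d0 s)) mulr_gt0 // r'0.
Qed.

(** The geodesic is a plane section of the quadric: in the frame at [axisK tau]
    its coordinates are [cos], [E * sin] and [Z * sin] of the parameter. The
    time coordinate is the polar angle of the first two. *)
Lemma geodesic_neg tau Q T : K < 0 -> 0 < T -> tinyK T -> in_chartK tau Q ->
  poleK K tau Q = mdK K T -> 0 < yK tau Q ->
  exists c, model_timelike_curve K c (axisK K tau) Q /\ model_length K c = T%:E.
Proof.
move=> Kn T0 hT [hQ _] hp y0.
have K0 : K != 0 by rewrite lt_eqF.
have k0 : 0 < k := k_gt0 K0; have KE := K_neg Kn; rewrite -/k in KE.
have [E [Z [E0 EZ]]] := frameK T0 hT hp y0.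
have [[r0 r1 C1r dr cr] [r'0 rb]] := rampP T0.
have {}hQ := hQ Kn; have {}hT := hT Kn.
rewrite /yK /zK /snK (negbTE K0) [0 < K]lt_gtF // -/k => hy hz.
move: hp; rewrite /poleK /mdK /csK (negbTE K0) [0 < K]lt_gtF // -/k => hp.
have {}hy : cosh (Q 0 1) * sin (Q 0 0 - k * tau) = E * sin (k * T).
  by apply: (@mulIf _ k^-1); rewrite ?invr_eq0 ?lt0r_neq0 // hy mulrA.
have {}hz : sinh (Q 0 1) = Z * sin (k * T).
  by apply: (@mulIf _ k^-1); rewrite ?invr_eq0 ?lt0r_neq0 // hz mulrA.
have {}hp : cosh (Q 0 1) * cos (Q 0 0 - k * tau) = cos (k * T).
  by apply: (@addIr _ (-1)); apply: (@mulIf _ K^-1) => //; rewrite invr_eq0.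
have cr0 s : 0 < cos (k * ramp T s).
  have : `|k * ramp T s| < pi / 2.
    by rewrite normrM gtr0_norm //; have := rb s; nra.
  by rewrite ltr_norml => h; apply: cos_gt0_pihalf.
pose c s := mkpt (k * tau + atan (E * sin (k * ramp T s) / cos (k * ramp T s)))
  (arsinh (Z * sin (k * ramp T s))).
have e0 : (fun s => c s 0 0) = (fun s => k * tau + atan (E * sin (k * ramp T s) / cos (k * ramp T s))).
  by apply/funext => s; rewrite mkpt0.
have e1 : (fun s => c s 0 1) = (fun s => arsinh (Z * sin (k * ramp T s))).
  by apply/funext => s; rewrite mkpt1.
pose D s := 1 + (Z * sin (k * ramp T s)) ^+ 2.
have D0 s : 0 < D s by rewrite ltr_pwDl // sqr_ge0.
have EE : E ^+ 2 = 1 + Z ^+ 2 by rewrite -EZ; ring.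
have DE s : D s = cos (k * ramp T s) ^+ 2 + (E * sin (k * ramp T s)) ^+ 2.
  by rewrite !exprMn EE cos2sin2; rewrite /D; ring.
have d0 s : isder s (fun s => c s 0 0) (E * k * ramp' T s / D s).
  rewrite e0; isdeq; first by rewrite lt0r_neq0.
  have cc := cr0 s; have hD := DE s; have hD0 := D0 s; have h2 := cos2Dsin2 (k * ramp T s).
  move: (cos _) (sin _) cc hD h2 => C S cc hD h2.
  have -> : 1 + (E * S / C) ^+ 2 = D s / C ^+ 2 by rewrite hD; field; exact: lt0r_neq0.
  have -> : (0 * S + E * (C * (0 * ramp T s + k * ramp' T s))) / C +
     E * S * (- (- S * (0 * ramp T s + k * ramp' T s)) / C ^+ 2) =
     E * k * ramp' T s * (C ^+ 2 + S ^+ 2) / C ^+ 2 by field; exact: lt0r_neq0.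
  by rewrite h2; field; rewrite !lt0r_neq0.
have d1 s : isder s (fun s => c s 0 1) (Z * cos (k * ramp T s) * k * ramp' T s / Num.sqrt (D s)).
  rewrite e1; apply: isd_eq.
    apply: (@isd_comp _ arsinh (fun s => Z * sin (k * ramp T s))); first exact: isd_arsinh.
    by isd.
  by cbv beta; rewrite -/(D s); ring.
have sp s : model_speed2 K c s = - ramp' T s ^+ 2.
  rewrite (model_speed2E K (d0 s) (d1 s)) /space_part /time_part (negbTE K0) [0 < K]lt_gtF // -/k.
  rewrite mkpt1 cosh_arsinh -/(D s).
  have sD : 0 < Num.sqrt (D s) by rewrite sqrtr_gt0.
  have := sqr_sqrtr (ltW (D0 s)); move: (Num.sqrt _) sD => d dd0 hd.
  rewrite [LHS](_ : _ = ramp' T s ^+ 2 * (Z ^+ 2 * cos (k * ramp T s) ^+ 2 * D s / d ^+ 2 - E ^+ 2 * d ^+ 2 / D s) / D s); last first.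
    by field; rewrite !lt0r_neq0.
  rewrite hd !mulfK ?lt0r_neq0 // EE cos2sin2.
  rewrite (_ : _ - _ = - D s); last by rewrite /D; ring.
  by rewrite mulrN mulNr mulfK // lt0r_neq0.
exists c; split; last first.
  rewrite (model_length_unit dr cr) ?r1 ?r0 ?subr0 //.
  by move=> s s01; split; [exact: r'0|exact: sp].
split; last by move=> s /r'0 h; rewrite sp oppr_lt0 exprn_gt0.
split.
- apply: model_pt_eq; rewrite /c /axisK (negbTE K0) ?mkpt0 ?mkpt1 r0 mulr0 sin0 mulr0.
    by rewrite mul0r atan0 addr0.
  by have := @arsinh_sinh R 0; rewrite sinh0.
- apply: model_pt_eq; rewrite /c ?mkpt0 ?mkpt1 r1; last by rewrite -hz arsinh_sinh.
  have cQ : 0 < cos (Q 0 0 - k * tau) by move: hQ; rewrite ltr_norml => h; apply: cos_gt0_pihalf.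
  have -> : E * sin (k * T) / cos (k * T) = tan (Q 0 0 - k * tau).
    by rewrite -hy -hp /tan; field; rewrite !lt0r_neq0 // cosh_gt0.
  by rewrite tanK ?in_itv /= -?ltr_norml //; ring.
- apply: C1_coordinates.
  + by rewrite e0; c1tac => s; rewrite lt0r_neq0.
  + by rewrite e1; apply: C1_arsinh; c1tac.
- move=> s s01; rewrite (isd_derive1 (d0 s)) divr_gt0 //.
  by apply: mulr_gt0; [exact: mulr_gt0|exact: r'0].
Qed.

(** Here the plane section is a hyperbola. The ambient coordinates [Y],
    [A] and [B] are those of a fixed frame, obtained by a boost from those in
    the frame at [axisK tau]; the space coordinate is the polar angle of
    [(A, B)], written by the half-angle formula so that it is smooth off the
    negative half-axis. *)
Lemma geodesic_pos tau Q T : 0 < K -> 0 < T -> in_chartK tau Q ->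
  poleK K tau Q = mdK K T -> 0 < yK tau Q ->
  exists c, model_timelike_curve K c (axisK K tau) Q /\ model_length K c = T%:E.
Proof.
move=> Kp T0 [_ hQ] hp y0.
have hT : tinyK T by rewrite /tinyK ltNge (ltW Kp).
have K0 : K != 0 by rewrite gt_eqF.
have k0 : 0 < k := k_gt0 K0; have KE := K_pos Kp; rewrite -/k in KE.
have [E [Z [E0 EZ]]] := frameK T0 hT hp y0.
have [[r0 r1 C1r dr cr] [r'0 _]] := rampP T0.
have {}hQ := hQ Kp.
rewrite /yK /zK /snK (negbTE K0) Kp -/k => hy hz.
move: hp; rewrite /poleK /mdK /csK (negbTE K0) Kp -/k => hp.
have := cosh2_sinh2 (k * tau); have := cosh_gt0 (k * tau).
have hk0 : sinh (k * tau) <= 0 \/ 0 <= sinh (k * tau) by apply/orP; exact: le_total.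
have ch0 : - cosh (k * tau) < sinh (k * tau) < cosh (k * tau).
  exact: sinh_lt_cosh.
have hT0 : axisK K tau = mkpt (arsinh (sinh (k * tau))) 0.
  by rewrite /axisK (negbTE K0) arsinh_sinh.
move: hp hy hT0 ch0; move: (cosh (k * tau)) (sinh (k * tau)) => C0 S0 hp hy hT0 ch0 C00 CS0.
have {}hy : sinh (Q 0 0) * C0 - cosh (Q 0 0) * cos (Q 0 1) * S0 = E * sinh (k * T).
  by apply: (@mulIf _ k^-1); rewrite ?invr_eq0 ?lt0r_neq0 // hy mulrA.
have {}hz : cosh (Q 0 0) * sin (Q 0 1) = Z * sinh (k * T).
  by apply: (@mulIf _ k^-1); rewrite ?invr_eq0 ?lt0r_neq0 // hz mulrA.
have {}hp : C0 * (cosh (Q 0 0) * cos (Q 0 1)) - S0 * sinh (Q 0 0) = cosh (k * T).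
  by apply: (@addIr _ (-1)); apply: (@mulIf _ K^-1) => //; rewrite invr_eq0.
have E1 : 1 <= E by nra.
pose Y s := E * sinh (k * ramp T s) * C0 + cosh (k * ramp T s) * S0.
pose A s := cosh (k * ramp T s) * C0 + E * sinh (k * ramp T s) * S0.
pose B s := Z * sinh (k * ramp T s).
pose Y' s := (E * cosh (k * ramp T s) * C0 + sinh (k * ramp T s) * S0) * (k * ramp' T s).
pose A' s := (sinh (k * ramp T s) * C0 + E * cosh (k * ramp T s) * S0) * (k * ramp' T s).
pose B' s := Z * cosh (k * ramp T s) * (k * ramp' T s).
have dY s : isder s Y (Y' s) by rewrite /Y /Y'; isdeq; ring.
have dA s : isder s A (A' s) by rewrite /A /A'; isdeq; ring.
have dB s : isder s B (B' s) by rewrite /B /B'; isdeq; ring.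
have hAB s : A s ^+ 2 + B s ^+ 2 = 1 + Y s ^+ 2.
  rewrite /A /B /Y; have := cosh2_sinh2 (k * ramp T s).
  move: (cosh _) (sinh _) => C S e.
  rewrite [LHS](_ : _ = C ^+ 2 * C0 ^+ 2 + E ^+ 2 * S ^+ 2 * S0 ^+ 2 + 2 * C * C0 * E * S * S0 + (E ^+ 2 - (E ^+ 2 - Z ^+ 2)) * S ^+ 2); last by ring.
  rewrite EZ CS0.
  rewrite [RHS](_ : _ = 1 + E ^+ 2 * S ^+ 2 * C0 ^+ 2 + C ^+ 2 * S0 ^+ 2 + 2 * C * C0 * E * S * S0); last by ring.
  by rewrite CS0 e; ring.
have hAB' s : A s * A' s + B s * B' s = Y s * Y' s.
  rewrite /A /B /Y /A' /B' /Y'; move: (cosh _) (sinh _) => C S.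
  rewrite [LHS](_ : _ = C * S * (C0 ^+ 2 + E ^+ 2 * S0 ^+ 2 + (E ^+ 2 - (E ^+ 2 - Z ^+ 2))) * (k * ramp' T s)
     + E * C0 * S0 * (C ^+ 2 + S ^+ 2) * (k * ramp' T s)); last by ring.
  by rewrite EZ CS0; rewrite [RHS](_ : _ = C * S * (E ^+ 2 * C0 ^+ 2 + S0 ^+ 2) * (k * ramp' T s)
     + E * C0 * S0 * (C ^+ 2 + S ^+ 2) * (k * ramp' T s)); [rewrite CS0; ring|ring].
have hAB'2 s : A' s ^+ 2 + B' s ^+ 2 - Y' s ^+ 2 = - (k * ramp' T s) ^+ 2.
  rewrite /A' /B' /Y'; have := cosh2_sinh2 (k * ramp T s).
  move: (cosh _) (sinh _) => C S e.
  rewrite [LHS](_ : _ = (S ^+ 2 * (C0 ^+ 2 - S0 ^+ 2) - C ^+ 2 * E ^+ 2 * (C0 ^+ 2 - S0 ^+ 2) + (E ^+ 2 - (E ^+ 2 - Z ^+ 2)) * C ^+ 2) * (k * ramp' T s) ^+ 2); last by ring.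
  by rewrite EZ CS0 e; ring.
pose rho s := Num.sqrt (1 + Y s ^+ 2).
have rho0 s : 0 < rho s by case: (sqrt1D_gt (Y s)).
have rho2 s : rho s ^+ 2 = 1 + Y s ^+ 2.
  by rewrite /rho sqr_sqrtr // addr_ge0 // sqr_ge0.
have chs s : - cosh (k * ramp T s) < sinh (k * ramp T s) < cosh (k * ramp T s).
  exact: sinh_lt_cosh.
(* the curve avoids the cut of the polar angle *)
have rA s : 0 < rho s + A s.
  have [A0|A0] := ltP 0 (A s); first by have := rho0 s; lra.
  have B0 : B s != 0.
    apply/eqP => /eqP; rewrite /B mulf_eq0 => /orP[/eqP Z0|/eqP s0]; move: A0; rewrite /A.
      have -> : E = 1.
        by apply/eqP; rewrite -(@eqrXn2 _ 2) ?ler01 ?ltW // expr1n; move: EZ; rewrite Z0 => <-; apply/eqP; ring.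
      move=> A0; have := chs s; have := mulr_gt0 C00 (cosh_gt0 (k * ramp T s)).
      move: (cosh _) (sinh _) A0 => C S A0 h1 h2; nra.
    rewrite s0 mulr0 mul0r addr0 => h; have := mulr_gt0 (cosh_gt0 (k * ramp T s)) C00; lra.
  have B2 : 0 < B s ^+ 2 by rewrite exprn_even_gt0 //= B0.
  by have := hAB s; rewrite -rho2 => h; have := rho0 s; nra.
have drho s : isder s rho (Y s * Y' s / rho s).
  rewrite /rho; apply: isd_eq.
    apply: (@isd_comp _ (@Num.sqrt R) (fun s => 1 + Y s ^+ 2)); last by isd.
    by apply: isd_sqrt; rewrite -rho2 exprn_gt0.
  by cbv beta; rewrite -/(rho s) /= expr1; field; exact: lt0r_neq0.
pose c s := mkpt (arsinh (Y s)) (2 * atan (B s / (rho s + A s))).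
have e0 : (fun s => c s 0 0) = (fun s => arsinh (Y s)).
  by apply/funext => s; rewrite mkpt0.
have e1 : (fun s => c s 0 1) = (fun s => 2 * atan (B s / (rho s + A s))).
  by apply/funext => s; rewrite mkpt1.
have d0 s : isder s (fun s => c s 0 0) (Y' s / rho s).
  rewrite e0; apply: isd_eq.
    by apply: (@isd_comp _ arsinh Y); [exact: isd_arsinh|exact: dY].
  by rewrite mulrC.
have d1 s : isder s (fun s => c s 0 1) ((A s * B' s - B s * A' s) / rho s ^+ 2).
  rewrite e1; isdeq; first by rewrite lt0r_neq0.
  have h1 := rho0 s; have h2 := rA s; have h3 := rho2 s; have h4 := hAB s; have h5 := hAB' s.
  have h6 : (rho s + A s) ^+ 2 + B s ^+ 2 = 2 * rho s * (rho s + A s).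
    rewrite [LHS](_ : _ = rho s ^+ 2 + 2 * rho s * A s + (A s ^+ 2 + B s ^+ 2)); last by ring.
    by rewrite h4 -h3; ring.
  have -> : 1 + (B s / (rho s + A s)) ^+ 2 = 2 * rho s / (rho s + A s).
    rewrite [LHS](_ : _ = ((rho s + A s) ^+ 2 + B s ^+ 2) / (rho s + A s) ^+ 2); last first.
      by field; exact: lt0r_neq0.
    by rewrite h6; field; exact: lt0r_neq0.
  rewrite -h5.
  rewrite [LHS](_ : _ = (B' s * rho s * (rho s + A s) - B s * (A s * A' s + B s * B' s) - rho s * B s * A' s) /
    (rho s ^+ 2 * (rho s + A s))); last by field; rewrite !lt0r_neq0 // mulr_gt0.
  rewrite [X in X / _](_ : _ = (A s * B' s - B s * A' s) * (rho s + A s)); last first.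
    rewrite [LHS](_ : _ = B' s * (rho s ^+ 2) + B' s * rho s * A s - B s * (A s * A' s + B s * B' s) - rho s * B s * A' s); last by ring.
    by rewrite h3 -h4; ring.
  by field; rewrite !lt0r_neq0.
have sp s : model_speed2 K c s = - ramp' T s ^+ 2.
  rewrite (model_speed2E K (d0 s) (d1 s)) /space_part /time_part (negbTE K0) Kp -/k.
  rewrite mkpt0 cosh_arsinh -/(rho s).
  have h1 := rho0 s; have h3 := rho2 s; have h4 := hAB s; have h5 := hAB' s.
  rewrite [LHS](_ : _ = (((A s ^+ 2 + B s ^+ 2) * (A' s ^+ 2 + B' s ^+ 2) - (A s * A' s + B s * B' s) ^+ 2) - Y' s ^+ 2) / rho s ^+ 2 / k ^+ 2); last first.
    by field; rewrite !lt0r_neq0.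
  have -> : A' s ^+ 2 + B' s ^+ 2 = Y' s ^+ 2 - (k * ramp' T s) ^+ 2 by rewrite -(opprK ((k * _) ^+ 2)) -hAB'2; ring.
  rewrite h5 h4 -h3.
  rewrite [X in X / _ / _](_ : _ = - (k * ramp' T s) ^+ 2 * rho s ^+ 2); last first.
    by rewrite h3; ring.
  by field; rewrite !lt0r_neq0.
exists c; split; last first.
  rewrite (model_length_unit dr cr) ?r1 ?r0 ?subr0 //.
  by move=> s s01; split; [exact: r'0|exact: sp].
split; last by move=> s /r'0 h; rewrite sp oppr_lt0 exprn_gt0.
split.
- rewrite hT0; apply: model_pt_eq; rewrite /c ?mkpt0 ?mkpt1.
    by rewrite /Y r0 mulr0 sinh0 cosh0; congr (arsinh _); ring.
  by rewrite /B r0 mulr0 sinh0 mulr0 mul0r atan0 mulr0.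
- have hA1 : A 1 = cosh (Q 0 0) * cos (Q 0 1).
    rewrite /A r1 -hy -hp.
    rewrite [LHS](_ : _ = (C0 ^+ 2 - S0 ^+ 2) * (cosh (Q 0 0) * cos (Q 0 1))); last by ring.
    by rewrite CS0; ring.
  have hY1 : Y 1 = sinh (Q 0 0).
    rewrite /Y r1 -hy -hp.
    rewrite [LHS](_ : _ = (C0 ^+ 2 - S0 ^+ 2) * sinh (Q 0 0)); last by ring.
    by rewrite CS0; ring.
  have hB1 : B 1 = cosh (Q 0 0) * sin (Q 0 1) by rewrite /B r1 -hz.
  apply: model_pt_eq; rewrite /c ?mkpt0 ?mkpt1; first by rewrite hY1 arsinh_sinh.
  have hr : rho 1 = cosh (Q 0 0) by rewrite /rho hY1 -cosh2_sinh2 sqrtr_sqr gtr0_norm // cosh_gt0.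
  have hx : - (pi / 2) < Q 0 1 / 2 < pi / 2 by move: hQ; rewrite ltr_norml; lra.
  have hc : 0 < cos (Q 0 1 / 2) by exact: cos_gt0_pihalf.
  have h2 : Q 0 1 = Q 0 1 / 2 + Q 0 1 / 2 by field.
  have -> : B 1 / (rho 1 + A 1) = tan (Q 0 1 / 2).
    rewrite hr hA1 hB1 /tan; have hs := sinD (Q 0 1 / 2) (Q 0 1 / 2).
    have hcD := cosD (Q 0 1 / 2) (Q 0 1 / 2); rewrite -h2 in hs hcD.
    rewrite hs hcD; have := cos2Dsin2 (Q 0 1 / 2); have ch := cosh_gt0 (Q 0 0).
    move: (cos (Q 0 1 / 2)) (sin (Q 0 1 / 2)) hc (cosh _) ch => a b a0 C ch ab.
    have -> : C + C * (a * a - b * b) = 2 * C * a ^+ 2.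
      by rewrite [RHS](_ : _ = C * (a ^+ 2 + b ^+ 2) + C * (a * a - b * b)); [rewrite ab; ring|ring].
    by field; rewrite !lt0r_neq0.
  by rewrite tanK ?in_itv //=; field.
- have C1Y : C1 Y by rewrite /Y; c1tac.
  have C1A : C1 A by rewrite /A; c1tac.
  have C1B : C1 B by rewrite /B; c1tac.
  have C1rho : C1 rho.
    rewrite /rho; apply: C1_sqrt; last by c1tac.
    by move=> s; rewrite -rho2 exprn_gt0.
  apply: C1_coordinates.
  + by rewrite e0; apply: C1_arsinh.
  + by rewrite e1; c1tac => s; rewrite lt0r_neq0.
- move=> s s01; rewrite (isd_derive1 (d0 s)) divr_gt0 //.
  apply: mulr_gt0; last by apply: mulr_gt0 => //; exact: r'0.
  have := chs s; have := cosh_gt0 (k * ramp T s).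
  move: (cosh _) (sinh _) => C S h1 h2.
  have p1 : 0 < (C + S) * (C0 + S0) by apply: mulr_gt0; lra.
  have p2 : 0 < (C - S) * (C0 - S0) by apply: mulr_gt0; lra.
  have p3 : 0 <= (E - 1) * (C * C0) by rewrite !mulr_ge0 ?subr_ge0 // ltW.
  by lra.
Qed.

Lemma geodesicK tau Q T : 0 < T -> tinyK T -> in_chartK tau Q ->
  poleK K tau Q = mdK K T -> 0 < yK tau Q ->
  exists c, model_timelike_curve K c (axisK K tau) Q /\ model_length K c = T%:E.
Proof.
have [Kn|Kp|K0] := ltgtP K 0; first exact: geodesic_neg.
- by move=> T0 _; exact: geodesic_pos.
- by move=> T0 _ _; exact: geodesic_flat.
Qed.

End geodesics.

(** * Time separation and thin triangles in the model planes *)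

Section model_time_separation.
Context {R : realType} (K : R).
Let k : R := Num.sqrt `|K|.
Notation model_pt := (@model_pt R).
Implicit Types (p q Q : model_pt) (c : R -> model_pt) (s t x tau : R).

(** Time reversal is an isometry which exchanges past and future. *)
Definition reflect p : model_pt := mkpt (- p 0 0) (p 0 1).
Definition reverse c : R -> model_pt := fun s => reflect (c (1 - s)).

Lemma reflectK p : reflect (reflect p) = p.
Proof. by apply: model_pt_eq; rewrite /reflect !(mkpt0, mkpt1) ?opprK. Qed.

Lemma reflect_axisK tau : reflect (axisK K tau) = axisK K (- tau).
Proof.
apply: model_pt_eq; rewrite /reflect /axisK !(mkpt0, mkpt1) //.
by case: ifP; rewrite ?mulrN.
Qed.

Lemma isd_reverse0 c s : (forall i, C1 (fun u => c u 0 i)) ->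
  isder s (fun u => reverse c u 0 0) (derive1 (fun u => c u 0 0) (1 - s)).
Proof.
move=> hC; have -> : (fun u => reverse c u 0 0) = (fun u => - c (1 - u) 0 0).
  by apply/funext => u; rewrite /reverse mkpt0.
apply: isd_eq.
  apply: isd_opp; apply: (@isd_comp _ (fun v => c v 0 0) (fun u => 1 - u)).
    exact: (C1_isd (hC 0)).
  by isd.
by ring.
Qed.

Lemma isd_reverse1 c s : (forall i, C1 (fun u => c u 0 i)) ->
  isder s (fun u => reverse c u 0 1) (- derive1 (fun u => c u 0 1) (1 - s)).
Proof.
move=> hC; have -> : (fun u => reverse c u 0 1) = (fun u => c (1 - u) 0 1).
  by apply/funext => u; rewrite /reverse mkpt1.
apply: isd_eq.
  apply: (@isd_comp _ (fun v => c v 0 1) (fun u => 1 - u)).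
    exact: (C1_isd (hC 1)).
  by isd.
by ring.
Qed.

Lemma model_speed2_reverse c s : (forall i, C1 (fun u => c u 0 i)) ->
  model_speed2 K (reverse c) s = model_speed2 K c (1 - s).
Proof.
move=> hC.
rewrite (model_speed2E K (isd_reverse0 s hC) (isd_reverse1 s hC)).
rewrite (model_speed2E K (C1_isd (hC 0) (1 - s)) (C1_isd (hC 1) (1 - s))).
rewrite /space_part /time_part /reverse mkpt0 mkpt1 coshN.
by case: ifP => _; [|case: ifP => _]; ring.
Qed.

Lemma model_future_curve_reverse c p q :
  model_future_curve c p q -> model_future_curve (reverse c) (reflect q) (reflect p).
Proof.
move=> [c0 c1 hC t0]; split.
- by rewrite /reverse subr0 c1.
- by rewrite /reverse subrr c0.
- apply: C1_coordinates.
  + have -> : (fun t => reverse c t 0 0) = (fun u => - c (1 - u) 0 0).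
      by apply/funext => u; rewrite /reverse mkpt0.
    apply: C1_opp; apply: (@C1_comp_on _ (fun v => c v 0 0) (derive1 (fun v => c v 0 0)) (fun u => 1 - u)).
    * by c1tac.
    * by move=> t; exact: (C1_isd (hC 0)).
    * by move=> t; exact: (hC 0).2.
  + have -> : (fun t => reverse c t 0 1) = (fun u => c (1 - u) 0 1).
      by apply/funext => u; rewrite /reverse mkpt1.
    apply: (@C1_comp_on _ (fun v => c v 0 1) (derive1 (fun v => c v 0 1)) (fun u => 1 - u)).
    * by c1tac.
    * by move=> t; exact: (C1_isd (hC 1)).
    * by move=> t; exact: (hC 1).2.
- by move=> t t01; rewrite (isd_derive1 (isd_reverse0 t hC)) t0 //; lra.
Qed.

Lemma model_causal_curve_reverse c p q :
  model_causal_curve K c p q -> model_causal_curve K (reverse c) (reflect q) (reflect p).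
Proof.
move=> [h hs]; split; first exact: model_future_curve_reverse.
by move=> t t01; rewrite model_speed2_reverse; [apply: hs; lra|case: h].
Qed.

Lemma model_timelike_curve_reverse c p q :
  model_timelike_curve K c p q -> model_timelike_curve K (reverse c) (reflect q) (reflect p).
Proof.
move=> [h hs]; split; first exact: model_future_curve_reverse.
by move=> t t01; rewrite model_speed2_reverse; [apply: hs; lra|case: h].
Qed.

Lemma model_length_reverse c : (forall i, C1 (fun u => c u 0 i)) ->
  model_length K (reverse c) = model_length K c.
Proof.
move=> hC; rewrite /model_length.
have cw : {within `[0, 1], continuous (fun s => Num.sqrt (- model_speed2 K c s))}.
  apply: continuous_subspaceT => s.
  have cs : {for s, continuous (model_speed2 K c)} by exact: cts_model_speed2.
  match goal with |- continuous_at _ ?f => change {for s, continuous f} end.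
  by cts.
have := @integration_by_substitution_onem R (fun s => Num.sqrt (- model_speed2 K c s)) 1 _ cw.
rewrite lexx ler01 [unstable.onem 1](_ : _ = 0); last by rewrite /unstable.onem subrr.
move=> /(_ isT) h; rewrite [RHS]h; apply: eq_integral => s _.
by rewrite model_speed2_reverse.
Qed.

Lemma model_tau_reflect p q : model_tau K (reflect q) (reflect p) = model_tau K p q.
Proof.
rewrite /model_tau; congr (maxe _ (ereal_sup _)); apply/seteqP; split => x /= [c hc <-].
- exists (reverse c); last by rewrite model_length_reverse //; case: hc => -[].
  by have := model_causal_curve_reverse hc; rewrite !reflectK.
- exists (reverse c); last by rewrite model_length_reverse //; case: hc => -[].
  exact: model_causal_curve_reverse.
Qed.

Lemma timelike_causal_curve c p q :
  model_timelike_curve K c p q -> model_causal_curve K c p q.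
Proof. by move=> [h hs]; split => // t /hs /ltW. Qed.

Lemma model_ll_le p q : model_ll K p q -> model_le K p q.
Proof. by move=> [c /timelike_causal_curve hc]; right; exists c. Qed.

Lemma future_curve_time c p q : model_future_curve c p q -> p 0 0 < q 0 0.
Proof.
move=> [c0 c1 hC t0]; have h := C1_isd (hC 0).
have [|s] := @MVT R (fun t => c t 0 0) _ 0 1 ltr01 (fun s _ => h s).
  by apply: continuous_subspaceT; exact: C1_cts (hC 0).
rewrite in_itv /= => /andP[s0 s1]; rewrite c0 c1 subr0 mulr1 -subr_gt0 => ->.
by apply: t0; rewrite !ltW.
Qed.

Lemma model_tau_past p q : q 0 0 <= p 0 0 -> model_tau K p q = 0%E.
Proof.
move=> qp; rewrite /model_tau (_ : [set _ | _ in _] = set0).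
  by rewrite ereal_sup0; exact/max_idPl/leNye.
apply/seteqP; split => // x /= [c [/future_curve_time pq _] _].
by move: pq; rewrite ltNge qp.
Qed.

(** Time separation [T] together with the curves that witness it. *)
Definition model_dist p q (T : R) := [/\ model_ll K p q, model_tau K p q = T%:E &
  exists2 c, model_causal_curve K c p q & model_length K c = model_tau K p q].

(** [geodesicK] gives a curve of length [T], and [causal_length_le] shows that
    no causal curve is longer. *)
Lemma model_dist_from_axis tau Q T : 0 < T -> tinyK K T -> in_chartK K tau Q ->
  poleK K tau Q = mdK K T -> 0 < yK K tau Q -> model_dist (axisK K tau) Q T.
Proof.
move=> T0 hT hQ hp y0; have [c [hc hl]] := geodesicK T0 hT hQ hp y0.
have hcc := timelike_causal_curve hc.
have ht : model_tau K (axisK K tau) Q = T%:E.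
  apply/eqP; rewrite eq_le; apply/andP; split.
    rewrite /model_tau ge_max lee_fin ltW //=; apply: ge_ereal_sup => x /= [c' hc' <-].
    have hb : poleK_bound K tau Q.
      by move=> /(hQ.1); rewrite ltr_norml => /andP[].
    have [L [L0 sL -> hL]] := causal_length_le hc' hb.
    by rewrite lee_fin; apply: (@mdK_lerI _ K) => //; [exact: ltW|rewrite -hp].
  rewrite /model_tau le_max; apply/orP; right; apply: ereal_sup_ubound.
  by exists c.
by split; [exists c|exact: ht|exists c => //; rewrite ht].
Qed.

Lemma model_dist_reflect p q T : model_dist p q T -> model_dist (reflect q) (reflect p) T.
Proof.
move=> [[c hc] h [c' hc' hl]]; split.
- by exists (reverse c); exact: model_timelike_curve_reverse.
- by rewrite model_tau_reflect.
- exists (reverse c'); first exact: model_causal_curve_reverse.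
  by rewrite model_tau_reflect model_length_reverse //; case: hc' => -[].
Qed.

Lemma poleK_reflect tau Q : poleK K (- tau) (reflect Q) = poleK K tau Q.
Proof.
rewrite /poleK /reflect mkpt0 mkpt1 -/k mulrN coshN coshN !sinhN.
have -> : - Q 0 0 - - (k * tau) = - (Q 0 0 - k * tau) by ring.
by rewrite cosN; case: ifP => _; [ring|case: ifP => _ //; ring].
Qed.

Lemma yK_reflect tau Q : yK K (- tau) (reflect Q) = - yK K tau Q.
Proof.
rewrite /yK /reflect mkpt0 mkpt1 -/k mulrN coshN coshN !sinhN.
have -> : - Q 0 0 - - (k * tau) = - (Q 0 0 - k * tau) by ring.
by rewrite sinN; case: ifP => _; [ring|case: ifP => _ //; ring].
Qed.

Lemma model_dist_to_axis tau Q T : 0 < T -> tinyK K T -> in_chartK K tau Q ->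
  poleK K tau Q = mdK K T -> yK K tau Q < 0 -> model_dist Q (axisK K tau) T.
Proof.
move=> T0 hT [hQ1 hQ2] hp y0.
have := @model_dist_from_axis (- tau) (reflect Q) T T0 hT.
rewrite poleK_reflect yK_reflect oppr_gt0 => h.
have {}h : model_dist (axisK K (- tau)) (reflect Q) T.
  apply: h => //; split=> [Kn|Kp]; rewrite /reflect ?mkpt0 ?mkpt1; last exact: hQ2.
  have -> : - Q 0 0 - Num.sqrt `|K| * - tau = - (Q 0 0 - k * tau) by rewrite -/k; ring.
  by rewrite normrN; exact: hQ1.
by have := model_dist_reflect h; rewrite reflect_axisK opprK reflectK.
Qed.

(** A point is determined, up to the reflection in the axis, by two coordinates
    in which the modified distances from all points of the axis are affine. *)
Lemma chartK (m y : R) : 0 <= m -> 0 <= y -> 0 < 1 + K * m -> 2 * m + K * m ^+ 2 <= y ^+ 2 ->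
  exists Q, [/\ forall tau, poleK K tau Q = m * csK K tau + mdK K tau - y * snK K tau,
    forall tau, yK K tau Q = y * csK K tau - (1 + K * m) * snK K tau,
    K < 0 -> 0 <= Q 0 0 < pi / 2 & 0 < K -> `|Q 0 1| < pi].
Proof.
move=> m0 y0 A0 hq; rewrite /poleK /yK /mdK /csK /snK -/k.
have [K0|K0] := eqVneq K 0; [|have k0 : 0 < k := k_gt0 K0; have [Kn|Kp|/eqP] := ltgtP K 0;
  last (by rewrite (negbTE K0))].
- rewrite K0 mul0r addr0 in hq.
  exists (mkpt y (Num.sqrt (y ^+ 2 - 2 * m))); rewrite mkpt0 mkpt1 K0 ltxx; split => // tau.
  + by rewrite sqr_sqrtr ?subr_ge0 //; field.
  + by ring.
- have KE := K_neg Kn; rewrite -/k in KE.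
  pose A := 1 + K * m; pose rho := Num.sqrt (A ^+ 2 + (k * y) ^+ 2).
  have AyE : 1 <= A ^+ 2 + (k * y) ^+ 2.
    have -> : A ^+ 2 + (k * y) ^+ 2 = 1 - K * (y ^+ 2 - (2 * m + K * m ^+ 2)).
      by rewrite /A [k * y]mulrC exprMn -[k ^+ 2]opprK -KE; ring.
    have : K * (y ^+ 2 - (2 * m + K * m ^+ 2)) <= 0 by rewrite nmulr_rle0 // subr_ge0.
    by lra.
  have hA : 0 < A by [].
  have rho0 : 0 < rho by rewrite sqrtr_gt0; lra.
  have rho2 : rho ^+ 2 = A ^+ 2 + (k * y) ^+ 2 by rewrite sqr_sqrtr //; lra.
  have [c0 s0] : cos (atan (k * y / A)) = A / rho /\ sin (atan (k * y / A)) = k * y / rho.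
    have h := cos_atan (k * y / A); have hb := atan_ltpi2 (k * y / A).
    have hr : Num.sqrt (1 + (k * y / A) ^+ 2) = rho / A.
      apply/eqP; rewrite -(@eqrXn2 _ 2) ?sqrtr_ge0 ?ltW ?divr_gt0 //.
      rewrite sqr_sqrtr; last by rewrite addr_ge0 // sqr_ge0.
      by rewrite [X in _ == X]expr_div_n rho2; apply/eqP; field; exact: lt0r_neq0.
    have hc : cos (atan (k * y / A)) = A / rho by rewrite h hr; field; rewrite !lt0r_neq0.
    split => //; have := atanK (k * y / A); rewrite {1}/tan => ht.
    have : sin (atan (k * y / A)) = k * y / A * cos (atan (k * y / A)).
      have ce : cos (atan (k * y / A)) != 0 by rewrite hc lt0r_neq0 // divr_gt0.
      by rewrite -[LHS](divfK ce) ht.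
    by rewrite hc => ->; field; rewrite !lt0r_neq0.
  pose x := arsinh (Num.sqrt (rho ^+ 2 - 1)).
  have cx : cosh x = rho.
    rewrite cosh_arsinh sqr_sqrtr ?subr_ge0 ?rho2 // addrC subrK -rho2.
    by rewrite sqrtr_sqr gtr0_norm.
  exists (mkpt (atan (k * y / A)) x); rewrite mkpt0 mkpt1 cx; split => [tau|tau|_|//].
  + rewrite cosB c0 s0.
    have -> : rho * (A / rho * cos (k * tau) + k * y / rho * sin (k * tau)) =
      A * cos (k * tau) + k * y * sin (k * tau) by field; exact: lt0r_neq0.
    have -> : y * (sin (k * tau) / k) = - (k * y * sin (k * tau)) / K.
      by rewrite KE; field; exact: lt0r_neq0.
    by rewrite /A; field.
  + rewrite sinB c0 s0.
    by rewrite -/A; field; rewrite !lt0r_neq0.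
  + rewrite atan_ltpi2 andbT -atan0 le_atan //.
    by rewrite divr_ge0 ?mulr_ge0 // ltW.
- have KE := K_pos Kp; rewrite -/k in KE.
  pose A := 1 + K * m; pose rho := Num.sqrt (1 + (k * y) ^+ 2).
  have AyE : A ^+ 2 <= 1 + (k * y) ^+ 2.
    have -> : 1 + (k * y) ^+ 2 = A ^+ 2 + K * (y ^+ 2 - (2 * m + K * m ^+ 2)).
      by rewrite /A [k * y]mulrC exprMn -KE; ring.
    by rewrite lerDl pmulr_rge0 // subr_ge0.
  have hA : 0 < A by [].
  have rho0 : 0 < rho by rewrite sqrtr_gt0; have := sqr_ge0 (k * y); lra.
  have rho2 : rho ^+ 2 = 1 + (k * y) ^+ 2 by rewrite sqr_sqrtr //; have := sqr_ge0 (k * y); lra.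
  have Ar : A <= rho by rewrite -(@ler_pXn2r _ 2) ?nnegrE ?(ltW hA) ?(ltW rho0) // rho2.
  have Ar1 : -1 <= A / rho <= 1.
    by rewrite ler_pdivrMr // mul1r Ar andbT; apply: (@le_trans _ _ 0); rewrite ?divr_ge0 ?ltW //; lra.
  exists (mkpt (arsinh (k * y)) (acos (A / rho))); rewrite mkpt0 mkpt1 cosh_arsinh sinh_arsinh -/rho.
  rewrite acosK ?in_itv //.
  have rA : rho * (A / rho) = A by field; exact: lt0r_neq0.
  rewrite rA; split => [tau|tau|//|_].
  + have -> : y * (sinh (k * tau) / k) = k * y * sinh (k * tau) / K.
      by rewrite KE; field; exact: lt0r_neq0.
    by rewrite /A; field.
  + by rewrite -/A; field; exact: lt0r_neq0.
  + rewrite ger0_norm ?acos_ge0 // acos_ltpi //.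
    by case/andP: Ar1 => _ ->; rewrite andbT (@lt_trans _ _ 0) ?divr_gt0 //; lra.
Qed.

Lemma smallK_tinyK T : 0 < T -> tinyK K T -> smallK K T.
Proof. by move=> T0 hT /hT; have := pi_gt0 R; rewrite -/k; lra. Qed.

(** A time separation of at least [a] is approached by lengths of curves, to
    which [causal_length_le] applies. *)
Lemma model_tau_pole tau Q (a : R) : poleK_bound K tau Q -> 0 < a ->
  (a%:E <= model_tau K (axisK K tau) Q)%E -> smallK K a -> mdK K a <= poleK K tau Q.
Proof.
move=> hb a0 + sa; rewrite leNgt; move=> /negP ha; rewrite leNgt; apply/negP => hp.
have [d d0 hd] : exists2 d : R, d < a & 0 < d /\ poleK K tau Q < mdK K d.
  have cm : {for a, continuous (mdK K)} by exact: isd_continuous (isd_mdK K a).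
  have : \forall t \near a, poleK K tau Q < mdK K t by exact: (cvgr_gt (mdK K a) cm).
  move=> /nbhs_ballP [e /= e0 he]; have [m m0 [m1 m2]] := pos_below2 e0 a0.
  exists (a - m / 2); first lra.
  split; first lra.
  by apply: he; rewrite /ball /= opprB addrC subrK gtr0_norm; lra.
apply: ha; apply: (@le_lt_trans _ _ d%:E); last by rewrite lte_fin.
rewrite /model_tau ge_max lee_fin ltW ?hd.1 //=; apply: ge_ereal_sup => x /= [c' hc' <-].
have [L [L0 sL -> hL]] := causal_length_le hc' hb.
rewrite lee_fin; apply: (@mdK_lerI _ K) => //; first exact: ltW hd.1.
by apply: (le_trans hL); exact: ltW hd.2.
Qed.

Lemma poleK_axisK tau u : poleK K tau (axisK K u) = mdK K (u - tau).
Proof.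
rewrite /poleK /axisK /mdK /csK mkpt0 mkpt1 -/k cosh0 cos0 mulr1 mul1r.
case: (K == 0); first by rewrite expr0n subr0.
case: (0 < K); last by rewrite mulrBr.
by congr ((_ - 1) / K); rewrite mulrBr coshD coshN sinhN; ring.
Qed.

Lemma yK_axisK tau u : yK K tau (axisK K u) = snK K (u - tau).
Proof.
rewrite /yK /axisK /snK mkpt0 mkpt1 -/k cosh0 cos0 mulr1 mul1r.
case: (K == 0) => //; case: (0 < K); last by rewrite mulrBr.
by congr (_ / k); rewrite mulrBr sinhD coshN sinhN; ring.
Qed.

Lemma model_dist_axis (u T : R) : 0 < T -> tinyK K T ->
  model_dist (axisK K u) (axisK K (u + T)) T.
Proof.
move=> T0 hT; have sT := smallK_tinyK T0 hT; have hp := pi_gt0 R.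
apply: model_dist_from_axis => //.
- split=> [Kn|Kp]; rewrite /axisK ?mkpt0 ?mkpt1; last by rewrite normr0.
  rewrite lt_eqF // -/k mulrDr [k * u + _]addrC addrK ger0_norm ?mulr_ge0 ?k_ge0 ?ltW //.
  exact: sT.
- by rewrite poleK_axisK; congr mdK; ring.
- by rewrite yK_axisK [u + T]addrC addrK; exact: snK_gt0.
Qed.

Lemma axis_side (d : R) : 0 < d -> tinyK K d -> exists2 cv,
  model_causal_curve K cv (axisK K 0) (axisK K d) &
  model_length K cv = model_tau K (axisK K 0) (axisK K d) /\
  forall g, 0 <= g <= d -> exists2 t, 0 <= t <= 1 & cv t = axisK K g.
Proof.
move=> d0 hd; pose cv s := axisK K (d * s).
pose v := if K == 0 then d else k * d.
have v0 : 0 < v by rewrite /v; case: ifP => // /negbT /k_gt0 k0; rewrite mulr_gt0.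
have e0 : (fun s => cv s 0 0) = (fun s => v * s).
  by apply/funext => s; rewrite /cv /axisK mkpt0 /v; case: ifP => // _; rewrite mulrA.
have e1 : (fun s => cv s 0 1) = (fun s => 0).
  by apply/funext => s; rewrite /cv /axisK mkpt1.
have d0' s : isder s (fun s => cv s 0 0) v by rewrite e0; isdeq; ring.
have d1' s : isder s (fun s => cv s 0 1) 0 by rewrite e1; isd.
have sp s : model_speed2 K cv s = - d ^+ 2.
  rewrite (model_speed2E K (d0' s) (d1' s)) /space_part /time_part /v /cv /axisK mkpt1 cosh0 -/k.
  have [_|K0] := eqVneq K 0; first by ring.
  have k0 := k_gt0 K0; rewrite -/k in k0.
  by case: ifP => _; field; exact: lt0r_neq0.
exists cv; first split; first split.
- by rewrite /cv mulr0.
- by rewrite /cv mulr1.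
- apply: C1_coordinates.
  + by rewrite e0; c1tac.
  + by rewrite e1; c1tac.
- by move=> t _; rewrite (isd_derive1 (d0' t)).
- by move=> t _; rewrite sp oppr_le0 sqr_ge0.
split; last first.
  move=> g /andP[g0 gd]; exists (g / d); last by rewrite /cv mulrC divfK // lt0r_neq0.
  by apply/andP; split; [rewrite divr_ge0 // ltW|rewrite ler_pdivrMr // mul1r].
have := model_dist_axis 0 d0 hd; rewrite add0r => -[_ -> _].
have ds (s : R) : isder s (fun s => d * s) d by isdeq; ring.
rewrite (model_length_unit ds); first by rewrite mulr1 mulr0 subr0.
- by move=> s; exact: cst_continuous.
- by move=> s _; rewrite sp.
Qed.

(** The vertex [Q] of a triangle with one side on the axis is found by
    prescribing its modified distances from the ends of that side; in the
    coordinates of [chartK] this is a linear system. As the modified distance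
    from [axisK g] is affine in the same coordinates, it is a combination of
    the two prescribed ones: this is Stewart's theorem for the cevian [a]. *)
Lemma thin_triangle (g b e c : R) (d := g + b) : 0 < g -> 0 < b -> 0 < e -> 0 < c ->
  tinyK K d -> tinyK K e -> tinyK K c ->
  e + c <= d \/ d + c <= e ->
  exists Q, [/\ model_dist (axisK K 0) Q e,
    e + c <= d -> model_dist Q (axisK K d) c,
    d + c <= e -> model_dist (axisK K d) Q c &
    forall a, 0 < a -> smallK K a -> (a%:E <= model_tau K (axisK K g) Q)%E ->
      mdK K a * snK K d <= mdK K e * snK K b + mdK K c * snK K g -
         snK K b * mdK K g - snK K g * mdK K b].
Proof.
move=> g0 b0 e0 c0 td te tc hab; have d0 : 0 < d by rewrite addr_gt0.
have sd := smallK_tinyK d0 td; have se := smallK_tinyK e0 te; have sc := smallK_tinyK c0 tc.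
have Sd := snK_gt0 d0 sd; have Se := snK_gt0 e0 se; have Sc := snK_gt0 c0 sc.
have Ce : 0 < csK K e by apply: csK_gt0 => //; exact: smallKN (ltW e0).
have Cd : 0 < csK K d by apply: csK_gt0 => //; exact: smallKN (ltW d0).
have Me := mdK_gt0 e0 se; have Mc := mdK_gt0 c0 sc.
(* the solution of [poleK K d Q = mdK K c], given that [poleK K 0 Q = mdK K e] *)
pose y := (mdK K e * csK K d + mdK K d - mdK K c) / snK K d.
have yS : y * snK K d = mdK K e * csK K d + mdK K d - mdK K c by rewrite /y divfK // lt0r_neq0.
have hMc : mdK K c <= mdK K (d - e).
  have [h|h] := leP e d.
    apply: mdK_ler; [exact: ltW|lra|]; apply: smallKW sd; lra.
  rewrite -(mdKN _ (d - e)); apply: mdK_ler; [exact: ltW|lra|]; apply: smallKW se; lra.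
have ySe : snK K e <= y.
  rewrite -(ler_pM2r Sd) yS; have := mdKD K (- e) d.
  by rewrite mdKN snKN [- e + d]addrC; lra.
have y0 : 0 < y by exact: lt_le_trans ySe.
have [||||Q [hpole hy hQ0 hQ1]] := @chartK (mdK K e) y; [exact: ltW|exact: ltW|by rewrite -csKE| |].
  by rewrite -snK_sq ler_pXn2r ?nnegrE // ltW.
have S2 := snK_sq K d; have CM := csKE K d.
have pe : poleK K 0 Q = mdK K e by rewrite hpole csK0 mdK0 snK0; ring.
have pd : poleK K d Q = mdK K c by rewrite hpole yS; ring.
have kd : K < 0 -> 0 <= k * d < pi / 2.
  by move=> Kn; rewrite mulr_ge0 ?k_ge0 ?ltW //=; exact: sd.
have chart u : 0 <= u -> u <= d -> in_chartK K u Q.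
  move=> u0 ud; split=> [Kn|]; last exact: hQ1.
  have := hQ0 Kn; have := kd Kn; have := ler_wpM2l (k_ge0 K) ud; have := mulr_ge0 (k_ge0 K) u0.
  by rewrite -/k ltr_norml; lra.
have yd : snK K d * yK K d Q = mdK K e - mdK K d - mdK K c * csK K d.
  rewrite hy -csKE mulrBr [_ * (y * _)](_ : _ = y * snK K d * csK K d); last by ring.
  rewrite yS [_ * (csK K e * _)](_ : _ = csK K e * snK K d ^+ 2); last by ring.
  by rewrite S2 !csKE; ring.
exists Q; split.
- apply: model_dist_from_axis => //; first by apply: chart => //; exact: ltW.
  by rewrite hy csK0 snK0; lra.
- move=> h; apply: model_dist_to_axis => //; first by apply: chart => //; exact: ltW.
  rewrite -(pmulr_rlt0 _ Sd) yd.
  have : mdK K e < mdK K d by apply: mdK_ltr => //; [exact: ltW|lra].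
  by have := mulr_gt0 Mc Cd; lra.
- move=> h; apply: model_dist_from_axis => //; first by apply: chart => //; exact: ltW.
  rewrite -(pmulr_rgt0 _ Sd) yd.
  have : mdK K (c + d) <= mdK K e by apply: mdK_ler => //; lra.
  by rewrite mdKD; have := mulr_gt0 Sc Sd; lra.
- move=> a a0 sa ha.
  have hb : poleK_bound K g Q.
    have gd : g <= d by rewrite /d lerDl ltW.
    move=> Kn; have [h _] := chart g (ltW g0) gd.
    by have := h Kn; rewrite ltr_norml => /andP[].
  have := model_tau_pole hb a0 ha sa; rewrite hpole => h.
  have := ler_wpM2r (ltW Sd) h.
  have -> : (mdK K e * csK K g + mdK K g - y * snK K g) * snK K d =
    mdK K e * (csK K g * snK K d - csK K d * snK K g) + mdK K g * snK K d - mdK K d * snK K g + mdK K c * snK K g.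
    by rewrite !mulrBl !mulrDl [y * _ * _](_ : _ = y * snK K d * snK K g); [rewrite yS; ring|ring].
  have Sg2 := snK_sq K g; have CMg := csKE K g.
  have -> : csK K g * snK K d - csK K d * snK K g = snK K b.
    rewrite /d snKD csKD [LHS](_ : _ = (csK K g ^+ 2 - K * snK K g ^+ 2) * snK K b); last by ring.
    by rewrite csK_sq; ring.
  have : mdK K g * snK K d - mdK K d * snK K g = - (snK K b * mdK K g) - snK K g * mdK K b.
    rewrite /d snKD mdKD [LHS](_ : _ = mdK K g * csK K g * snK K b - snK K g ^+ 2 * snK K b - mdK K b * snK K g); last by ring.
    by rewrite Sg2 CMg; ring.
  by lra.
Qed.

End model_time_separation.

(** * Comparison angles *)

Section minkowski_plane.
Context {R : realType}.
Notation model_pt := (@model_pt R).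
Implicit Types (p q : model_pt) (c : R -> model_pt).

Let dt p q : R := q 0 0 - p 0 0.
Let dx p q : R := q 0 1 - p 0 1.

Lemma isd_shift c p : (forall i, C1 (fun u => c u 0 i)) ->
  let c' := fun s => mkpt (c s 0 0) (c s 0 1 - p 0 1) in
  (forall s, isder s (fun u => c' u 0 0) (derive1 (fun u => c u 0 0) s)) /\
  (forall s, isder s (fun u => c' u 0 1) (derive1 (fun u => c u 0 1) s)).
Proof.
move=> hC c'; have h0 := C1_isd (hC 0); have h1 := C1_isd (hC 1).
have e0 : (fun u => c' u 0 0) = (fun u => c u 0 0) by apply/funext => u; rewrite mkpt0.
have e1 : (fun u => c' u 0 1) = (fun u => c u 0 1 - p 0 1) by apply/funext => u; rewrite mkpt1.
by split=> s; rewrite ?e0 ?e1 //; apply: isd_eq; [apply: isd_add; [exact: h1|isd]|rewrite addr0].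
Qed.

(** Translation in space brings the initial point to the axis, where
    [causal_length_le] applies. *)
Lemma flat_causal c p q : model_causal_curve 0 c p q ->
  [/\ 0 < dt p q, dx p q ^+ 2 <= dt p q ^+ 2 &
      (model_length 0 c <= (Num.sqrt (dt p q ^+ 2 - dx p q ^+ 2))%:E)%E].
Proof.
move=> hc; have [[c0 c1 hC t0] hs] := hc.
have dt0 : 0 < dt p q by rewrite subr_gt0; case: hc => /future_curve_time.
have [i0 i1] := isd_shift p hC; pose c' := fun s => mkpt (c s 0 0) (c s 0 1 - p 0 1).
have sp s : model_speed2 0 c' s = model_speed2 0 c s.
  rewrite (model_speed2E 0 (i0 s) (i1 s)) (model_speed2E 0 (C1_isd (hC 0) s) (C1_isd (hC 1) s)).
  by rewrite /space_part /time_part eqxx.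
have hc' : model_causal_curve 0 c' (axisK 0 (p 0 0)) (mkpt (q 0 0) (q 0 1 - p 0 1)).
  split; last by move=> s s01; rewrite sp; exact: hs.
  split.
  - by rewrite /c' c0 subrr /axisK eqxx.
  - by rewrite /c' c1.
  - apply: C1_coordinates.
    + rewrite (_ : (fun t => c' t 0 0) = (fun t => c t 0 0)); first exact: hC.
      by apply/funext => u; rewrite /c' mkpt0.
    + rewrite (_ : (fun t => c' t 0 1) = (fun t => c t 0 1 - p 0 1)).
        by have h1 := hC 1; c1tac.
      by apply/funext => u; rewrite /c' mkpt1.
  - by move=> s s01; rewrite (isd_derive1 (i0 s)) t0.
have [|L [L0 _ hL hm]] := causal_length_le hc'; first by rewrite /poleK_bound ltxx.
move: hm; rewrite /mdK /poleK eqxx mkpt0 mkpt1 -/(dt p q) -/(dx p q) => hm.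
have eL : model_length 0 c = L%:E.
  rewrite -hL /model_length; apply: eq_integral => s _.
  by rewrite -[in LHS]sp.
have h2 : L ^+ 2 <= dt p q ^+ 2 - dx p q ^+ 2 by lra.
split => //; first by have := sqr_ge0 L; lra.
rewrite eL lee_fin -(@ler_pXn2r _ 2) ?nnegrE ?sqrtr_ge0 // sqr_sqrtr //.
by have := sqr_ge0 L; lra.
Qed.

Lemma flat_line p q : 0 < dt p q -> dx p q ^+ 2 <= dt p q ^+ 2 ->
  exists2 c, model_causal_curve 0 c p q /\
    (dx p q ^+ 2 < dt p q ^+ 2 -> model_timelike_curve 0 c p q) &
    model_length 0 c = (Num.sqrt (dt p q ^+ 2 - dx p q ^+ 2))%:E.
Proof.
move=> t0 hx; pose c s := mkpt (p 0 0 + dt p q * s) (p 0 1 + dx p q * s).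
have e0 : (fun s => c s 0 0) = (fun s => p 0 0 + dt p q * s).
  by apply/funext => s; rewrite mkpt0.
have e1 : (fun s => c s 0 1) = (fun s => p 0 1 + dx p q * s).
  by apply/funext => s; rewrite mkpt1.
have d0 s : isder s (fun s => c s 0 0) (dt p q) by rewrite e0; isdeq; ring.
have d1 s : isder s (fun s => c s 0 1) (dx p q) by rewrite e1; isdeq; ring.
have sp s : model_speed2 0 c s = - (dt p q ^+ 2 - dx p q ^+ 2).
  by rewrite (model_speed2E 0 (d0 s) (d1 s)) /space_part /time_part eqxx; ring.
have hf : model_future_curve c p q.
  split.
  - by apply: model_pt_eq; rewrite /c ?mkpt0 ?mkpt1; ring.
  - by apply: model_pt_eq; rewrite /c ?mkpt0 ?mkpt1 /dt /dx; ring.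
  - apply: C1_coordinates.
    + by rewrite e0; c1tac.
    + by rewrite e1; c1tac.
  - by move=> s _; rewrite (isd_derive1 (d0 s)).
exists c; first by split; [|move=> hx']; split => // s _; rewrite sp; lra.
rewrite /model_length; under eq_integral do rewrite sp opprK.
rewrite (integral_isd (F := fun s => Num.sqrt (dt p q ^+ 2 - dx p q ^+ 2) * s)).
- by rewrite mulr1 mulr0 subr0.
- by move=> s _; isdeq; ring.
- by apply: continuous_subspaceT => s; exact: cst_continuous.
Qed.

Lemma flat_tau p q : 0 < dt p q -> dx p q ^+ 2 <= dt p q ^+ 2 ->
  model_tau 0 p q = (Num.sqrt (dt p q ^+ 2 - dx p q ^+ 2))%:E.
Proof.
move=> t0 hx; have [c [hc _] hl] := flat_line t0 hx.
apply/eqP; rewrite eq_le; apply/andP; split.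
  rewrite /model_tau ge_max lee_fin sqrtr_ge0 /=; apply: ge_ereal_sup => x /= [c' hc' <-].
  by have [_ _] := flat_causal hc'.
by rewrite /model_tau le_max; apply/orP; right; apply: ereal_sup_ubound; exists c.
Qed.

Lemma flat_le p q : model_le 0 p q -> p = q \/ (0 < dt p q /\ dx p q ^+ 2 <= dt p q ^+ 2).
Proof. by move=> [->|[c hc]]; [left|right; have [] := flat_causal hc]. Qed.

Lemma bform_diff p q : bform 1 (q - p) (q - p) = dx p q ^+ 2 - dt p q ^+ 2.
Proof. by rewrite bform21 !mxE /dt /dx; ring. Qed.

(** As the scalar product of [q - p] and [r - p] is determined by the three
    norms, a comparison angle is a function of time separations alone. *)
Lemma flat_norm p q : model_le 0 p q \/ model_le 0 q p ->
  bform 1 (q - p) (q - p) = - (fine (model_tau 0 p q) + fine (model_tau 0 q p)) ^+ 2.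
Proof.
have sym (u v : model_pt) : dt v u = - dt u v /\ dx v u = - dx u v by rewrite /dt /dx !opprB.
have key (u v : model_pt) : model_le 0 u v ->
    bform 1 (v - u) (v - u) = - (fine (model_tau 0 u v) + fine (model_tau 0 v u)) ^+ 2.
  move=> /flat_le[->|[t0 hx]].
    by rewrite model_tau_past // addr0 expr0n oppr0 bform_diff /dt /dx !subrr; ring.
  rewrite (flat_tau t0 hx) (@model_tau_past _ _ v u); last first.
    by move: t0; rewrite subr_gt0 => /ltW.
  by rewrite /= addr0 sqr_sqrtr ?subr_ge0 // bform_diff opprB.
move=> [/key //|/key h]; rewrite [fine _ + _]addrC -h !bform_diff.
by have [-> ->] := sym p q; rewrite !sqrrN.
Qed.

Lemma bform_polar p q r :
  bform 1 (q - p) (r - p) =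
  (bform 1 (q - p) (q - p) + bform 1 (r - p) (r - p) - bform 1 (r - q) (r - q)) / 2.
Proof. by rewrite !bform21 !mxE; field. Qed.

Lemma bform_scale (a b : R) (v w : model_pt) :
  bform 1 (a *: v) (b *: w) = a * b * bform 1 v w.
Proof. by rewrite !bform21 !mxE; ring. Qed.

End minkowski_plane.

Section comparison_angles.
Context {R : realType} {X : lorentzian_prelength_space R}.
Implicit Types (x y z u v w : X).
Notation model_pt := (@model_pt R).

Lemma tau_self x : (tau x x < +oo)%E -> tau x x = 0%E.
Proof.
move=> h; have := tau_reverse_triangle (causal_refl x) (causal_refl x).
have := tau_ge0 x x; case: (tau x x) h => // r _.
by rewrite lee_fin -EFinD lee_fin => r0 h; congr EFin; lra.
Qed.

Lemma tau_back u v : tau u u = 0%E -> causal u v -> causal v u ->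
  tau u v = 0%E /\ tau v u = 0%E.
Proof.
move=> hu uv vu; have := tau_reverse_triangle uv vu; rewrite hu.
have := tau_ge0 u v; have := tau_ge0 v u.
case: (tau u v) => [a| |] //; case: (tau v u) => [b| |] //.
by rewrite -EFinD !lee_fin => *; split; congr EFin; lra.
Qed.

Lemma not_chron_back u v : tau u u = 0%E -> causal u v -> ~ chron v u.
Proof.
move=> hu uv vu; have [_ h] := tau_back hu uv (chron_causal vu).
by move/tau_gt0: vu; rewrite h ltxx.
Qed.

Definition flat_entry u v (U V : model_pt) :=
  [/\ chron u v -> model_ll 0 U V, causal u v -> model_le 0 U V &
      model_tau 0 U V = tau u v].

Lemma flat_entry_self u (U : model_pt) : tau u u = 0%E -> flat_entry u u U U.
Proof.
move=> hu; split => [/tau_gt0|_|]; [by rewrite hu ltxx|by left|].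
by rewrite model_tau_past // hu.
Qed.

(** Placing [U] and [V] at the right time separation settles the backward
    entry too, unless [v] also precedes [u]; then both time separations
    vanish and the two points must coincide. *)
Lemma flat_entries u v (U V : model_pt) (a : R) : tau u u = 0%E -> causal u v ->
  0 <= a -> tau u v = a%:E -> 0 <= V 0 0 - U 0 0 ->
  (V 0 0 - U 0 0) ^+ 2 - (V 0 1 - U 0 1) ^+ 2 = a ^+ 2 ->
  (causal v u -> U = V) ->
  flat_entry u v U V /\ flat_entry v u V U.
Proof.
move=> hu uv a0 ha ht hq hback.
have tvu : tau v u = 0%E.
  apply/eqP; rewrite eq_le tau_ge0 andbT leNgt; apply/negP => /tau_gt0.
  exact: not_chron_back.
split; last first.
  split.
  - by move=> vu; have := not_chron_back hu uv vu.
  - by move=> /hback ->; left.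
  - by rewrite tvu model_tau_past // -subr_ge0.
have [t0|t0] := eqVneq (V 0 0 - U 0 0) 0.
  have x0 : V 0 1 - U 0 1 = 0 by apply/eqP; rewrite -sqrf_eq0; apply/eqP; move: hq (sqr_ge0 a) (sqr_ge0 (V 0 1 - U 0 1)); rewrite t0; lra.
  have a00 : a = 0 by apply/eqP; rewrite -sqrf_eq0 -hq t0 x0; apply/eqP; ring.
  have UV : U = V by apply: model_pt_eq; apply/eqP; rewrite eq_sym -subr_eq0; apply/eqP.
  split; first by move=> /tau_gt0; rewrite ha a00 ltxx.
  - by move=> _; left.
  - by rewrite UV model_tau_past // ha a00.
have {}t0 : 0 < V 0 0 - U 0 0 by rewrite lt_def t0.
have hx : (V 0 1 - U 0 1) ^+ 2 <= (V 0 0 - U 0 0) ^+ 2 by have := sqr_ge0 a; lra.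
have [c [hc hc'] _] := flat_line t0 hx.
split.
- move=> /tau_gt0; rewrite ha lte_fin => ap; exists c; apply: hc'.
  by have : 0 < a ^+ 2 by [rewrite exprn_gt0]; lra.
- by move=> _; right; exists c.
- by rewrite (flat_tau t0 hx) hq sqrtr_sqr ger0_norm.
Qed.

Lemma fine_tauK u v : (tau u v < +oo)%E -> tau u v = (fine (tau u v))%:E.
Proof. by move=> h; rewrite fineK // ge0_fin_numE // tau_ge0. Qed.

Lemma fine_tau_ge0 u v : 0 <= fine (tau u v).
Proof. by apply: fine_ge0; exact: tau_ge0. Qed.

Lemma chain_coordinates (A B C : R) : 0 < C -> 0 <= A -> 0 <= B -> A + B <= C ->
  exists t x : R, [/\ A <= t, B <= C - t, t ^+ 2 - x ^+ 2 = A ^+ 2,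
    (C - t) ^+ 2 - x ^+ 2 = B ^+ 2 &
    (C <= B -> t = 0 /\ x = 0) /\ (C <= A -> t = C /\ x = 0)].
Proof.
move=> C0 A0 B0 tri; pose t := (C ^+ 2 + A ^+ 2 - B ^+ 2) / (2 * C).
have tC : t * (2 * C) = C ^+ 2 + A ^+ 2 - B ^+ 2 by rewrite /t divfK //; lra.
have tA : A <= t by rewrite /t ler_pdivlMr; [nra|lra].
have tB : B <= C - t by rewrite lerBrDr -lerBrDl /t ler_pdivrMr; [nra|lra].
have x0 : 0 <= t ^+ 2 - A ^+ 2 by nra.
have x2 : Num.sqrt (t ^+ 2 - A ^+ 2) ^+ 2 = t ^+ 2 - A ^+ 2 by rewrite sqr_sqrtr.
exists t, (Num.sqrt (t ^+ 2 - A ^+ 2)); split => //.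
- by rewrite x2; ring.
- by rewrite x2 [LHS](_ : _ = C ^+ 2 + A ^+ 2 - t * (2 * C)); [rewrite tC; ring|ring].
- split=> [CB|CA].
  + have -> : t = 0 by lra.
    by rewrite (_ : A = 0) ?subrr ?sqrtr0 //; lra.
  + have -> : t = C by lra.
    by rewrite (_ : A = C) ?subrr ?sqrtr0 //; lra.
Qed.

(** By the reverse triangle inequality, [chain_coordinates] places the middle
    point of three causally ordered points above the segment of the outer
    ones. *)
Lemma flat_chain u v w : causal u v -> causal v w -> chron u w ->
  tau u u = 0%E -> tau v v = 0%E -> tau w w = 0%E -> (tau u w < +oo)%E ->
  exists U V W, (flat_entry u v U V /\ flat_entry v u V U) /\
    (flat_entry v w V W /\ flat_entry w v W V) /\
    (flat_entry u w U W /\ flat_entry w u W U).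
Proof.
move=> uv vw uw hu hv hw fuw; have tri := tau_reverse_triangle uv vw.
have fuv : (tau u v < +oo)%E.
  by apply: le_lt_trans fuw; apply: le_trans tri; rewrite leeDl // tau_ge0.
have fvw : (tau v w < +oo)%E.
  by apply: le_lt_trans fuw; apply: le_trans tri; rewrite leeDr // tau_ge0.
have eA := fine_tauK fuv; have eB := fine_tauK fvw; have eC := fine_tauK fuw.
have C0 : 0 < fine (tau u w) by move/tau_gt0: uw; rewrite eC lte_fin.
have A0 := fine_tau_ge0 u v; have B0 := fine_tau_ge0 v w.
move: tri; rewrite eA eB eC -EFinD lee_fin.
have hback1 : causal v u -> fine (tau u w) <= fine (tau v w).
  move=> vu; have := tau_reverse_triangle vu (chron_causal uw).
  have [_ ->] := tau_back hu uv vu; rewrite add0e => h; apply: fine_le h; rewrite ge0_fin_numE ?tau_ge0 //.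
have hback2 : causal w v -> fine (tau u w) <= fine (tau u v).
  move=> wv; have := tau_reverse_triangle (chron_causal uw) wv.
  have [_ ->] := tau_back hv vw wv; rewrite adde0 => h; apply: fine_le h; rewrite ge0_fin_numE ?tau_ge0 //.
move: eA eB eC C0 A0 B0 hback1 hback2.
move: (fine (tau u v)) (fine (tau v w)) (fine (tau u w)) => A B C.
move=> eA eB eC C0 A0 B0 hback1 hback2 tri.
have [t [x [tA tB hx hx' [h1 h2]]]] := chain_coordinates C0 A0 B0 tri.
exists (mkpt 0 0), (mkpt t x), (mkpt C 0); split; [|split].
- apply: (flat_entries hu uv A0 eA); rewrite ?mkpt0 ?mkpt1 ?subr0 //; first exact: le_trans tA.
  by move=> /hback1 /h1 [-> ->].
- apply: (flat_entries hv vw B0 eB); rewrite ?mkpt0 ?mkpt1 ?sub0r ?sqrrN //; first exact: le_trans tB.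
  by move=> /hback2 /h2 [-> ->].
- apply: (flat_entries hu (chron_causal uw) (ltW C0) eC); rewrite ?mkpt0 ?mkpt1 ?subr0 ?expr0n ?subr0 //; first exact: ltW.
  by move=> wu; have [] := tau_back hu (chron_causal uw) wu; rewrite eC => -[C00]; rewrite C00 ltxx in C0.
Qed.

Definition sep x y : R := fine (tau x y) + fine (tau y x).

Lemma sepC x y : sep x y = sep y x. Proof. by rewrite /sep addrC. Qed.

Definition law_of_cosines_value (a b c : R) : R := `|a ^+ 2 + b ^+ 2 - c ^+ 2| / (2 * a * b).

Lemma triple_entries x y z (U V W : model_pt) :
  tau x x = 0%E -> tau y y = 0%E -> tau z z = 0%E ->
  flat_entry x y U V /\ flat_entry y x V U ->
  flat_entry y z V W /\ flat_entry z y W V ->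
  flat_entry x z U W /\ flat_entry z x W U ->
  comparison_triangle 0 (triple x y z) (fun i => nth U [:: U; V; W] i).
Proof.
move=> hx hy hz [xy yx] [yz zy] [xz zx].
have x1 := flat_entry_self U hx; have y1 := flat_entry_self V hy.
have z1 := flat_entry_self W hz.
by move=> [[|[|[|//]]] hi] [[|[|[|//]]] hj].
Qed.

Lemma comparison_angle_value x y z pb :
  comparison_triangle 0 (triple x y z) pb ->
  chron x y \/ chron y x -> chron x z \/ chron z x -> causal y z \/ causal z y ->
  `|bform 1 (unit_velocity (pb 0) (pb 1)) (unit_velocity (pb 0) (pb 2))| =
  law_of_cosines_value (sep x y) (sep x z) (sep y z).
Proof.
move=> hpb hxy hxz hyz.
have tauE i j : model_tau 0 (pb i) (pb j) = tau (triple x y z i) (triple x y z j).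
  by have [] := hpb i j.
have leE i j : causal (triple x y z i) (triple x y z j) -> model_le 0 (pb i) (pb j).
  by have [] := hpb i j.
have t0 : triple x y z 0 = x by []. have t1 : triple x y z 1 = y by [].
have t2 : triple x y z 2 = z by [].
have n01 : bform 1 (pb 1 - pb 0) (pb 1 - pb 0) = - sep x y ^+ 2.
  rewrite flat_norm; first by rewrite !tauE t0 t1.
  by case: hxy => /chron_causal h; [left|right]; apply: leE; rewrite t0 t1.
have n02 : bform 1 (pb 2 - pb 0) (pb 2 - pb 0) = - sep x z ^+ 2.
  rewrite flat_norm; first by rewrite !tauE t0 t2.
  by case: hxz => /chron_causal h; [left|right]; apply: leE; rewrite t0 t2.
have n12 : bform 1 (pb 2 - pb 1) (pb 2 - pb 1) = - sep y z ^+ 2.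
  rewrite flat_norm; first by rewrite !tauE t1 t2.
  by case: hyz => h; [left|right]; apply: leE; rewrite t1 t2.
rewrite /unit_velocity bform_scale (bform_polar (pb 0) (pb 1) (pb 2)) n01 n02 n12 !normrN.
rewrite !(ger0_norm (sqr_ge0 _)) !sqrtr_sqr.
have s1 : 0 <= sep x y by rewrite addr_ge0 // fine_tau_ge0.
have s2 : 0 <= sep x z by rewrite addr_ge0 // fine_tau_ge0.
rewrite [`|sep x y|]ger0_norm // [`|sep x z|]ger0_norm // /law_of_cosines_value.
have -> : - sep x y ^+ 2 + - sep x z ^+ 2 - - sep y z ^+ 2 =
  - (sep x y ^+ 2 + sep x z ^+ 2 - sep y z ^+ 2) by ring.
rewrite !normrM !normfV normrN [`|sep x y|]ger0_norm // [`|sep x z|]ger0_norm //.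
by rewrite [`|2|]ger0_norm // !invfM; ring.
Qed.

Lemma comparison_angle_exists x y z :
  chron x y \/ chron y x -> chron x z \/ chron z x -> causal y z \/ causal z y ->
  (exists pb, comparison_triangle 0 (triple x y z) pb) ->
  comparison_angle x y z = arcosh (law_of_cosines_value (sep x y) (sep x z) (sep y z)).
Proof.
move=> hxy hxz hyz [pb hpb]; rewrite /comparison_angle.
set S := [set _ | _]; have hS : S !=set0.
  by exists (arcosh `|bform 1 (unit_velocity (pb 0) (pb 1)) (unit_velocity (pb 0) (pb 2))|); exists pb.
have [pb' hpb' ->] := xgetPex 0 hS.
by rewrite (comparison_angle_value hpb' hxy hxz hyz).
Qed.

Lemma finite_separationsP x y z : finite_separations x y z ->
  [/\ (tau x x < +oo)%E /\ (tau y y < +oo)%E /\ (tau z z < +oo)%E,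
      (tau x y < +oo)%E /\ (tau y x < +oo)%E, (tau x z < +oo)%E /\ (tau z x < +oo)%E &
      (tau y z < +oo)%E /\ (tau z y < +oo)%E].
Proof.
move=> h; split; split; try split.
- exact: (h 0 0). - exact: (h 1 1). - exact: (h 2 2).
- exact: (h 0 1). - exact: (h 1 0). - exact: (h 0 2). - exact: (h 2 0).
- exact: (h 1 2). - exact: (h 2 1).
Qed.

(** All comparison triangles give the same value, by [flat_norm], and there is
    one, by [flat_chain]. *)
Lemma comparison_angleE x y z : finite_separations x y z ->
  (chron x y /\ chron x z) \/ (chron x y /\ chron z x) \/ (chron y x /\ chron x z) ->
  causal y z \/ causal z y ->
  comparison_angle x y z = arcosh (law_of_cosines_value (sep x y) (sep x z) (sep y z)).
Proof.
move=> /finite_separationsP[[/tau_self xx [/tau_self yy /tau_self zz]] [fxy fyx] [fxz fzx] [fyz fzy]].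
move=> hch hyz; apply: comparison_angle_exists => //; [tauto|tauto|].
case: hch => [[xy xz]|[[xy zx]|[yx xz]]].
- case: hyz => [yz|zy].
  + have [U [V [W [h1 [h2 h3]]]]] := flat_chain (chron_causal xy) yz xz xx yy zz fxz.
    by eexists; exact: (triple_entries xx yy zz h1 h2 h3).
  + have [U [V [W [h1 [h2 h3]]]]] := flat_chain (chron_causal xz) zy xy xx zz yy fxy.
    by eexists; exact: (triple_entries xx yy zz h3 (conj h2.2 h2.1) h1).
- have zy := chron_trans zx xy.
  have [U [V [W [h1 [h2 h3]]]]] := flat_chain (chron_causal zx) (chron_causal xy) zy zz xx yy fzy.
  by eexists; exact: (triple_entries xx yy zz h2 (conj h3.2 h3.1) (conj h1.2 h1.1)).
- have yz := chron_trans yx xz.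
  have [U [V [W [h1 [h2 h3]]]]] := flat_chain (chron_causal yx) (chron_causal xz) yz yy xx zz fyz.
  by eexists; exact: (triple_entries xx yy zz (conj h1.2 h1.1) h3 h2).
Qed.

End comparison_angles.

(** * Germs of timelike curves *)

Section continuity_along_curves.
Context {R : realType} {X : lorentzian_prelength_space R}.
Implicit Types (x y p q : X) (W : set X) (c : R -> X) (D : set R).

Lemma lipschitz_within D c : locally_lipschitz D c -> forall t, D t ->
  c @ within D (nbhs t) --> c t.
Proof.
move=> hc t Dt A /nbhs_ballP[e /= e0 hA].
have [e' e'0 [k hk]] := hc t Dt.
pose k' := `|k| + 1; have k'0 : 0 < k' by rewrite ltr_wpDl.
rewrite nbhs_simpl /=; apply/nbhs_ballP; exists (Num.min e' (e / k')) => /=.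
  by rewrite lt_min e'0 divr_gt0.
move=> s; rewrite /ball /= lt_min => /andP[h1 h2] Ds; apply: hA; rewrite ballEmdist /=.
have tt : `|t - t| < e' by rewrite subrr normr0.
have hs := hk t s Dt Ds tt _; rewrite distrC in h1.
apply: (le_lt_trans (hs h1)).
apply: (@le_lt_trans _ _ (k' * `|t - s|)).
  by rewrite ler_wpM2r // /k'; have := ler_norm k; lra.
by rewrite mulrC -ltr_pdivlMr.
Qed.

(** Chronological futures and pasts are open since [tau] is lower
    semicontinuous. *)
Lemma chron_near p q : chron p q ->
  (\forall p' \near p, chron p' q) /\ (\forall q' \near q, chron p q').
Proof.
move=> /tau_gt0 h.
have [V hV hV'] := @tau_lsc _ X (p, q) 0 h.
have [[V1 V2] /= [h1 h2] hV12] := hV.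
split.
- near=> p'; apply/tau_gt0; apply: (hV' (p', q)); apply: hV12; split => /=; last exact: nbhs_singleton.
  by near: p'.
- near=> q'; apply/tau_gt0; apply: (hV' (p, q')); apply: hV12; split => /=; first exact: nbhs_singleton.
  by near: q'.
Unshelve. all: by end_near.
Qed.

Lemma cts_tau_curves W (b : R) (c1 c2 : R -> X) : tau_finite_on W -> tau_continuous_on W ->
  (forall t, 0 <= t <= b -> W (c1 t) /\ W (c2 t)) ->
  {within `[0, b], continuous c1} -> {within `[0, b], continuous c2} ->
  {within `[0, b], continuous (fun t => fine (tau (c1 t) (c2 t)))}.
Proof.
move=> fW cW hW /subspace_continuousP h1 /subspace_continuousP h2.
apply/subspace_continuousP => t tb; have [W1 W2] := hW t tb.
apply: fine_cvg; rewrite fineK; last by rewrite ge0_fin_numE ?tau_ge0 // fW.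
have /subspace_continuousP/(_ (c1 t, c2 t) (conj W1 W2)) hcvg := cW.
have hp : (c1 s, c2 s) @[s --> within `[0, b] (nbhs t)] --> within (W `*` W) (nbhs (c1 t, c2 t)).
  have hc : (c1 s, c2 s) @[s --> within `[0, b] (nbhs t)] --> (c1 t, c2 t).
    by apply: cvg_pair; [exact: h1|exact: h2].
  move=> A /= hA; have := hc _ hA; rewrite !nbhs_simpl /= => hA'.
  move: hA'; rewrite /within /=; apply: filterS => s h sb; apply: h => //.
  by apply: hW; move: sb; rewrite /= in_itv.
exact: (cvg_comp _ _ hp hcvg).
Qed.

End continuity_along_curves.

Section germs.
Context {R : realType} {X : lorentzian_prelength_space R}.
Variables (W : set X) (x : X).
Implicit Types (p q : X) (al be ga : R -> X) (s t u d w : R).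

(** An angle depends only on initial segments of the curves; these are taken
    inside a set [W] on which the time separation is finite and continuous. *)
Definition future_germ d al := [/\ 0 < d, al 0 = x,
  forall t, 0 <= t <= d -> W (al t), {within `[0, d], continuous al} &
  forall s t, 0 <= s -> s < t -> t <= d -> chron (al s) (al t)].

Definition past_germ d al := [/\ 0 < d, al 0 = x,
  forall t, 0 <= t <= d -> W (al t), {within `[0, d], continuous al} &
  forall s t, 0 <= s -> s < t -> t <= d -> chron (al t) (al s)].

Hypotheses (Wfin : tau_finite_on W) (Wcts : tau_continuous_on W).

Lemma germ_shrink d d' al : 0 < d' -> d' <= d -> future_germ d al -> future_germ d' al.
Proof.
move=> d'0 dd [d0 a0 aW ac ach]; split => //.
- by move=> t h; apply: aW; lra.
- by apply: continuous_subspaceW ac => t; rewrite /= !in_itv /=; lra.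
- by move=> s t *; apply: ach => //; lra.
Qed.

Lemma past_germ_shrink d d' al : 0 < d' -> d' <= d -> past_germ d al -> past_germ d' al.
Proof.
move=> d'0 dd [d0 a0 aW ac ach]; split => //.
- by move=> t h; apply: aW; lra.
- by apply: continuous_subspaceW ac => t; rewrite /= !in_itv /=; lra.
- by move=> s t *; apply: ach => //; lra.
Qed.

Lemma Wself p : W p -> tau p p = 0%E.
Proof. by move=> Wp; apply: tau_self; exact: Wfin. Qed.

Lemma fine_tau_gt0 p q : W p -> W q -> chron p q -> 0 < fine (tau p q).
Proof.
move=> Wp Wq /tau_gt0 h; rewrite fine_gt0 // h /=; exact: Wfin.
Qed.

Lemma fine_tau_chron p q : 0 < fine (tau p q) -> chron p q.
Proof.
move=> h; apply/tau_gt0; rewrite lt_neqAle tau_ge0 andbT eq_sym; apply/eqP => e.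
by rewrite e ltxx in h.
Qed.

Lemma fine_tau_triangle p q r : W p -> W q -> W r -> causal p q -> causal q r ->
  fine (tau p q) + fine (tau q r) <= fine (tau p r).
Proof.
move=> Wp Wq Wr pq qr; rewrite -lee_fin EFinD -!fine_tauK ?Wfin //.
exact: tau_reverse_triangle.
Qed.

Lemma sep_causal p q : W p -> causal p q -> sep p q = fine (tau p q).
Proof.
move=> Wp pq; rewrite /sep (_ : tau q p = 0%E) ?addr0 //.
apply/eqP; rewrite eq_le tau_ge0 andbT leNgt; apply/negP => /tau_gt0.
exact: not_chron_back (Wself Wp) pq.
Qed.

Lemma finite_separationsW p q r : W p -> W q -> W r -> finite_separations p q r.
Proof. by move=> Wp Wq Wr [[|[|[|//]]] hi] [[|[|[|//]]] hj]; apply: Wfin. Qed.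

Section future.
Context {d al} (hal : future_germ d al).

Lemma fgW t : 0 <= t -> t <= d -> W (al t).
Proof. by case: hal => _ _ h _ _ t0 td; apply: h; rewrite t0. Qed.

Lemma fg_base : W x.
Proof. by case: hal => d0 <- h _ _; apply: h; rewrite lexx ltW. Qed.

Lemma fg_chron t : 0 < t -> t <= d -> chron x (al t).
Proof. by case: hal => _ <- _ _ h t0 td; exact: h. Qed.

Lemma fg_mono s t : 0 <= s -> s <= t -> t <= d ->
  fine (tau x (al s)) <= fine (tau x (al t)).
Proof.
move=> s0; rewrite le_eqVlt => /predU1P[-> //|st] td.
have [d0 a0 _ _ hch] := hal.
have h : causal x (al s).
  move: s0; rewrite le_eqVlt => /predU1P[<-|s0]; first by rewrite a0; exact: causal_refl.
  by apply/chron_causal/fg_chron => //; lra.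
have := fine_tau_triangle fg_base (fgW s0 _) (fgW _ td) h (chron_causal (hch s t s0 st td)).
have := fine_tau_ge0 (al s) (al t); move=> h1 h2.
by have := h2 ltac:(lra) ltac:(lra); lra.
Qed.

(** The intermediate value theorem for the continuous function
    [tau x (al s)], which vanishes at [0]. *)
Lemma fg_value v : 0 < v -> v <= fine (tau x (al d)) ->
  exists2 s, 0 < s <= d & fine (tau x (al s)) = v.
Proof.
move=> v0 vd; have [d0 a0 aW ac _] := hal.
have cf : {within `[0, d], continuous (fun t => fine (tau x (al t)))}.
  apply: (cts_tau_curves Wfin Wcts) ac; first by move=> t td; split; [exact: fg_base|exact: aW].
  exact: cst_continuous.
have [|s] := IVT (ltW d0) cf (v := v).
  rewrite a0 (Wself fg_base) /=; rewrite ge_min le_max (ltW v0) vd orbT andbT //.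
rewrite in_itv /= => /andP[s0 sd] hs; exists s => //; rewrite sd andbT lt_neqAle s0 andbT.
by apply/eqP => e; move: hs; rewrite -e a0 (Wself fg_base) /= => e'; rewrite -e' ltxx in v0.
Qed.

End future.

(** The comparison angle at [x] is at most [w], by the law of cosines. *)
Definition angle_bound d al be w := forall s t, 0 < s -> s <= d -> 0 < t -> t <= d ->
  chron (al s) (be t) \/ chron (be t) (al s) ->
  fine (tau x (al s)) ^+ 2 + fine (tau x (be t)) ^+ 2 - sep (al s) (be t) ^+ 2 <=
  2 * fine (tau x (al s)) * fine (tau x (be t)) * cosh w.

Lemma angle_boundC d al be w : angle_bound d al be w -> angle_bound d be al w.
Proof.
move=> h s t s0 sd t0 td st; have := h t s t0 td s0 sd; rewrite sepC => h'.
have : chron (al t) (be s) \/ chron (be s) (al t) by tauto.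
by move=> /h'; lra.
Qed.

(** A bound on the angle forces [al s << be t] as soon as [be t] is farther
    from [x] than the light ray from [al s] in the Minkowski hinge. Otherwise
    the time separation from [al s'] to [be t], positive for small [s'], would
    take all small positive values before it vanishes, whereas the law of
    cosines keeps it away from [0]. *)
Lemma angle_bound_chron d al be w s t : future_germ d al -> future_germ d be ->
  0 <= w -> angle_bound d al be w -> 0 < s -> s <= d -> 0 < t -> t <= d ->
  fine (tau x (al s)) * expR w < fine (tau x (be t)) ->
  chron (al s) (be t) /\
  fine (tau x (al s)) ^+ 2 + fine (tau x (be t)) ^+ 2 -
    2 * fine (tau x (al s)) * fine (tau x (be t)) * cosh w <= fine (tau (al s) (be t)) ^+ 2.
Proof.
move=> hal hbe w0 hw s0 sd t0 td hab.
have Wx := fg_base hal; have Wb := fgW hbe (ltW t0) td.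
have Wa s' : 0 <= s' -> s' <= s -> W (al s') by move=> *; apply: (fgW hal) => //; lra.
suff hch : chron (al s) (be t).
  split => //; have := hw s t s0 sd t0 td (or_introl hch).
  by rewrite (sep_causal (Wa _ (ltW s0) (lexx s)) (chron_causal hch)); lra.
apply: contrapT => nch.
set a := fine _ in hab; set b := fine _ in hab.
have a0 : 0 < a by exact: (fine_tau_gt0 Wx (Wa _ (ltW s0) (lexx s)) (fg_chron hal s0 sd)).
pose eta := (b - a * expR w) * (b - a * expR (- w)).
have eN : expR (- w) <= expR w by rewrite ler_expR; lra.
have e0 : 0 < expR (- w) by exact: expR_gt0.
have eta0 : 0 < eta by rewrite mulr_gt0 //; nra.
have b0 : 0 < b by have := expR_gt0 w; nra.
pose v := Num.min b (Num.sqrt eta) / 2.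
have sq0 : 0 < Num.sqrt eta by rewrite sqrtr_gt0.
have m0 : 0 < Num.min b (Num.sqrt eta) by rewrite lt_min b0.
have mb : Num.min b (Num.sqrt eta) <= b by rewrite ge_min lexx.
have ms : Num.min b (Num.sqrt eta) <= Num.sqrt eta by rewrite ge_min lexx orbT.
have [_ al0 _ ac _] := hal.
have cf : {within `[0, s], continuous (fun s' => fine (tau (al s') (be t)))}.
  apply: (cts_tau_curves Wfin Wcts).
  - by move=> s' /andP[h1 h2]; split => //; exact: Wa.
  - by apply: continuous_subspaceW ac => s'; rewrite /= !in_itv /=; lra.
  - exact: cst_continuous.
have fs : fine (tau (al s) (be t)) = 0.
  apply/eqP; rewrite eq_le fine_tau_ge0 andbT leNgt; apply/negP => h.
  by apply: nch; exact: fine_tau_chron.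
have [|s'] := IVT (ltW s0) cf (v := v).
  by rewrite fs al0 ge_min le_max -/b; apply/andP; split; apply/orP; [right|left]; rewrite /v; lra.
rewrite in_itv /= => /andP[s'0 s's] hv.
have v0 : 0 < v by rewrite /v; lra.
have {}s'0 : 0 < s'.
  rewrite lt_neqAle s'0 andbT; apply/eqP => e; move: hv; rewrite -e al0 -/b /v; lra.
have hch : chron (al s') (be t) by apply: fine_tau_chron; rewrite hv.
have s'd : s' <= d by lra.
have := hw s' t s'0 s'd t0 td (or_introl hch).
rewrite sep_causal; [|exact: Wa (ltW s'0) s's|exact: chron_causal].
rewrite hv -/b.
have := fg_mono hal (ltW s'0) s's sd; rewrite -/a.
have := fine_tau_ge0 x (al s'); move: (fine (tau x (al s'))) => a' a'0 a'a.
have hv2 : v ^+ 2 <= eta / 4.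
  have := sqr_sqrtr (ltW eta0); have : v <= Num.sqrt eta / 2 by rewrite /v; lra.
  by nra.
have : eta <= (b - a' * expR w) * (b - a' * expR (- w)).
  apply: ler_pM; [lra|nra| |].
    by have := ler_wpM2r (ltW (expR_gt0 w)) a'a; lra.
  by have := ler_wpM2r (ltW (expR_gt0 (- w))) a'a; lra.
have -> : (b - a' * expR w) * (b - a' * expR (- w)) = a' ^+ 2 * (expR w * expR (- w)) + b ^+ 2 - 2 * a' * b * cosh w.
  by rewrite /cosh; field.
by rewrite expR_mulN; lra.
Qed.

End germs.

(** * Adding angles *)

Section hyperbolic_triangles.
Context {R : realType}.
Implicit Types (a b g w : R).

Lemma exp_gt1 w : 0 < w -> [/\ 1 < expR w, 0 < (expR w)^-1 & (expR w)^-1 < 1].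
Proof.
move=> w0; have h : 1 < expR w by rewrite expR_gt1.
by rewrite h invr_gt0 expR_gt0 invf_lt1 ?expR_gt0.
Qed.

(** In the hinge spanned by the vectors of rapidity [0] and [w1 + w2] and of
    lengths [a] and [g], the vector of rapidity [w1] meets the third side at
    length [b] and divides it in the ratio [l : 1 - l]. *)
Lemma divide_hinge a g w1 w2 : 0 < a -> 0 < g -> 0 < w1 -> 0 < w2 ->
  a * expR (w1 + w2) < g ->
  exists b l, [/\ 0 < b /\ 0 <= l <= 1, a * expR w1 < b, b * expR w2 < g,
    a ^+ 2 + b ^+ 2 - 2 * a * b * cosh w1 =
      l ^+ 2 * (a ^+ 2 + g ^+ 2 - 2 * a * g * cosh (w1 + w2)) &
    b ^+ 2 + g ^+ 2 - 2 * b * g * cosh w2 =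
      (1 - l) ^+ 2 * (a ^+ 2 + g ^+ 2 - 2 * a * g * cosh (w1 + w2))].
Proof.
move=> a0 g0 w10 w20 hg.
have s1 := sinh_gt0 w10; have s2 := sinh_gt0 w20.
have N0 : 0 < a * sinh w1 + g * sinh w2 by rewrite addr_gt0 // mulr_gt0.
have S0 : 0 < sinh (w1 + w2) by rewrite sinh_gt0 // addr_gt0.
exists (a * g * sinh (w1 + w2) / (a * sinh w1 + g * sinh w2)),
  (a * sinh w1 / (a * sinh w1 + g * sinh w2)).
have [p1 pi0 pi1] := exp_gt1 w10; have [q1 qi0 qi1] := exp_gt1 w20.
have hN : sinh w1 * (a * expR (w1 + w2)) < sinh w1 * g by rewrite ltr_pM2l.
have hN2 : sinh w2 * (a * expR (w1 + w2)) < sinh w2 * g by rewrite ltr_pM2l.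
have expS : expR (w1 + w2) = expR w1 * expR w2 by rewrite expRD.
have shS : sinh (w1 + w2) = (expR w1 * expR w2 - (expR w1)^-1 * (expR w2)^-1) / 2.
  by rewrite /sinh opprD !expRD !expRN.
have chS : cosh (w1 + w2) = (expR w1 * expR w2 + (expR w1)^-1 * (expR w2)^-1) / 2.
  by rewrite /cosh opprD !expRD !expRN.
have sh1 : sinh w1 = (expR w1 - (expR w1)^-1) / 2 by rewrite /sinh expRN.
have ch1 : cosh w1 = (expR w1 + (expR w1)^-1) / 2 by rewrite /cosh expRN.
have sh2 : sinh w2 = (expR w2 - (expR w2)^-1) / 2 by rewrite /sinh expRN.
have ch2 : cosh w2 = (expR w2 + (expR w2)^-1) / 2 by rewrite /cosh expRN.
have Nn := lt0r_neq0 N0.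
move: N0 S0 hN hN2 s1 s2 Nn; rewrite expS shS chS sh1 sh2 ch1 ch2.
move: (expR w1) (expR w2) p1 pi0 pi1 q1 qi0 qi1 => p q p1 pi0 pi1 q1 qi0 qi1 N0 S0 hN hN2 s1 s2 Nn.
have pn : p != 0 by rewrite lt0r_neq0 //; lra.
have qn : q != 0 by rewrite lt0r_neq0 //; lra.
split.
- split; first by apply: divr_gt0 => //; apply: mulr_gt0 => //; exact: mulr_gt0.
  apply/andP; split; first by apply: divr_ge0; [apply: mulr_ge0; exact: ltW|exact: ltW].
  by rewrite ler_pdivrMr // mul1r lerDl; apply: mulr_ge0; exact: ltW.
- rewrite ltr_pdivlMr // -subr_gt0.
  have -> : a * g * ((p * q - p^-1 * q^-1) / 2) - a * p * (a * ((p - p^-1) / 2) + g * ((q - q^-1) / 2)) =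
    a * q^-1 * ((p - p^-1) / 2 * g - (p - p^-1) / 2 * (a * (p * q))).
    by field; rewrite pn qn.
  by apply: mulr_gt0; [exact: mulr_gt0|rewrite subr_gt0].
- rewrite mulrAC ltr_pdivrMr // -subr_gt0.
  have -> : g * (a * ((p - p^-1) / 2) + g * ((q - q^-1) / 2)) - a * g * ((p * q - p^-1 * q^-1) / 2) * q =
    g * ((q - q^-1) / 2 * g - (q - q^-1) / 2 * (a * (p * q))).
    by field; rewrite pn qn.
  by apply: mulr_gt0; [|rewrite subr_gt0].
- set N := a * _ + g * _ in Nn *.
  have key : a ^+ 2 * N ^+ 2 + (a * g * ((p * q - p^-1 * q^-1) / 2)) ^+ 2 -
      2 * a * (a * g * ((p * q - p^-1 * q^-1) / 2)) * N * ((p + p^-1) / 2) =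
      (a * ((p - p^-1) / 2)) ^+ 2 *
      (a ^+ 2 + g ^+ 2 - 2 * a * g * ((p * q + p^-1 * q^-1) / 2)).
    by rewrite /N; field; rewrite pn qn.
  rewrite [RHS](_ : _ = ((a * ((p - p^-1) / 2)) ^+ 2 *
      (a ^+ 2 + g ^+ 2 - 2 * a * g * ((p * q + p^-1 * q^-1) / 2))) / N ^+ 2).
    by rewrite -key; field; rewrite pn qn Nn.
  by field; rewrite pn qn Nn.
- set N := a * _ + g * _ in Nn *.
  have e1 : 1 - a * ((p - p^-1) / 2) / N = g * ((q - q^-1) / 2) / N.
    by apply: (mulIf Nn); rewrite mulrBl mul1r !divfK // /N; ring.
  have key : g ^+ 2 * N ^+ 2 + (a * g * ((p * q - p^-1 * q^-1) / 2)) ^+ 2 -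
      2 * g * (a * g * ((p * q - p^-1 * q^-1) / 2)) * N * ((q + q^-1) / 2) =
      (g * ((q - q^-1) / 2)) ^+ 2 *
      (a ^+ 2 + g ^+ 2 - 2 * a * g * ((p * q + p^-1 * q^-1) / 2)).
    by rewrite /N; field; rewrite pn qn.
  rewrite e1 [RHS](_ : _ = ((g * ((q - q^-1) / 2)) ^+ 2 *
      (a ^+ 2 + g ^+ 2 - 2 * a * g * ((p * q + p^-1 * q^-1) / 2))) / N ^+ 2).
    by rewrite -key; field; rewrite pn qn Nn.
  by field; rewrite pn qn Nn.
Qed.

(** The past vector of rapidity [0] and length [G], the future vector of
    rapidity [w1 + w2] and length [1], and the future vector of rapidity [w2]
    and length [B] have collinear end points, the second one in the middle. *)
Lemma collinear_hinge w1 w2 : 0 < w1 -> 0 < w2 ->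
  exists G B, [/\ 0 < G, 0 < B, expR w1 < B,
    1 + B ^+ 2 - 2 * B * cosh w1 = 1 + G ^+ 2 + 2 * G * cosh (w1 + w2) &
    G ^+ 2 + B ^+ 2 + 2 * G * B * cosh w2 = 4 * (1 + G ^+ 2 + 2 * G * cosh (w1 + w2))].
Proof.
move=> w10 w20; have s1 := sinh_gt0 w10; have s2 := sinh_gt0 w20.
have S0 : 0 < sinh (w1 + w2) by rewrite sinh_gt0 // addr_gt0.
exists (2 * sinh w1 / sinh w2), (2 * sinh (w1 + w2) / sinh w2).
have [p1 pi0 pi1] := exp_gt1 w10; have [q1 qi0 qi1] := exp_gt1 w20.
split; [by apply: divr_gt0 => //; apply: mulr_gt0|by apply: divr_gt0 => //; apply: mulr_gt0| | |].
- rewrite ltr_pdivlMr // sinhD; have := sinh_lt_cosh w2; have := cosh_gt0 w1.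
  rewrite expR_coshDsinh; nra.
- rewrite /sinh /cosh !opprD !expRD !expRN.
  move: s2; rewrite /sinh expRN; move: (expR w1) (expR w2) p1 q1 => p q p1 q1 s2.
  have pn : p != 0 by rewrite lt0r_neq0 //; lra.
  have qn : q != 0 by rewrite lt0r_neq0 //; lra.
  have h : q * q - 1 != 0 by rewrite lt0r_neq0 //; nra.
  by field; rewrite pn qn h.
- rewrite /sinh /cosh !opprD !expRD !expRN.
  move: s2; rewrite /sinh expRN; move: (expR w1) (expR w2) p1 q1 => p q p1 q1 s2.
  have pn : p != 0 by rewrite lt0r_neq0 //; lra.
  have qn : q != 0 by rewrite lt0r_neq0 //; lra.
  have h : q * q - 1 != 0 by rewrite lt0r_neq0 //; nra.
  by field; rewrite pn qn h.
Qed.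

End hyperbolic_triangles.

Section triangle_inequalities.
Context {R : realType} {X : lorentzian_prelength_space R}.
Variables (W : set X) (x : X).
Hypotheses (Wfin : tau_finite_on W) (Wcts : tau_continuous_on W).
Implicit Types (p q : X) (al be ga : R -> X) (s t u d w : R).

(** Two curves [al] and [ga] are joined through [be] at the length at which
    the Minkowski hinge of angle [w1 + w2] is divided into the angles [w1] and
    [w2]. By the two bounds the two pieces are at least as long as in that
    hinge, and so is [tau (al s) (ga u)] by the reverse triangle
    inequality. *)
Lemma angle_bound_add d al be ga w1 w2 s u :
  future_germ W x d al -> future_germ W x d be -> future_germ W x d ga ->
  0 < w1 -> 0 < w2 -> angle_bound x d al be w1 -> angle_bound x d be ga w2 ->
  0 < s -> s <= d -> 0 < u -> u <= d -> causal (al s) (ga u) ->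
  fine (tau x (ga u)) < fine (tau x (be d)) ->
  fine (tau x (al s)) ^+ 2 + fine (tau x (ga u)) ^+ 2 - sep (al s) (ga u) ^+ 2 <=
    2 * fine (tau x (al s)) * fine (tau x (ga u)) * cosh (w1 + w2).
Proof.
move=> hal hbe hga w10 w20 h1 h2 s0 sd u0 ud hc hg.
have Wx := fg_base hal; have Wa := fgW hal (ltW s0) sd; have Wg := fgW hga (ltW u0) ud.
rewrite (sep_causal Wfin Wa hc).
have a0 := fine_tau_gt0 Wfin Wx Wa (fg_chron hal s0 sd).
have g0 := fine_tau_gt0 Wfin Wx Wg (fg_chron hga u0 ud).
have tri := fine_tau_triangle Wfin Wx Wa Wg (chron_causal (fg_chron hal s0 sd)) hc.
have c0 := fine_tau_ge0 (al s) (ga u).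
have w0 : 0 < w1 + w2 by rewrite addr_gt0.
rewrite leNgt; apply/negP => hlt.
(* otherwise [ga u] would not be in the future of [al s] in the hinge *)
have hag : fine (tau x (al s)) * expR (w1 + w2) < fine (tau x (ga u)).
  move: a0 g0 tri c0 hlt; move: (fine (tau x (al s))) (fine (tau x (ga u))) (fine (tau (al s) (ga u))) => a g c.
  rewrite /cosh expRN; have [p1 pi0 pi1] := exp_gt1 w0.
  have pp : expR (w1 + w2) * (expR (w1 + w2))^-1 = 1 by rewrite divff // lt0r_neq0 // expR_gt0.
  move: (expR _) (expR _)^-1 p1 pi0 pi1 pp => p pi p1 pi0 pi1 pp a0 g0 tri c0 hlt.
  rewrite ltNge; apply/negP => h.
  have : (g - a * p) * (g - a * pi) <= 0.
    by apply: mulr_le0_ge0; nra.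
  have -> : (g - a * p) * (g - a * pi) = g ^+ 2 + a ^+ 2 * (p * pi) - 2 * a * g * ((p + pi) / 2) by field.
  by rewrite pp; have := sqr_ge0 c; lra.
have [b [l [[b0 l01] ab bg e1 e2]]] := divide_hinge a0 g0 w10 w20 hag.
have bd : b <= fine (tau x (be d)).
  have [q1 _ _] := exp_gt1 w20; have : b <= b * expR w2 by rewrite ler_peMr //; exact: ltW.
  by lra.
have [t /andP[t0 td] tb] := fg_value Wfin Wcts hbe b0 bd.
rewrite -tb in ab bg e1 e2.
have [ch1 le1] := angle_bound_chron Wfin Wcts hal hbe (ltW w10) h1 s0 sd t0 td ab.
have [ch2 le2] := angle_bound_chron Wfin Wcts hbe hga (ltW w20) h2 t0 td u0 ud bg.
have Wb := fgW hbe (ltW t0) td.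
have tri2 := fine_tau_triangle Wfin Wa Wb Wg (chron_causal ch1) (chron_causal ch2).
have c10 := fine_tau_ge0 (al s) (be t); have c20 := fine_tau_ge0 (be t) (ga u).
move: le1 le2 tri2 c10 c20 hlt; rewrite e1 e2.
set D := _ - 2 * _ * _ * cosh (w1 + w2).
move: (fine (tau (al s) (be t))) (fine (tau (be t) (ga u))) => c1 c2 le1 le2 tri2 c10 c20 hlt.
have D0 : 0 < D by move: hlt (sqr_ge0 (fine (tau (al s) (ga u)))); rewrite /D; lra.
have sq := sqr_sqrtr (ltW D0); have sD := sqrtr_ge0 D.
have i1 : l * Num.sqrt D <= c1.
  by rewrite -(@ler_pXn2r _ 2) ?nnegrE ?mulr_ge0 //; [rewrite exprMn sq|lra].
have i2 : (1 - l) * Num.sqrt D <= c2.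
  by rewrite -(@ler_pXn2r _ 2) ?nnegrE ?mulr_ge0 //; [rewrite exprMn sq|lra].
have i3 : Num.sqrt D <= fine (tau (al s) (ga u)) by lra.
have : D <= fine (tau (al s) (ga u)) ^+ 2 by rewrite -sq ler_pXn2r ?nnegrE.
by move: hlt; rewrite /D; lra.
Qed.

Section past.
Context {d : R} {ga : R -> X} (hga : past_germ W x d ga).

Lemma pgW t : 0 <= t -> t <= d -> W (ga t).
Proof. by case: hga => _ _ h _ _ t0 td; apply: h; rewrite t0. Qed.

Lemma pg_base : W x.
Proof. by case: hga => d0 <- h _ _; apply: h; rewrite lexx ltW. Qed.

Lemma pg_chron t : 0 < t -> t <= d -> chron (ga t) x.
Proof. by case: hga => _ <- _ _ h t0 td; exact: h. Qed.

Lemma pg_value v : 0 < v -> v <= fine (tau (ga d) x) ->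
  exists2 s, 0 < s <= d & fine (tau (ga s) x) = v.
Proof.
move=> v0 vd; have [d0 a0 aW ac _] := hga.
have cf : {within `[0, d], continuous (fun t => fine (tau (ga t) x))}.
  apply: (cts_tau_curves Wfin Wcts) => //; first by move=> t td; split; [exact: aW|exact: pg_base].
  exact: cst_continuous.
have [|s] := IVT (ltW d0) cf (v := v).
  rewrite a0 (Wself Wfin pg_base) /=; rewrite ge_min le_max (ltW v0) vd orbT andbT //.
rewrite in_itv /= => /andP[s0 sd] hs; exists s => //; rewrite sd andbT lt_neqAle s0 andbT.
by apply/eqP => e; move: hs; rewrite -e a0 (Wself Wfin pg_base) /= => e'; rewrite -e' ltxx in v0.
Qed.

End past.

(** The bound on the angle between a future and a past directed curve; here the
    two sides lie on opposite sides of [x], which changes the sign of the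
    product in the law of cosines. *)
Definition mixed_bound d al ga w := forall s u, 0 < s -> s <= d -> 0 < u -> u <= d ->
  fine (tau (ga u) (al s)) ^+ 2 <= fine (tau x (al s)) ^+ 2 + fine (tau (ga u) x) ^+ 2 +
    2 * fine (tau x (al s)) * fine (tau (ga u) x) * cosh w.

(** If the angle between [al] and [ga] exceeded [w1 + w2] in the limit, then
    for points [ga u], [al s], [be t] at distances from [x] in the ratio of
    [collinear_hinge], the time separation from [ga u] to [be t] would be less
    than the sum of those through [al s]. *)
Lemma mixed_bound_add d al be ga w1 w2 :
  future_germ W x d al -> future_germ W x d be -> past_germ W x d ga ->
  0 < w1 -> 0 < w2 -> angle_bound x d al be w1 -> mixed_bound d be ga w2 ->
  ~ (forall s u, 0 < s -> s <= d -> 0 < u -> u <= d ->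
    fine (tau x (al s)) ^+ 2 + fine (tau (ga u) x) ^+ 2 +
    2 * fine (tau x (al s)) * fine (tau (ga u) x) * cosh (w1 + w2) <
    fine (tau (ga u) (al s)) ^+ 2).
Proof.
move=> hal hbe hga w10 w20 h1 h2 hgt.
have [d0 _ _ _ _] := hal; have dd := lexx d.
have Wx := fg_base hal.
have [G [B [G0 B0 hB e1 e2]]] := collinear_hinge w10 w20.
have ad := fine_tau_gt0 Wfin Wx (fgW hal (ltW d0) dd) (fg_chron hal d0 dd).
have bd := fine_tau_gt0 Wfin Wx (fgW hbe (ltW d0) dd) (fg_chron hbe d0 dd).
have gd := fine_tau_gt0 Wfin (pgW hga (ltW d0) dd) Wx (pg_chron hga d0 dd).
pose a := Num.min (fine (tau x (al d))) (Num.min (fine (tau (ga d) x) / G) (fine (tau x (be d)) / B)).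
have a0 : 0 < a by rewrite !lt_min ad !divr_gt0.
have [s /andP[s0 sd] sa] : exists2 s, 0 < s <= d & fine (tau x (al s)) = a.
  by apply: (fg_value Wfin Wcts hal a0); rewrite ge_min lexx.
have [u /andP[u0 ud] ug] : exists2 s, 0 < s <= d & fine (tau (ga s) x) = a * G.
  apply: (pg_value hga); first exact: mulr_gt0.
  by rewrite -ler_pdivlMr // /a !ge_min lexx !orbT.
have [t /andP[t0 td] tb] : exists2 s, 0 < s <= d & fine (tau x (be s)) = a * B.
  apply: (fg_value Wfin Wcts hbe); first exact: mulr_gt0.
  by rewrite -ler_pdivlMr // /a !ge_min lexx !orbT.
have [|ch1 le1] := angle_bound_chron Wfin Wcts hal hbe (ltW w10) h1 s0 sd t0 td.
  by rewrite sa tb ltr_pM2l.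
have Wa := fgW hal (ltW s0) sd; have Wb := fgW hbe (ltW t0) td; have Wg := pgW hga (ltW u0) ud.
have hga' := chron_trans (pg_chron hga u0 ud) (fg_chron hal s0 sd).
have tri := fine_tau_triangle Wfin Wg Wa Wb (chron_causal hga') (chron_causal ch1).
have := h2 t u t0 td u0 ud; have := hgt s u s0 sd u0 ud.
have c10 := fine_tau_ge0 (al s) (be t); have A0 := fine_tau_ge0 (ga u) (al s).
move: le1 tri c10 A0; rewrite sa ug tb.
move: (fine (tau (al s) (be t))) (fine (tau (ga u) (al s))) (fine (tau (ga u) (be t))) => c A T.
move=> le1 tri c0 A0 hA hT.
pose D := 1 + G ^+ 2 + 2 * G * cosh (w1 + w2).
have D0 : 0 < D.
  have : 0 < 2 * G * cosh (w1 + w2) by apply: mulr_gt0; [lra|exact: cosh_gt0].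
  by have := sqr_ge0 G; rewrite /D; lra.
have q1 : a ^+ 2 * D <= c ^+ 2.
  by apply: le_trans le1; rewrite le_eqVlt; apply/orP; left; apply/eqP; rewrite /D -e1; ring.
have q2 : a ^+ 2 * D < A ^+ 2.
  by apply: le_lt_trans hA; rewrite le_eqVlt; apply/orP; left; apply/eqP; rewrite /D; ring.
have q3 : T ^+ 2 <= a ^+ 2 * (4 * D).
  by apply: (le_trans hT); rewrite le_eqVlt; apply/orP; left; apply/eqP; rewrite /D -e2; ring.
have q4 : (A + c) ^+ 2 <= T ^+ 2 by rewrite ler_pXn2r ?nnegrE //; lra.
have sq : Num.sqrt (a ^+ 2 * D) ^+ 2 = a ^+ 2 * D by rewrite sqr_sqrtr // mulr_ge0 ?sqr_ge0 ?ltW.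
have s00 := sqrtr_ge0 (a ^+ 2 * D).
have i1 : Num.sqrt (a ^+ 2 * D) <= c by rewrite -(@ler_pXn2r _ 2) ?nnegrE // sq.
have i2 : Num.sqrt (a ^+ 2 * D) < A by rewrite -(@ltr_pXn2r _ 2) ?nnegrE // sq.
by move: i1 i2 sq; move: (Num.sqrt _) s00 => S S0 i1 i2 sq; nra.
Qed.

End triangle_inequalities.

(** * Upper angles *)

Section upper_angles.
Context {R : realType} {X : lorentzian_prelength_space R}.
Implicit Types (al be ga : R -> X) (s t d w : R).

Lemma angle_filterP al be (P : set (R * R)) : angle_filter al be P <->
  exists2 d : R, 0 < d & forall s t, 0 < s -> s <= d -> 0 < t -> t <= d ->
    angle_domain al be (s, t) -> P (s, t).
Proof.
split.
- rewrite /angle_filter /within /= => /nbhs_ballP[e /= e0 he]; exists (e / 2); first lra.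
  move=> s t s0 sd t0 td hst; apply: (he (s, t)) => //; split; rewrite /ball /= sub0r normrN gtr0_norm //; lra.
- move=> [d d0 h]; rewrite /angle_filter /within /=; apply/nbhs_ballP; exists d => //=.
  move=> [s t] [/= hs ht] hd; have [/= s0 t0 _ _] := hd; apply: h => //.
    by move: hs; rewrite /ball /= sub0r normrN gtr0_norm // => /ltW.
  by move: ht; rewrite /ball /= sub0r normrN gtr0_norm // => /ltW.
Qed.

Lemma upper_angle_lt al be w : (upper_angle al be < w%:E)%E ->
  exists2 d : R, 0 < d & forall s t, 0 < s -> s <= d -> 0 < t -> t <= d ->
    angle_domain al be (s, t) -> comparison_angle (al 0) (al s) (be t) < w.
Proof.
rewrite /upper_angle /limf_esup => /ereal_inf_lt[_ [V hV <-] hlt].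
have [d d0 h] := (angle_filterP al be V).1 hV.
exists d => // s t s0 sd t0 td hst; rewrite -lte_fin.
apply: le_lt_trans hlt; apply: ereal_sup_ubound; exists (s, t) => //; exact: h.
Qed.

Lemma upper_angle_gt al be w d : (w%:E < upper_angle al be)%E -> 0 < d ->
  exists s t, [/\ 0 < s <= d, 0 < t <= d, angle_domain al be (s, t) &
    w < comparison_angle (al 0) (al s) (be t)].
Proof.
move=> hw d0; pose V : set (R * R) := [set st | st.1 <= d /\ st.2 <= d /\ angle_domain al be st].
have hV : angle_filter al be V.
  by apply/angle_filterP; exists d => // s t s0 sd t0 td hst.
have : (w%:E < ereal_sup (angle_fun al be @` V))%E.
  by apply: lt_le_trans hw _; apply: ereal_inf_lbound; exists V.
move=> /ereal_sup_gt[_ [[s t] [/= sd [td hst]] <-]]; rewrite lte_fin => h.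
by have [/= s0 t0 _ _] := hst; exists s, t; split => //; apply/andP; split.
Qed.

Lemma upper_angle_ge0 al be :
  (forall d, 0 < d -> exists s t, [/\ 0 < s <= d, 0 < t <= d, angle_domain al be (s, t) &
    0 <= comparison_angle (al 0) (al s) (be t)]) -> (0 <= upper_angle al be)%E.
Proof.
move=> h; rewrite leNgt; apply/negP => /upper_angle_lt[d d0 hd].
have [s [t [/andP[s0 sd] /andP[t0 td] hst h0]]] := h d d0.
by have := hd s t s0 sd t0 td hst; rewrite ltNge h0.
Qed.

Lemma angle_exists_gt al be w : angle_exists al be -> (w%:E < upper_angle al be)%E ->
  exists2 d : R, 0 < d & forall s t, 0 < s -> s <= d -> 0 < t -> t <= d ->
    angle_domain al be (s, t) -> w < comparison_angle (al 0) (al s) (be t).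
Proof.
move=> [_ hcvg] hw.
have : angle_filter al be (fun st => (w%:E < angle_fun al be st)%E).
  have hn : nbhs (upper_angle al be) [set y | (w%:E < y)%E].
    by apply: open_nbhs_nbhs; split; [exact: open_ereal_gt_ereal|exact: hw].
  exact: (hcvg _ hn).
by move=> /angle_filterP[d d0 h]; exists d.
Qed.

End upper_angles.

Section angles_of_germs.
Context {R : realType} {X : lorentzian_prelength_space R}.
Variables (W : set X) (x : X).
Hypotheses (Wfin : tau_finite_on W).
Implicit Types (al be ga : R -> X) (s t u d w : R).

Lemma future_value d al be s t : future_germ W x d al -> future_germ W x d be ->
  0 < s -> s <= d -> 0 < t -> t <= d -> causal (al s) (be t) \/ causal (be t) (al s) ->
  [/\ angle_domain al be (s, t),
    comparison_angle (al 0) (al s) (be t) =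
      arcosh ((fine (tau x (al s)) ^+ 2 + fine (tau x (be t)) ^+ 2 - sep (al s) (be t) ^+ 2) /
        (2 * fine (tau x (al s)) * fine (tau x (be t)))) &
    2 * fine (tau x (al s)) * fine (tau x (be t)) <=
      fine (tau x (al s)) ^+ 2 + fine (tau x (be t)) ^+ 2 - sep (al s) (be t) ^+ 2 /\
    0 < 2 * fine (tau x (al s)) * fine (tau x (be t))].
Proof.
move=> hal hbe s0 sd t0 td hc.
have Wx := fg_base hal; have Wa := fgW hal (ltW s0) sd; have Wb := fgW hbe (ltW t0) td.
have cha := fg_chron hal s0 sd; have chb := fg_chron hbe t0 td.
have a0 := fine_tau_gt0 Wfin Wx Wa cha; have b0 := fine_tau_gt0 Wfin Wx Wb chb.
have [_ al0 _ _ _] := hal.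
have h1 : 2 * fine (tau x (al s)) * fine (tau x (be t)) <=
      fine (tau x (al s)) ^+ 2 + fine (tau x (be t)) ^+ 2 - sep (al s) (be t) ^+ 2.
  case: hc => h.
    have := fine_tau_triangle Wfin Wx Wa Wb (chron_causal cha) h.
    rewrite (sep_causal Wfin Wa h); have := fine_tau_ge0 (al s) (be t).
    by move: (fine (tau (al s) (be t))) => c c0 tri; nra.
  have := fine_tau_triangle Wfin Wx Wb Wa (chron_causal chb) h.
  rewrite sepC (sep_causal Wfin Wb h); have := fine_tau_ge0 (be t) (al s).
  by move: (fine (tau (be t) (al s))) => c c0 tri; nra.
have h2 : 0 < 2 * fine (tau x (al s)) * fine (tau x (be t)) by rewrite !mulr_gt0.
split => //; first by split => //=; rewrite al0; exact: (finite_separationsW Wfin Wx Wa Wb).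
rewrite al0 comparison_angleE; [|exact: (finite_separationsW Wfin Wx Wa Wb)|by left|by []].
rewrite (sep_causal Wfin Wx (chron_causal cha)) (sep_causal Wfin Wx (chron_causal chb)).
rewrite /law_of_cosines_value ger0_norm //.
by apply: le_trans h1; exact: ltW.
Qed.

Lemma mixed_value d al ga s u : future_germ W x d al -> past_germ W x d ga ->
  0 < s -> s <= d -> 0 < u -> u <= d ->
  [/\ angle_domain al ga (s, u) /\ angle_domain ga al (u, s),
    comparison_angle x (al s) (ga u) =
      arcosh ((fine (tau (ga u) (al s)) ^+ 2 - fine (tau x (al s)) ^+ 2 - fine (tau (ga u) x) ^+ 2) /
        (2 * fine (tau x (al s)) * fine (tau (ga u) x))),
    comparison_angle x (ga u) (al s) = comparison_angle x (al s) (ga u) &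
    2 * fine (tau x (al s)) * fine (tau (ga u) x) <=
      fine (tau (ga u) (al s)) ^+ 2 - fine (tau x (al s)) ^+ 2 - fine (tau (ga u) x) ^+ 2 /\
    0 < 2 * fine (tau x (al s)) * fine (tau (ga u) x)].
Proof.
move=> hal hga s0 sd u0 ud.
have Wx := fg_base hal; have Wa := fgW hal (ltW s0) sd; have Wg := pgW hga (ltW u0) ud.
have cha := fg_chron hal s0 sd; have chg := pg_chron hga u0 ud.
have a0 := fine_tau_gt0 Wfin Wx Wa cha; have g0 := fine_tau_gt0 Wfin Wg Wx chg.
have [_ al0 _ _ _] := hal; have [_ ga0 _ _ _] := hga.
have chga := chron_trans chg cha.
have h1 : 2 * fine (tau x (al s)) * fine (tau (ga u) x) <=
      fine (tau (ga u) (al s)) ^+ 2 - fine (tau x (al s)) ^+ 2 - fine (tau (ga u) x) ^+ 2.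
  have := fine_tau_triangle Wfin Wg Wx Wa (chron_causal chg) (chron_causal cha).
  by move: (fine (tau (ga u) (al s))) => c tri; nra.
have h2 : 0 < 2 * fine (tau x (al s)) * fine (tau (ga u) x) by rewrite !mulr_gt0.
have e1 : comparison_angle x (al s) (ga u) =
      arcosh ((fine (tau (ga u) (al s)) ^+ 2 - fine (tau x (al s)) ^+ 2 - fine (tau (ga u) x) ^+ 2) /
        (2 * fine (tau x (al s)) * fine (tau (ga u) x))).
  rewrite comparison_angleE; [|exact: (finite_separationsW Wfin Wx Wa Wg)|by right; left|by right; exact: chron_causal].
  rewrite (sep_causal Wfin Wx (chron_causal cha)) [sep x _]sepC (sep_causal Wfin Wg (chron_causal chg)).
  rewrite sepC (sep_causal Wfin Wg (chron_causal chga)) /law_of_cosines_value -normrN ger0_norm; last lra.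
  by congr (arcosh (_ / _)); ring.
split => //.
- split; split => //=; rewrite ?al0 ?ga0.
  + by right; exact: chron_causal.
  + exact: (finite_separationsW Wfin Wx Wa Wg).
  + by left; exact: chron_causal.
  + exact: (finite_separationsW Wfin Wx Wg Wa).
- rewrite e1 comparison_angleE; [|exact: (finite_separationsW Wfin Wx Wg Wa)|by right; right|by left; exact: chron_causal].
  rewrite (sep_causal Wfin Wx (chron_causal cha)) [sep x _]sepC (sep_causal Wfin Wg (chron_causal chg)).
  rewrite (sep_causal Wfin Wg (chron_causal chga)) /law_of_cosines_value -normrN ger0_norm; last lra.
  by congr (arcosh (_ / _)); ring.
Qed.

Lemma future_bound d al be w : future_germ W x d al -> future_germ W x d be -> 0 <= w ->
  (upper_angle al be < w%:E)%E -> exists2 d', 0 < d' <= d & angle_bound x d' al be w.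
Proof.
move=> hal hbe w0 /upper_angle_lt[e e0 he]; have [d0 _ _ _ _] := hal.
exists (Num.min d e); first by rewrite lt_min d0 e0 ge_min lexx.
move=> s t s0; rewrite le_min => /andP[sd se] t0; rewrite le_min => /andP[td te] hc.
have hc' : causal (al s) (be t) \/ causal (be t) (al s) by case: hc => /chron_causal; tauto.
have [hd hv [h1 h2]] := future_value hal hbe s0 sd t0 td hc'.
have := he s t s0 se t0 te hd; rewrite hv arcosh_lt //; last by rewrite ler_pdivlMr // mul1r.
by rewrite ltr_pdivrMr // => /ltW; rewrite mulrC.
Qed.

Lemma mixed_bound_lt d al ga w : future_germ W x d al -> past_germ W x d ga -> 0 <= w ->
  (upper_angle al ga < w%:E)%E \/ (upper_angle ga al < w%:E)%E ->
  exists2 d', 0 < d' <= d & mixed_bound x d' al ga w.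
Proof.
move=> hal hga w0 hw; have [d0 al0 _ _ _] := hal; have [_ ga0 _ _ _] := hga.
have [e e0 he] : exists2 e : R, 0 < e & forall s u, 0 < s -> s <= d -> s <= e -> 0 < u -> u <= d -> u <= e ->
    comparison_angle x (al s) (ga u) < w.
  case: hw => /upper_angle_lt[e e0 he]; exists e => // s u s0 sd se u0 ud ue.
    by have [[hd _] _ _ _] := mixed_value hal hga s0 sd u0 ud; rewrite -al0; exact: he.
  have [[_ hd] _ <- _] := mixed_value hal hga s0 sd u0 ud.
  by rewrite -ga0; exact: he.
exists (Num.min d e); first by rewrite lt_min d0 e0 ge_min lexx.
move=> s u s0; rewrite le_min => /andP[sd se] u0; rewrite le_min => /andP[ud ue].
have [_ hv _ [h1 h2]] := mixed_value hal hga s0 sd u0 ud.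
have := he s u s0 sd se u0 ud ue; rewrite hv arcosh_lt //; last by rewrite ler_pdivlMr // mul1r.
by rewrite ltr_pdivrMr // => h; lra.
Qed.

Lemma mixed_angle_gt d al ga w : future_germ W x d al -> past_germ W x d ga -> 0 <= w ->
  angle_exists al ga -> (w%:E < upper_angle al ga)%E ->
  exists2 d', 0 < d' <= d & forall s u, 0 < s -> s <= d' -> 0 < u -> u <= d' ->
    fine (tau x (al s)) ^+ 2 + fine (tau (ga u) x) ^+ 2 +
    2 * fine (tau x (al s)) * fine (tau (ga u) x) * cosh w <
    fine (tau (ga u) (al s)) ^+ 2.
Proof.
move=> hal hga w0 hex hw; have [d0 al0 _ _ _] := hal.
have [e e0 he] := angle_exists_gt hex hw.
exists (Num.min d e); first by rewrite lt_min d0 e0 ge_min lexx.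
move=> s u s0; rewrite le_min => /andP[sd se] u0; rewrite le_min => /andP[ud ue].
have [[hd _] hv _ [h1 h2]] := mixed_value hal hga s0 sd u0 ud.
have := he s u s0 se u0 ue hd; rewrite al0 hv arcosh_gt //; last by rewrite ler_pdivlMr // mul1r.
by rewrite ltr_pdivlMr // => h; lra.
Qed.

Lemma future_angle_gt d al be w : future_germ W x d al -> future_germ W x d be -> 0 <= w ->
  (w%:E < upper_angle al be)%E ->
  forall d', 0 < d' -> d' <= d -> exists s t, [/\ 0 < s <= d', 0 < t <= d',
    causal (al s) (be t) \/ causal (be t) (al s) &
    2 * fine (tau x (al s)) * fine (tau x (be t)) * cosh w <
      fine (tau x (al s)) ^+ 2 + fine (tau x (be t)) ^+ 2 - sep (al s) (be t) ^+ 2].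
Proof.
move=> hal hbe w0 hw d' d'0 dd.
have [s [t [/andP[s0 sd] /andP[t0 td] hd]]] := upper_angle_gt hw d'0.
have [_ _ hc _] := hd.
have [_ -> [h1 h2]] := future_value hal hbe s0 (le_trans sd dd) t0 (le_trans td dd) hc.
rewrite arcosh_gt //; last by rewrite ler_pdivlMr // mul1r.
rewrite ltr_pdivlMr // => h; exists s, t; split => //; [by rewrite s0|by rewrite t0|lra].
Qed.

(** The point [be d] is in the future of [x], hence of [al s] for small
    [s]. This is what makes the upper angle of two future directed curves
    nonnegative: the limit superior is not over the empty set. *)
Lemma future_near d al be : future_germ W x d al -> future_germ W x d be ->
  exists s t, [/\ 0 < s <= d, 0 < t <= d & chron (al s) (be t)].
Proof.
move=> hal hbe; have [d0 al0 _ ac _] := hal.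
have h := fg_chron hbe d0 (lexx d).
have [hn _] := chron_near h.
have /subspace_continuousP/(_ 0) hc := ac.
have : within `[0, d] (nbhs (0 : R)) (fun s => chron (al s) (be d)).
  apply: (hc _ (fun p => chron p (be d))); first by rewrite /= in_itv /= lexx ltW.
  by change (nbhs (al 0) (fun p => chron p (be d))); rewrite al0.
rewrite /within /= => /nbhs_ballP[e /= e0 he].
have [m m0 [m1 m2]] := pos_below2 d0 e0.
exists (m / 2), d; split; [lra|by rewrite d0 lexx|].
apply: he; last by rewrite /= in_itv /=; lra.
by rewrite /ball /= sub0r normrN gtr0_norm; lra.
Qed.

Lemma future_angle_ge0 d al be : future_germ W x d al -> future_germ W x d be ->
  (0 <= upper_angle al be)%E.
Proof.
move=> hal hbe; apply: upper_angle_ge0 => e e0; have [d0 _ _ _ _] := hal.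
have [m m0 [m1 m2]] := pos_below2 d0 e0.
have [s [t [/andP[s0 sd] /andP[t0 td] hc]]] :=
  future_near (germ_shrink m0 m1 hal) (germ_shrink m0 m1 hbe).
have [hd hv [h1 h2]] := future_value hal hbe s0 (le_trans sd m1) t0 (le_trans td m1) (or_introl (chron_causal hc)).
exists s, t; split => //; [by rewrite s0 (le_trans sd)|by rewrite t0 (le_trans td)|].
by rewrite hv arcosh_ge0 // ler_pdivlMr // mul1r.
Qed.

Lemma mixed_angle_ge0 d al ga : future_germ W x d al -> past_germ W x d ga ->
  (0 <= upper_angle al ga)%E /\ (0 <= upper_angle ga al)%E.
Proof.
move=> hal hga; have [d0 al0 _ _ _] := hal; have [_ ga0 _ _ _] := hga.
split; apply: upper_angle_ge0 => e /(pos_below2 d0)[s s0 [sd se]]; exists s, s; split; rewrite ?s0 ?se //.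
- by have [[]] := mixed_value hal hga s0 sd s0 sd.
- have [_ hv _ [h1 h2]] := mixed_value hal hga s0 sd s0 sd.
  by rewrite al0 hv arcosh_ge0 // ler_pdivlMr // mul1r.
- by have [[]] := mixed_value hal hga s0 sd s0 sd.
- have [_ hv hs [h1 h2]] := mixed_value hal hga s0 sd s0 sd.
  by rewrite ga0 hs hv arcosh_ge0 // ler_pdivlMr // mul1r.
Qed.

End angles_of_germs.

Section extended_reals.
Context {R : realType}.
Implicit Types (p q r : \bar R).

Lemma split_gap p q r : (0 <= p)%E -> (0 <= q)%E -> (p + q < r)%E ->
  exists w1 w2 : R, [/\ 0 < w1, 0 < w2, (p < w1%:E)%E, (q < w2%:E)%E & ((w1 + w2)%:E < r)%E].
Proof.
move=> p0 q0 h; have : (p + q < +oo)%E by apply: lt_le_trans h _; exact: leey.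
case: p p0 h => [p| |] //; case: q q0 => [q| |] //; rewrite !lee_fin => q0 p0 + _.
case: r => [r| |] //; last by move=> _; exists (p + 1), (q + 1); rewrite !lte_fin ltry; split=> //; lra.
rewrite -EFinD lte_fin => h; pose e := (r - (p + q)) / 3.
exists (p + e), (q + e); rewrite !lte_fin /e; split; lra.
Qed.

End extended_reals.

Section curves_to_germs.
Context {R : realType} {X : lorentzian_prelength_space R}.
Implicit Types (al be ga : R -> X) (s t u d : R) (W : set X) (I : set R).

Lemma curve_within I al (b : R) : locally_lipschitz I al -> `[0, b]%classic `<=` I ->
  {within `[0, b], continuous al}.
Proof.
move=> hl hI; apply/subspace_continuousP => t tb.
have := lipschitz_within hl (hI t tb); apply: cvg_trans; apply: cvg_fmap2.
by move=> A /=; rewrite /within /=; apply: filterS => s h sb; apply: h; exact: hI.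
Qed.

Lemma curve_near I al (b : R) W : 0 < b -> locally_lipschitz I al -> `[0, b]%classic `<=` I ->
  nbhs (al 0) W -> exists d, [/\ 0 < d, d <= b & forall t, 0 <= t <= d -> W (al t)].
Proof.
move=> b0 hl hI hW; have I0 : I 0 by apply: hI; rewrite /= in_itv /= lexx ltW.
have := lipschitz_within hl I0 hW; rewrite /= /within /= => /nbhs_ballP[e /= e0 he].
have [m m0 [m1 m2]] := pos_below2 b0 e0.
exists (m / 2); split; [lra|lra|] => t /andP[t0 td]; apply: he.
  by rewrite /ball /= sub0r normrN ger0_norm //; lra.
by apply: hI; rewrite /= in_itv /=; lra.
Qed.

Lemma future_curve_germ I al (b : R) W : 0 < b -> fd_timelike I al -> `[0, b]%classic `<=` I ->
  nbhs (al 0) W -> exists2 d, d <= b & future_germ W (al 0) d al.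
Proof.
move=> b0 [[_ _ _ hl] hch] hI hW; have [d [d0 db hd]] := curve_near b0 hl hI hW.
have hI' : `[0, d]%classic `<=` I.
  by apply: subset_trans hI => t; rewrite /= !in_itv /=; lra.
exists d => //; split => //; first exact: curve_within hl hI'.
by move=> s t s0 st td; apply: hch => //; apply: hI'; rewrite /= in_itv /=; lra.
Qed.

Lemma past_curve_germ I al (b : R) W : 0 < b -> pd_timelike I al -> `[0, b]%classic `<=` I ->
  nbhs (al 0) W -> exists2 d, d <= b & past_germ W (al 0) d al.
Proof.
move=> b0 [[_ _ _ hl] hch] hI hW; have [d [d0 db hd]] := curve_near b0 hl hI hW.
have hI' : `[0, d]%classic `<=` I.
  by apply: subset_trans hI => t; rewrite /= !in_itv /=; lra.
exists d => //; split => //; first exact: curve_within hl hI'.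
by move=> s t s0 st td; apply: hch => //; apply: hI'; rewrite /= in_itv /=; lra.
Qed.

Lemma initial_segment (B : \bar R) : (0 < B)%E -> exists2 b : R, 0 < b &
  `[0, b]%classic `<=` [set t | 0 <= t /\ (t%:E < B)%E].
Proof.
case: B => [B| |] // B0; last first.
  by exists 1 => // t; rewrite /= in_itv /= => /andP[-> _]; rewrite ltry.
rewrite lte_fin in B0; exists (B / 2) => [|t]; first lra.
by rewrite /= in_itv /= => /andP[t0 tB]; split => //; rewrite lte_fin; lra.
Qed.

Lemma tame_neighbourhood (x : X) : locally_finite_valued X -> locally_continuous X ->
  exists W, [/\ nbhs x W, tau_finite_on W & tau_continuous_on W].
Proof.
move=> /(_ x)[U hU fU] /(_ x)[V hV cV]; exists (U `&` V); split.
- exact: filterI.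
- by move=> p q [Up _] [Uq _]; exact: fU.
- by apply: continuous_subspaceW cV => -[p q] /= [[_ Vp] [_ Vq]].
Qed.

End curves_to_germs.

Section part_one.
Context {R : realType} {X : lorentzian_prelength_space R}.
Implicit Types (al be ga : R -> X).

(** Any gap in the triangle inequality would leave room for [w1] and [w2] that
    exceed the two angles on the right; [mixed_bound_add] excludes this. That
    the angle on the left is a limit is used to have its lower bound for all
    small parameters, since the parameters are chosen by [mixed_bound_add]. *)
Lemma upper_angle_triangle_past (W : set X) (x : X) (d : R) al be ga :
  tau_finite_on W -> tau_continuous_on W ->
  future_germ W x d al -> future_germ W x d be -> past_germ W x d ga ->
  angle_exists al ga ->
  (upper_angle al ga <= upper_angle al be + upper_angle be ga)%E.
Proof.
move=> Wfin Wcts hal hbe hga hex; rewrite leNgt; apply/negP => hlt.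
have p0 := future_angle_ge0 Wfin hal hbe.
have [q0 _] := mixed_angle_ge0 Wfin hbe hga.
have [w1 [w2 [w10 w20 h1 h2 h3]]] := split_gap p0 q0 hlt.
have [d1 /andP[d10 d1d] b1] := future_bound Wfin hal hbe (ltW w10) h1.
have [d2 /andP[d20 d2d] b2] := mixed_bound_lt Wfin hbe hga (ltW w20) (or_introl h2).
have w0 : 0 <= w1 + w2 by lra.
have [d3 /andP[d30 d3d] b3] := mixed_angle_gt Wfin hal hga w0 hex h3.
have [e e0 [e1 e2 e3]] := pos_below3 d10 d20 d30.
have ed : e <= d by lra.
apply: (mixed_bound_add Wfin Wcts (germ_shrink e0 ed hal) (germ_shrink e0 ed hbe)
  (past_germ_shrink e0 ed hga) w10 w20) => [s t *|s u *|s u *].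
- by apply: b1 => //; lra.
- by apply: b2 => //; lra.
- by apply: b3 => //; lra.
Qed.

(** Here the upper angle on the left is enough: [angle_bound_add] applies to any
    two points of [al] and [ga] that are close enough to [x] for [be] to
    reach beyond them. *)
Lemma upper_angle_triangle_future (W : set X) (x : X) (d w1 w2 : R) al be ga :
  tau_finite_on W -> tau_continuous_on W ->
  future_germ W x d al -> future_germ W x d be -> future_germ W x d ga ->
  0 < w1 -> 0 < w2 -> angle_bound x d al be w1 -> angle_bound x d be ga w2 ->
  (upper_angle al ga <= (w1 + w2)%:E)%E.
Proof.
move=> Wfin Wcts hal hbe hga w10 w20 b1 b2; rewrite leNgt; apply/negP => hlt.
have [d0 al0 _ ac _] := hal; have Wx := fg_base hal.
have bd := fine_tau_gt0 Wfin Wx (fgW hbe (ltW d0) (lexx d)) (fg_chron hbe d0 (lexx d)).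
have small (c : R -> X) : future_germ W x d c ->
    exists2 e, 0 < e <= d & fine (tau x (c e)) < fine (tau x (be d)).
  move=> hc.
  have cd := fine_tau_gt0 Wfin Wx (fgW hc (ltW d0) (lexx d)) (fg_chron hc d0 (lexx d)).
  have bd2 : 0 < fine (tau x (be d)) / 2 by lra.
  have [v v0 [vb vc]] := pos_below2 bd2 cd.
  by have [s hs hv] := fg_value Wfin Wcts hc v0 vc; exists s => //; rewrite hv; lra.
have [ea /andP[ea0 ead] ha] := small al hal.
have [eg /andP[eg0 egd] hg] := small ga hga.
have [e e0 [e1 e2]] := pos_below2 ea0 eg0.
have w0 : 0 <= w1 + w2 by lra.
have ed : e <= d by lra.
have [s [u [/andP[s0 se] /andP[u0 ue] hc]]] := future_angle_gt Wfin hal hga w0 hlt e0 ed.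
have sd : s <= d by lra. have ud : u <= d by lra.
apply/negP; rewrite -leNgt; case: hc => hc.
- apply: (angle_bound_add Wfin Wcts hal hbe hga w10 w20 b1 b2) => //.
  by apply: le_lt_trans hg; apply: (fg_mono Wfin hga) => //; [exact: ltW|lra].
- have := angle_bound_add Wfin Wcts hga hbe hal w20 w10 (angle_boundC b2) (angle_boundC b1) u0 ud s0 sd hc.
  rewrite sepC [w2 + w1]addrC => h.
  have : fine (tau x (al s)) < fine (tau x (be d)).
    by apply: le_lt_trans ha; apply: (fg_mono Wfin hal) => //; [exact: ltW|lra].
  by move=> /h; lra.
Qed.

End part_one.

(** * Maximal curves *)

Section realizers.
Context {R : realType} {X : lorentzian_prelength_space R}.
Implicit Types (c : R -> X) (a b s t : R) (l : seq R).

Fixpoint chain_sum c a l : \bar R :=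
  if l is y :: l' then (tau (c a) (c y) + chain_sum c y l')%E else 0%E.

Lemma chain_sumE c a b l :
  (\sum_(0 <= i < size l) tau (c (nth b (a :: l) i)) (c (nth b l i)))%E = chain_sum c a l.
Proof.
elim: l a => [|y l IH] a /=; first by rewrite big_geq.
by rewrite big_nat_recl //= IH.
Qed.

Lemma tau_lengthE c a b :
  tau_length c a b = ereal_inf [set chain_sum c a l | l in itv_partition a b].
Proof.
by rewrite /tau_length; congr ereal_inf; apply/seteqP; split => _ [l hl <-]; exists l => //; rewrite chain_sumE.
Qed.

Lemma chain_sum_cat c a l1 l2 :
  chain_sum c a (l1 ++ l2) = (chain_sum c a l1 + chain_sum c (last a l1) l2)%E.
Proof. by elim: l1 a => [|y l1 IH] a /=; rewrite ?add0e // IH addeA. Qed.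

Lemma chain_sum_ge0 c a l : (0 <= chain_sum c a l)%E.
Proof. by elim: l a => [|y l IH] a //=; rewrite adde_ge0 // tau_ge0. Qed.

Lemma path_le_last a l : path <%R a l -> a <= last a l.
Proof.
elim: l a => [|y l IH] a //= /andP[ay /IH]; apply: le_trans; exact: ltW.
Qed.

Lemma fd_causal_le c a b s t : fd_causal `[a, b] c -> a <= s -> s <= t -> t <= b ->
  causal (c s) (c t).
Proof.
move=> [_ h] sa; rewrite le_eqVlt => /predU1P[->|st] tb; first exact: causal_refl.
by apply: h => //; rewrite /= in_itv /=; lra.
Qed.

Lemma chain_sum_le c a b s l : fd_causal `[a, b] c -> a <= s -> path <%R s l -> last s l <= b ->
  (chain_sum c s l <= tau (c s) (c (last s l)))%E.
Proof.
move=> hc; elim: l s => [|y l IH] s /= as_; first by rewrite tau_ge0.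
move=> /andP[sy hl] lb; have yl := path_le_last hl.
have h1 := fd_causal_le hc as_ (ltW sy) (le_trans yl lb).
have ay : a <= y by lra.
have h2 := fd_causal_le hc ay yl lb.
by apply: le_trans (tau_reverse_triangle h1 h2); rewrite leeD2l // IH.
Qed.

Lemma realizer_chain c a b l : fd_realizer c a b -> path <%R a l -> last a l = b ->
  (tau (c a) (c b) <= chain_sum c a l)%E.
Proof.
move=> [_ <-] h1 h2; rewrite tau_lengthE; apply: ereal_inf_lbound; exists l => //.
by split => //; apply/eqP.
Qed.

Lemma lorentzian_curve_sub (I J : set R) c s t : lorentzian_curve I c -> J `<=` I ->
  is_interval J -> J s -> J t -> s < t -> lorentzian_curve J c.
Proof.
move=> [_ _ h1 h2] JI iJ Js Jt st; split => //; first by exists s, t.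
- by move=> u v /JI Iu /JI Iv; exact: h1.
- move=> u /JI Iu; have [e e0 [k hk]] := h2 u Iu; exists e => //; exists k => v w /JI Iv /JI Iw.
  exact: hk.
Qed.

Lemma fd_causal_sub c a b s t : fd_causal `[a, b] c -> a <= s -> s < t -> t <= b ->
  fd_causal `[s, t] c.
Proof.
move=> [h1 h2] as_ st tb; have hI : `[s, t]%classic `<=` `[a, b].
  by move=> u; rewrite /= !in_itv /=; lra.
split; last by move=> u v /hI hu /hI hv; exact: h2.
apply: (lorentzian_curve_sub (s := s) (t := t) h1 hI) => //; first exact: interval_is_interval.
- by rewrite /= in_itv /=; lra.
- by rewrite /= in_itv /=; lra.
Qed.

Lemma chain_ends a s : a <= s -> exists2 l, path <%R a l & last a l = s.
Proof.
rewrite le_eqVlt => /predU1P[->|h]; first by exists [::].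
by exists [:: s] => //=; rewrite h.
Qed.

(** Cutting off the ends of a maximal curve of finite length leaves a maximal
    curve: a shorter chain in the middle could be completed to one that is
    shorter than the whole curve. *)
Lemma sub_realizer c a b s t : fd_realizer c a b -> (tau (c a) (c b) < +oo)%E ->
  a <= s -> s < t -> t <= b -> fd_realizer c s t.
Proof.
move=> hr hfin as_ st tb; have [hc _] := hr.
split; first exact: fd_causal_sub hc as_ st tb.
have [l1 p1 e1] := chain_ends as_; have [l2 p2 e2] := chain_ends tb.
have ab : path <%R a (l1 ++ t :: l2) by rewrite cat_path p1 e1 /= st.
have hle := chain_sum_le hc (lexx a) ab; rewrite last_cat /= e2 in hle.
have {hle} := hle (lexx b); rewrite chain_sum_cat e1 /= => hle.
apply/eqP; rewrite tau_lengthE eq_le; apply/andP; split.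
  apply: ereal_inf_lbound; exists [:: t]; last by rewrite /= adde0.
  by split => //=; rewrite st.
apply: le_ereal_inf_tmp => _ [l [pl /eqP el] <-].
have pl' : path <%R a (l1 ++ l ++ l2) by rewrite !cat_path p1 e1 pl el p2.
have := realizer_chain hr pl'; rewrite !last_cat e1 el e2 => /(_ erefl) hge.
have {hge} := le_trans hle hge; rewrite !chain_sum_cat e1 el.
have f1 : chain_sum c a l1 \is a fin_num.
  rewrite ge0_fin_numE ?chain_sum_ge0 //; apply: le_lt_trans hfin; apply: le_trans hle.
  by rewrite leeDl // adde_ge0 ?tau_ge0 ?chain_sum_ge0.
have f2 : chain_sum c t l2 \is a fin_num.
  rewrite ge0_fin_numE ?chain_sum_ge0 //; apply: le_lt_trans hfin; apply: le_trans hle.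
  by rewrite addeA leeDr // adde_ge0 ?tau_ge0 ?chain_sum_ge0.
by rewrite leeD2lE // leeD2rE.
Qed.

Lemma realizer_split c a b m : fd_realizer c a b -> a < m -> m < b ->
  (tau (c a) (c b) = tau (c a) (c m) + tau (c m) (c b))%E.
Proof.
move=> hr am mb; have [hc _] := hr; apply/eqP; rewrite eq_le; apply/andP; split.
  have := @realizer_chain c a b [:: m; b] hr; rewrite /= adde0; apply=> //.
  by rewrite am mb.
apply: tau_reverse_triangle.
- by apply: (fd_causal_le hc); lra.
- by apply: (fd_causal_le hc); lra.
Qed.

(** The supremum of the parameters that are reached by such a chain is
    attained, and cannot be less than [b], because of the neighbourhood of its
    image on which the time separation is finite. *)
Lemma finite_chain c a b : locally_finite_valued X -> a <= b -> locally_lipschitz `[a, b] c ->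
  exists2 l, path <%R a l & last a l = b /\ (chain_sum c a l < +oo)%E.
Proof.
move=> hfin ab hl.
pose E : set R := [set t | a <= t <= b /\ exists2 l, path <%R a l & last a l = t /\ (chain_sum c a l < +oo)%E].
have Ea : E a by split; [rewrite lexx|exists [::] => //=; rewrite ltry].
have hE : has_sup E by split; [exists a|exists b => t [/andP[]]].
pose m := sup E.
have am : a <= m by apply: ub_le_sup => //; case: hE.
have mb : m <= b by apply: ge_sup; [exists a|move=> t [/andP[]]].
have [U hU fU] := hfin (c m).
have Im : `[a, b]%classic m by rewrite /= in_itv /= am.
have := lipschitz_within hl Im hU; rewrite /= /within /= => /nbhs_ballP[e /= e0 he].
have [t [/andP[at_ tb] [l pl [el fl]]] mt] := sup_adherent e0 hE.
have tm : t <= m by apply: ub_le_sup; [case: hE|split; [rewrite at_|exists l]].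
have Ut : U (c t).
  apply: he; last by rewrite /= in_itv /= at_.
  by rewrite /ball /= ger0_norm ?subr_ge0 // /m; lra.
rewrite -/m in mt.
have ext v : t < v -> v <= b -> v < m + e -> E v.
  move=> tv vb vm; split; first by lra.
  exists (l ++ [:: v]); first by rewrite cat_path pl el /= tv.
  rewrite last_cat /=; split => //; rewrite chain_sum_cat el /= adde0 lte_add_pinfty //.
  apply: fU => //; apply: he; last by rewrite /= in_itv /=; lra.
  by rewrite /ball /= ltr_norml; lra.
have [bm|mb'] := ltP b (m + e).
  have [tb'|bt] := ltP t b; first by have [_] := ext b tb' (lexx b) bm.
  by exists l => //; split => //; rewrite el; lra.
have : E (m + e / 2) by apply: ext; lra.
by move=> /(ub_le_sup (proj2 hE)); rewrite -/m; lra.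
Qed.

Lemma realizer_finite c a b : locally_finite_valued X -> a < b -> fd_realizer c a b ->
  (tau (c a) (c b) < +oo)%E.
Proof.
move=> hfin ab hr; have [[[_ _ _ hl] _] _] := hr.
have [l pl [el fl]] := finite_chain hfin (ltW ab) hl.
exact: le_lt_trans (realizer_chain hr pl el) fl.
Qed.

End realizers.

(** * Triangle comparison *)

Section comparison_of_hinges.
Context {R : realType} {X : lorentzian_prelength_space R} (K : R).
Notation model_pt := (@model_pt R).
Implicit Types (p : 'I_3 -> X) (pb : 'I_3 -> model_pt) (x y z v : X) (a b c e g d w : R).

Lemma tinyK_diameter T : tinyK K T -> (T%:E < model_diameter K)%E.
Proof.
rewrite /tinyK /model_diameter => h; case: ifP => K0; last exact: ltry.
have := h K0; rewrite ltr0_norm // => {}h.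
have k0 : 0 < Num.sqrt (- K) by rewrite sqrtr_gt0 oppr_gt0.
rewrite lte_fin ltr_pdivlMr // mulrC; apply: lt_le_trans h _.
by have := pi_gt0 R; lra.
Qed.

(** Since [tau x x = 0], nothing leads from [y] back to [x]; and the time
    separation from [Q] to [P] vanishes because time increases along causal
    curves of the model plane. *)
Lemma comparison_entry x y (P Q : model_pt) T : tau x x = 0%E -> tau x y = T%:E -> chron x y ->
  model_dist K P Q T ->
  [/\ chron x y -> model_ll K P Q, causal x y -> model_le K P Q & model_tau K P Q = tau x y] /\
  [/\ chron y x -> model_ll K Q P, causal y x -> model_le K Q P & model_tau K Q P = tau y x].
Proof.
move=> hx hT xy [hll ht _]; split.
  by split=> // [_|]; [exact: model_ll_le|rewrite ht hT].
have nyx : ~ chron y x by exact: not_chron_back hx (chron_causal xy).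
have tyx : tau y x = 0%E.
  by apply/eqP; rewrite eq_le tau_ge0 andbT leNgt; apply/negP => /tau_gt0.
split=> // [yx|].
- have [h _] := tau_back hx (chron_causal xy) yx.
  by move/tau_gt0: xy; rewrite h ltxx.
- rewrite tyx model_tau_past //; case: hll => cv [/future_curve_time h _]; exact: ltW.
Qed.

Lemma comparison_entry_self x (P : model_pt) : tau x x = 0%E ->
  [/\ chron x x -> model_ll K P P, causal x x -> model_le K P P & model_tau K P P = tau x x].
Proof.
by move=> h; split => [/tau_gt0|_|]; [rewrite h ltxx|left|rewrite model_tau_past // h].
Qed.

Definition triple_of (T : Type) (u v w : T) (i : 'I_3) : T := nth u [:: u; v; w] i.

Lemma ord3P (P : 'I_3 -> Prop) : P 0 -> P 1 -> P 2 -> forall i, P i.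
Proof.
move=> h0 h1 h2 [[|[|[|//]]] hi].
- by rewrite (_ : Ordinal hi = 0) //; exact: val_inj.
- by rewrite (_ : Ordinal hi = 1) //; exact: val_inj.
- by rewrite (_ : Ordinal hi = 2) //; exact: val_inj.
Qed.

Lemma chron_comparison_triangle x y z (P Q S : model_pt) a b c :
  tau x x = 0%E -> tau y y = 0%E -> tau z z = 0%E ->
  chron x y -> chron y z -> tau x y = a%:E -> tau y z = b%:E -> tau x z = c%:E ->
  model_dist K P Q a -> model_dist K Q S b -> model_dist K P S c ->
  comparison_triangle K (triple_of x y z) (triple_of P Q S).
Proof.
move=> hx hy hz xy yz ta tb tc da db dc; have xz := chron_trans xy yz.
have [h01 h10] := comparison_entry hx ta xy da.
have [h12 h21] := comparison_entry hy tb yz db.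
have [h02 h20] := comparison_entry hx tc xz dc.
have h00 := comparison_entry_self P hx; have h11 := comparison_entry_self Q hy.
have h22 := comparison_entry_self S hz.
by apply: ord3P; apply: ord3P.
Qed.

(** The sides of a triangle exist by timelike geodesic connectedness; the one
    from the first vertex to [p n] is prescribed. *)
Lemma side_family (U : set X) p (c01 : R -> X) l r (n : 'I_3) :
  strictly_timelike_geodesically_connected U -> (forall i, U (p i)) ->
  (forall i j : 'I_3, (i < j)%N -> chron (p i) (p j)) -> (0 < n)%N ->
  maximal_from_to_in U (p 0) (p n) c01 l r ->
  exists (c : 'I_3 -> 'I_3 -> R -> X) (a b : 'I_3 -> 'I_3 -> R),
    [/\ forall i j : 'I_3, (i < j)%N -> maximal_from_to_in U (p i) (p j) (c i j) (a i j) (b i j),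
    c 0 n = c01, a 0 n = l & b 0 n = r].
Proof.
move=> hU Up hp n0 hn.
have h (ij : 'I_3 * 'I_3) : exists f : (R -> X) * R * R,
    ((ij.1 < ij.2)%N -> maximal_from_to_in U (p ij.1) (p ij.2) f.1.1 f.1.2 f.2) /\
    (ij = (0, n) -> f = (c01, l, r)).
  have [->|ne] := eqVneq ij (0, n); first by exists (c01, l, r).
  have [lt|_] := ltnP ij.1 ij.2; last first.
    by exists (c01, l, r); split => // /eqP; rewrite (negbTE ne).
  have [[c [a [b hc]]] _] := hU _ _ (Up ij.1) (Up ij.2) (hp _ _ lt).
  by exists (c, a, b); split => // /eqP; rewrite (negbTE ne).
have [F hF] := choice h.
exists (fun i j => (F (i, j)).1.1), (fun i j => (F (i, j)).1.2), (fun i j => (F (i, j)).2).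
have [_ ->] := hF (0, n); last by [].
by split => // i j ij; have [/(_ ij)] := hF (i, j).
Qed.

(** A vertex is a point of a side, to which the vertex of the comparison
    triangle corresponds. *)
Lemma curvature_vertex (U : set X) p pb (c : R -> X) l m r g d (n v : 'I_3) :
  curvature_comparison_set K U -> (forall i, U (p i)) ->
  (forall i j : 'I_3, (i < j)%N -> chron (p i) (p j)) ->
  (forall i j : 'I_3, (i < j)%N -> tinyK K (fine (tau (p i) (p j)))) ->
  (0 < n)%N -> (0 < v)%N -> maximal_from_to_in U (p 0) (p n) c l r -> l <= m <= r ->
  comparison_triangle K p pb -> pb 0 = axisK K 0 -> pb n = axisK K d ->
  0 < g -> g <= d -> tinyK K d -> tau (p 0) (c m) = g%:E ->
  (exists2 cv, model_causal_curve K cv (pb 0) (pb v) & model_length K cv = model_tau K (pb 0) (pb v)) ->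
  (tau (c m) (p v) <= model_tau K (axisK K g) (pb v))%E.
Proof.
move=> [_ Ufin _ Ucon Ucmp] Up hch htiny n0 v0 hmax lmr hcmp pb0 pbn g0 gd dt hg [cv hcv lcv].
have [cc [ca [cb [hs ec ea eb]]]] := side_family Ucon Up hch n0 hmax.
apply: (Ucmp p cc ca cb pb) => //.
- split; first by move=> i j; apply: Ufin.
  by move=> i j ij; have [h1 h2 h3 _] := hs i j ij; split => //; exact: hch.
- by split => // i j ij; have [] := hs i j ij.
- move=> i j ij; rewrite fine_tauK ?Ufin //; exact/tinyK_diameter/htiny.
- exists 0, n; split => //; first by exists m; rewrite ?ec ?ea ?eb.
  + have d0 : 0 < d by lra.
    have [cw hcw [lcw hgw]] := axis_side d0 dt.
    rewrite pb0 pbn; exists cw; split => //; apply: hgw; lra.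
  + have gt : tinyK K g.
      move=> K0; have := dt K0; apply: le_lt_trans; rewrite ler_wpM2l //.
    have [_ h _] := model_dist_axis 0 g0 gt; rewrite add0r in h.
    by rewrite pb0 h hg.
- exists 0, v; have [_ ex ey _] := hs 0 v v0; split => //.
  + have [[[[_ [s [t [hs1 ht1 _]]] _ _] _] _] _ _ _] := hs 0 v v0.
    exists (cb 0 v) => //; move: hs1 ht1; rewrite /= !in_itv /= lexx andbT => /andP[h1 h2] _.
    exact: le_trans h1 h2.
  + exists cv; split => //; exists 1; rewrite ?lexx ?ler01 //.
    by case: hcv => -[].
  + by have [] := hcmp 0 v.
Qed.

End comparison_of_hinges.

Section hinge_in_space.
Context {R : realType} {X : lorentzian_prelength_space R} (K : R).
Implicit Types (x y z v : X) (k : R -> X) (l m r T : R) (U : set X).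

Lemma tinyKW (T T' : R) : T <= T' -> tinyK K T' -> tinyK K T.
Proof. by move=> h hT K0; apply: le_lt_trans (hT K0); rewrite ler_wpM2l // sqrtr_ge0. Qed.

(** The maximal curve [k] is a side of the triangle with the third vertex [v],
    and [k m] a point of that side. The curvature bound makes the cevian from
    [v] to [k m] at most as long as in the comparison triangle, where
    [thin_triangle] evaluates it. *)
Lemma stewart_inequality U k l m r v T : curvature_comparison_set K U ->
  fd_realizer k l r -> (forall t, l <= t <= r -> U (k t)) -> l < m -> m < r -> U v ->
  chron (k l) (k m) -> chron (k m) (k r) -> chron (k m) v ->
  chron v (k r) \/ chron (k r) v ->
  tinyK K T -> fine (tau (k l) (k r)) <= T -> fine (tau (k l) v) <= T -> sep v (k r) <= T ->
  mdK K (fine (tau (k m) v)) * snK K (fine (tau (k l) (k m)) + fine (tau (k m) (k r))) <=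
  mdK K (fine (tau (k l) v)) * snK K (fine (tau (k m) (k r))) +
  mdK K (sep v (k r)) * snK K (fine (tau (k l) (k m))) -
  snK K (fine (tau (k m) (k r))) * mdK K (fine (tau (k l) (k m))) -
  snK K (fine (tau (k l) (k m))) * mdK K (fine (tau (k m) (k r))).
Proof.
move=> hU hr hk lm mr Uv clm cmr cmv hvr hT hd he hc.
have [_ Ufin _ _ _] := hU.
have Ul : U (k l) by apply: hk; lra.
have Um : U (k m) by apply: hk; lra.
have Ur : U (k r) by apply: hk; lra.
have clr := chron_trans clm cmr; have clv := chron_trans clm cmv.
have split_d : fine (tau (k l) (k r)) = fine (tau (k l) (k m)) + fine (tau (k m) (k r)).
  by rewrite (realizer_split hr lm mr) fineD // ge0_fin_numE ?tau_ge0 // Ufin.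
have g0 := fine_tau_gt0 Ufin Ul Um clm; have b0 := fine_tau_gt0 Ufin Um Ur cmr.
have e0 := fine_tau_gt0 Ufin Ul Uv clv; have a0 := fine_tau_gt0 Ufin Um Uv cmv.
have ae := fine_tau_triangle Ufin Ul Um Uv (chron_causal clm) (chron_causal cmv).
have sa : smallK K (fine (tau (k m) v)).
  by apply: smallK_tinyK => //; apply: tinyKW hT; lra.
have td : tinyK K (fine (tau (k l) (k m)) + fine (tau (k m) (k r))).
  by rewrite -split_d; exact: tinyKW hT.
have te := tinyKW he hT; have tc := tinyKW hc hT.
have sl := Wself Ufin Ul; have sr := Wself Ufin Ur; have sv := Wself Ufin Uv.
have tauE (y z : X) : U y -> U z -> tau y z = (fine (tau y z))%:E.
  by move=> Uy Uz; apply: fine_tauK; exact: Ufin.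
have sepE y z : U y -> U z -> chron y z -> sep y z = fine (tau y z).
  by move=> Uy Uz yz; rewrite (sep_causal Ufin Uy (chron_causal yz)).
have lmr : l <= m <= r by lra.
have hdist : model_dist K (axisK K 0)
    (axisK K (fine (tau (k l) (k m)) + fine (tau (k m) (k r)))) (fine (tau (k l) (k r))).
  have := @model_dist_axis _ K 0 (fine (tau (k l) (k r))); rewrite add0r split_d; apply => //.
  exact: addr_gt0.
have gd : fine (tau (k l) (k m)) <= fine (tau (k l) (k m)) + fine (tau (k m) (k r)) by lra.
case: hvr => hv.
- have ec := sepE _ _ Uv Ur hv; rewrite ec in tc *.
  have c0 := fine_tau_gt0 Ufin Uv Ur hv.
  have tri := fine_tau_triangle Ufin Ul Uv Ur (chron_causal clv) (chron_causal hv).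
  rewrite split_d in tri.
  have [Q [dQ1 dQ2 _ hQ]] := thin_triangle g0 b0 e0 c0 td te tc (or_introl tri).
  apply: hQ => //; rewrite -tauE //.
  have hcmp := chron_comparison_triangle sl sv sr clv hv (tauE _ _ Ul Uv) (tauE _ _ Uv Ur)
    (tauE _ _ Ul Ur) dQ1 (dQ2 tri) hdist.
  apply: (@curvature_vertex _ _ K U (triple_of (k l) v (k r)) (triple_of (axisK K 0) Q _)
    k l m r _ _ 2 1 hU _ _ _ isT isT _ lmr hcmp erefl erefl g0 gd td (tauE _ _ Ul Um)).
  + exact: ord3P.
  + by apply: ord3P; apply: ord3P.
  + by apply: ord3P; apply: ord3P => // _; rewrite /triple_of /= ?split_d //.
  + by split.
  + by have [] := dQ1.
- have ec := sepE _ _ Ur Uv hv; rewrite sepC ec in tc *.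
  have c0 := fine_tau_gt0 Ufin Ur Uv hv.
  have tri := fine_tau_triangle Ufin Ul Ur Uv (chron_causal clr) (chron_causal hv).
  rewrite split_d in tri.
  have [Q [dQ1 _ dQ2 hQ]] := thin_triangle g0 b0 e0 c0 td te tc (or_intror tri).
  apply: hQ => //; rewrite -tauE //.
  have hcmp := chron_comparison_triangle sl sr sv clr hv (tauE _ _ Ul Ur) (tauE _ _ Ur Uv)
    (tauE _ _ Ul Uv) hdist (dQ2 tri) dQ1.
  apply: (@curvature_vertex _ _ K U (triple_of (k l) (k r) v) (triple_of (axisK K 0) _ Q)
    k l m r _ _ 1 2 hU _ _ _ isT isT _ lmr hcmp erefl erefl g0 gd td (tauE _ _ Ul Um)).
  + exact: ord3P.
  + by apply: ord3P; apply: ord3P.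
  + by apply: ord3P; apply: ord3P => // _; rewrite /triple_of /= ?split_d //.
  + by split.
  + by have [] := dQ1.
Qed.

End hinge_in_space.

Section first_variation.
Context {R : realType} (K : R).
Implicit Types (a b c g W T : R).

Lemma isder_right_ge0 (f : R -> R) (D g0 : R) : isder 0 f D -> f 0 = 0 -> 0 < g0 ->
  (forall g, 0 < g -> g < g0 -> 0 <= f g) -> 0 <= D.
Proof.
move=> hD f0 g00 hf; rewrite leNgt; apply/negP => D0.
have hc : h^-1 *: ((f \o shift 0) (h *: (1 : R)) - f 0) @[h --> (0 : R)^'] --> D.
  by have [h1 h2] := hD; rewrite -h2; exact: h1.
have : \forall h \near (0 : R)^', h^-1 *: ((f \o shift 0) (h *: (1 : R)) - f 0) < 0.
  exact: (cvgr_lt D hc).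
rewrite /dnbhs /within /= => /nbhs_ballP [d /= d0 hd].
have [m m0 [m1 m2]] := pos_below2 d0 g00.
have p0 : 0 < m / 2 by lra.
have := hd (m / 2); rewrite /ball /= sub0r normrN gtr0_norm // => h.
have : (m / 2)^-1 * (f (m / 2 * 1 + 0) - f 0) < 0.
  by apply: h; [lra|exact: lt0r_neq0].
rewrite f0 subr0 mulr1 addr0 pmulr_rlt0 ?invr_gt0 // ltNge hf //; lra.
Qed.

(** Both sides of Stewart's inequality agree at [g = 0]; comparing their
    derivatives there gives one of the inequalities in the law of cosines. *)
Lemma stewart_first_order a b c W g0 : 0 < g0 ->
  (forall g, 0 < g -> g < g0 -> mdK K a * snK K (g + b) <=
     mdK K (a + g * W) * snK K b + mdK K c * snK K g -
     snK K b * mdK K g - snK K g * mdK K b) ->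
  mdK K (a - b) - snK K a * snK K b * (W - 1) <= mdK K c.
Proof.
move=> g00 h.
have h0 : 0 <= snK K a * W * snK K b + mdK K c - mdK K b - mdK K a * csK K b.
  apply: (@isder_right_ge0 (fun g => mdK K (a + g * W) * snK K b + mdK K c * snK K g -
     snK K b * mdK K g - snK K g * mdK K b - mdK K a * snK K (g + b)) _ g0) => //.
  - have hm := isd_mdK K; have hs := isd_snK K.
    have d1 : isder 0 (fun g : R => mdK K (a + g * W)) (snK K a * W).
      apply: isd_eq; first by apply: (@isd_comp _ (mdK K) (fun g => a + g * W)); [exact: hm|isd].
      by rewrite mul0r addr0; ring.
    have d2 : isder 0 (fun g : R => snK K (g + b)) (csK K b).
      apply: isd_eq; first by apply: (@isd_comp _ (snK K) (fun g => g + b)); [exact: hs|isd].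
      by rewrite add0r; ring.
    have d3 : isder 0 (snK K) 1 by rewrite -(csK0 K); exact: hs.
    have d4 : isder 0 (mdK K) 0 by apply: (isd_eq (hm 0)); exact: snK0.
    by clear hm hs; isdeq; ring.
  - by rewrite mul0r addr0 add0r snK0 mdK0; ring.
  - by move=> g gp gg; rewrite subr_ge0; exact: h.
have := mdKD K a (- b); rewrite csKN snKN mdKN => ->; lra.
Qed.

End first_variation.

(** * Prolongation of a geodesic *)

Section prolonged_curves.
Context {R : realType} {X : lorentzian_prelength_space R}.
Implicit Types (x : X) (al be ga k : R -> X) (s t u d w : R) (U V : set X).

Lemma germ_in d al V : 0 < d -> {within `[0, d], continuous al} -> nbhs (al 0) V ->
  exists2 e, 0 < e <= d & forall t, 0 <= t -> t <= e -> V (al t).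
Proof.
move=> d0 /subspace_continuousP/(_ 0) hc hV.
have I0 : `[0, d]%classic 0 by rewrite /= in_itv /= lexx ltW.
have := hc I0 _ hV; rewrite /= /within /= => /nbhs_ballP[e /= e0 he].
have [m m0 [m1 m2]] := pos_below2 d0 e0.
exists (m / 2); first by lra.
move=> t t0 td; apply: he; last by rewrite /= in_itv /=; lra.
by rewrite /ball /= sub0r normrN ger0_norm //; lra.
Qed.

Lemma small_tau U x (T : R) : open U -> tau_finite_on U -> tau_continuous_on U -> U x ->
  0 < T -> exists V, [/\ nbhs x V, V `<=` U &
    forall p q, V p -> V q -> fine (tau p q) <= T].
Proof.
move=> Uo Ufin Ucts Ux T0.
have nU : nbhs x U by exact: open_nbhs_nbhs.
have /subspace_continuousP/(_ (x, x) (conj Ux Ux)) hc := Ucts.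
have hT : nbhs (tau x x) [set y | (y < T%:E)%E].
  apply: open_nbhs_nbhs; split; first exact: open_ereal_lt_ereal.
  by rewrite /= (Wself Ufin Ux) lte_fin.
have := hc _ hT; rewrite /= /within /= => -[[V1 V2] /= [h1 h2] hV].
exists (V1 `&` V2 `&` U); split.
- by apply: filterI => //; exact: filterI.
- by move=> p [].
- move=> p q [[p1 _] Up] [[_ q2] Uq].
  have : (tau p q < T%:E)%E by apply: (hV (p, q)).
  by rewrite fine_tauK ?Ufin // lte_fin => /ltW.
Qed.

(** The past directed curve [be], run backwards, is the first half of a maximal
    curve in [U]. *)
Definition prolongs U d be k := [/\ fd_realizer k (- d) d,
  forall t, - d <= t -> t <= d -> U (k t) & forall u, 0 <= u -> u <= d -> k (- u) = be u].

Lemma prolongs0 U d be k : 0 < d -> prolongs U d be k -> k 0 = be 0.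
Proof. by move=> d0 [_ _ h]; rewrite -[in LHS]oppr0 h // ltW. Qed.

Lemma prolongs_shrink U d e be k : tau_finite_on U -> 0 < e -> e <= d ->
  prolongs U d be k -> prolongs U e be k.
Proof.
move=> Ufin e0 ed [hr hkU hkb]; split.
- have hfin : (tau (k (- d)%R) (k d) < +oo)%E by apply: Ufin; apply: hkU; lra.
  by apply: (sub_realizer hr hfin); lra.
- by move=> t t1 t2; apply: hkU; lra.
- by move=> u u0 ue; apply: hkb; lra.
Qed.

(** The end points of [k] are chronologically related, since [be] is timelike;
    so [k] is timelike by strict timelike geodesic connectedness. *)
Lemma prolongs_germ K U x d be k : curvature_comparison_set K U -> past_germ U x d be ->
  prolongs U d be k -> future_germ U x d k.
Proof.
move=> [_ Ufin _ Ucon _] hbe hk; have [d0 b0 _ _ _] := hbe; have [hr hU hkb] := hk.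
have k0 : k 0 = x by rewrite (prolongs0 d0 hk).
have [hcau _] := hr; have Ux := pg_base hbe.
have dd : - d <= d by lra.
have c1 : chron (k (- d)) x by rewrite hkb ?(ltW d0) //; exact: (pg_chron hbe).
have c2 : causal x (k d) by rewrite -k0; apply: (fd_causal_le hcau); lra.
have Ul : U (k (- d)) by exact: hU.
have Ur : U (k d) by exact: hU.
have c3 : chron (k (- d)) (k d).
  apply: fine_tau_chron; have := fine_tau_triangle Ufin Ul Ux Ur (chron_causal c1) c2.
  by have := fine_tau_gt0 Ufin Ul Ux c1; have := fine_tau_ge0 x (k d); lra.
have [_ hmax] := Ucon _ _ Ul Ur c3.
have [[_ _ _ hl] hch] : fd_timelike `[- d, d] k.
  by apply: hmax; split => // t /andP[]; exact: hU.
have hI : `[0, d]%classic `<=` `[- d, d].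
  by move=> t; rewrite /= !in_itv /=; lra.
split => //.
- by move=> t /andP[t0 td]; apply: hU; lra.
- exact: curve_within hl hI.
- by move=> s t s0 st td; apply: hch => //; apply: hI; rewrite /= in_itv /=; lra.
Qed.

(** In the limit [u -> 0], Stewart's inequality for the hinge of [be u],
    [al s] and [k t] turns the bound on the angle of [al] and [be] into the
    same bound, up to the error of [law_of_cosines_small], on the angle of
    [al] and [k]. *)
Lemma angle_bound_prolong K U x d al be k w' w : curvature_comparison_set K U ->
  future_germ U x d al -> past_germ U x d be -> prolongs U d be k ->
  0 <= w' -> w' < w -> mixed_bound x d al be w' ->
  exists2 d', 0 < d' <= d & angle_bound x d' al k w.
Proof.
move=> hU hal hbe hk w'0 w'w hmix.
have hkg := prolongs_germ hU hbe hk.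
have [Uo Ufin Ucts _ _] := hU.
have Ux := fg_base hal.
have W1 := cosh_ge1 w'; have WW : cosh w' < cosh w by rewrite ltr_cosh //; lra.
have [d0 d00 [sd law]] := law_of_cosines_small K W1 WW.
pose T := d0 / 2; have T0 : 0 < T by rewrite /T; lra.
have Td : T <= d0 by rewrite /T; lra.
have hT : tinyK K T by move=> K0; have := sd K0; rewrite /T; lra.
have [V [nV VU hV]] := small_tau Uo Ufin Ucts Ux T0.
have [dd ald _ alc _] := hal; have dN : - d <= d by lra.
have [_ bed _ bec _] := hbe; have [_ kd _ kc _] := hkg.
have [e1 /andP[e10 e1d] h1] : exists2 e, 0 < e <= d & forall t, 0 <= t -> t <= e -> V (al t).
  by apply: germ_in => //; rewrite ald.
have [e2 /andP[e20 e2d] h2] : exists2 e, 0 < e <= d & forall t, 0 <= t -> t <= e -> V (be t).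
  by apply: germ_in => //; rewrite bed.
have [e3 /andP[e30 e3d] h3] : exists2 e, 0 < e <= d & forall t, 0 <= t -> t <= e -> V (k t).
  by apply: germ_in => //; rewrite kd.
have [e e0 [ee1 ee2 ee3]] := pos_below3 e10 e20 e30.
have ed : e <= d by lra.
exists e; first by rewrite e0.
move=> s t s0 se t0 te hst.
have Vx : V x by exact: nbhs_singleton.
have Va : V (al s) by apply: h1; [exact: ltW|exact: le_trans se ee1].
have Vb : V (k t) by apply: h3; [exact: ltW|exact: le_trans te ee3].
have sd' := le_trans se ed; have td' := le_trans te ed.
have cha := fg_chron hal s0 sd'; have chb := fg_chron hkg t0 td'.
have a0 := fine_tau_gt0 Ufin Ux (VU _ Va) cha; have b0 := fine_tau_gt0 Ufin Ux (VU _ Vb) chb.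
have aT := hV _ _ Vx Va; have bT := hV _ _ Vx Vb.
have cT : sep (al s) (k t) <= T.
  case: hst => /chron_causal h; first by rewrite (sep_causal Ufin (VU _ Va) h) hV.
  by rewrite sepC (sep_causal Ufin (VU _ Vb) h) hV.
have c0 : 0 <= sep (al s) (k t) by rewrite addr_ge0 // fine_tau_ge0.
have hbe' := past_germ_shrink e0 ed hbe.
have [hr hkU hkb] := hk.
have g0 := fine_tau_gt0 Ufin (pgW hbe' (ltW e0) (lexx e)) Ux (pg_chron hbe' e0 (lexx e)).
(* below [g1] the length [g] is attained by [be], and [a + g * cosh w'] stays
   in the range where [mdK] is increasing *)
pose g1 := Num.min (fine (tau (be e) x)) (T / cosh w').
have W0 := cosh_gt0 w'.
have g10 : 0 < g1 by rewrite lt_min g0 divr_gt0.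
suff : fine (tau x (al s)) ^+ 2 + fine (tau x (k t)) ^+ 2 -
    2 * fine (tau x (al s)) * fine (tau x (k t)) * cosh w <= sep (al s) (k t) ^+ 2 by lra.
apply: law; [exact: ltW|exact: le_trans aT Td|exact: ltW|exact: le_trans bT Td|exact: c0|].
apply: (stewart_first_order g10) => g gp; rewrite lt_min => /andP[gg1 gg2].
have [u /andP[u0 ue] hu] := pg_value Ufin Ucts hbe' gp (ltW gg1).
have ud := le_trans ue ed.
have Vu : V (be u) by apply: h2; [exact: ltW|exact: le_trans ue ee2].
have chu := pg_chron hbe u0 ud.
have hku := hkb _ (ltW u0) ud.
have hfin : (tau (k (- d)%R) (k d) < +oo)%E by apply: Ufin; apply: hkU.
have hsub : fd_realizer k (- u) t.
  by apply: (sub_realizer hr hfin) => //; [rewrite lerN2|apply: lt_trans t0; rewrite oppr_lt0].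
have := @stewart_inequality _ _ K U k (- u) 0 t (al s) T hU hsub.
rewrite hku kd hu => st; apply: (le_trans (st _ _ _ _ _ _ _ _ _ _ _ _)) => //.
- move=> v /andP[v1 v2]; apply: hkU; last exact: le_trans td'.
  by apply: le_trans v1; rewrite lerN2.
- by rewrite oppr_lt0.
- exact: VU.
- exact: hV.
- exact: hV.
have hmx := hmix s u s0 sd' u0 ud; rewrite hu in hmx.
have gW : g * cosh w' < T by rewrite -ltr_pdivlMr.
have E0 := fine_tau_ge0 (be u) (al s).
have hE : fine (tau (be u) (al s)) <= fine (tau x (al s)) + g * cosh w'.
  rewrite -(@ler_pXn2r _ 2) ?nnegrE //; last by apply: addr_ge0; apply: ltW => //; exact: mulr_gt0.
  apply: (le_trans hmx); rewrite -subr_ge0.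
  have -> : (fine (tau x (al s)) + g * cosh w') ^+ 2 - (fine (tau x (al s)) ^+ 2 + g ^+ 2 +
     2 * fine (tau x (al s)) * g * cosh w') = g ^+ 2 * ((cosh w') ^+ 2 - 1) by ring.
  by apply: mulr_ge0; [exact: sqr_ge0|nra].
have sE : smallK K (fine (tau x (al s)) + g * cosh w').
  by apply: smallKW sd; have := lerD aT (ltW gW); rewrite /T -splitr.
have hM := mdK_ler E0 hE sE.
have Sb : 0 <= snK K (fine (tau x (k t))).
  by apply: snK_ge0; [exact: ltW|apply: smallKW sd; exact: le_trans bT Td].
by have := ler_wpM2r Sb hM; lra.
Qed.

(** The prolongation of [be] cannot be future directed, as it agrees with [be]
    on an interval. As a geodesic it is maximal near its interior point [x],
    and a maximal curve is still maximal when it is shortened to stay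
    in [U]. *)
Lemma prolongation_exists (I : set R) be U x : locally_finite_valued X -> geodesic_prolongation X ->
  I 0 -> (forall t, I t -> 0 <= t) -> pd_geodesic I be -> pd_timelike I be -> be 0 = x -> nbhs x U ->
  exists2 d, 0 < d & exists2 k, prolongs U d be k & `[0, d]%classic `<=` I.
Proof.
move=> hfin hpr I0 Ige [hpc hgeo] [_ htl] be0 nU.
have [a [b [abI hnear hreal]]] := hgeo 0 I0.
have /andP[a0 b0] := nbhs_singleton hnear I0.
have a00 : a = 0.
  apply/eqP; rewrite eq_le a0 andTb; apply: Ige; apply: abI; rewrite /= in_itv /= lexx; exact: le_trans b0.
rewrite {}a00 in abI hnear hreal a0.
have hb : 0 < b.
  have [[[_ [s [t [hs ht st]]] _ _] _] _] := hreal.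
  by move: hs ht; rewrite /= !in_itv /=; lra.
have hg : geodesic `[0, b] be.
  right; split; first by case: hreal.
  move=> t tI; exists 0, b; split => //.
  by apply/nbhs_ballP; exists 1 => //= s _; rewrite in_itv.
have [a1 [e1 [h [a10 be1 hgh hagree]]]] := hpr 0 b be hg.
have h0 : h 0 = x by rewrite hagree ?lexx ?(ltW hb) // be0.
have J0 : `]a1, e1[%classic 0 by rewrite /= in_itv /=; lra.
have Jb : `]a1, e1[%classic b by rewrite /= in_itv /=; lra.
have {}hgh : pd_geodesic `]a1, e1[ h.
  case: hgh => // -[[_ hc] _]; exfalso.
  have := hc 0 b J0 Jb hb; rewrite h0 hagree ?lexx ?(ltW hb) // => hxb.
  have Ib : I b by apply: abI; rewrite /= in_itv /= lexx ltW.
  have := htl 0 b I0 Ib hb; rewrite be0; apply: not_chron_back hxb.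
  by apply: tau_self; have [V nV hV] := hfin x; apply: hV; exact: nbhs_singleton.
have [_ /(_ 0 J0)[a2 [b2 [abJ hnear2 [_ hr]]]]] := hgh.
have hnJ : nbhs (0 : R) (`]a1, e1[)%classic.
  by apply: open_nbhs_nbhs; split => //; exact: interval_open.
move: hnear2 => /nbhs_ballP[e1' /= e1'0 he1]; move: hnJ => /nbhs_ballP[e2' /= e2'0 he2].
have [e e0 [le1 le2]] := pos_below2 e1'0 e2'0.
have he' s : - e < s -> s < e -> a2 <= s <= b2.
  move=> s1 s2; apply: he1; last apply: he2; rewrite /ball /= sub0r normrN ltr_norml; lra.
pose k s := h (- s).
have hl : locally_lipschitz `[- b2, - a2] k by case: hr => -[[]].
have hb2 : `[- b2, - a2]%classic 0.
  by rewrite /= in_itv /=; have := he' 0; lra.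
have k0 : k 0 = x by rewrite /k oppr0.
have nk : nbhs (k 0) U by rewrite k0.
have := lipschitz_within hl hb2 nk; rewrite /= /within /= => /nbhs_ballP[e' /= e'0 he3].
have [m m0 [m1 m2 m3]] := pos_below3 hb e0 e'0.
have [d d0 [db de de']] : exists2 d : R, 0 < d & [/\ d < b, d < e & d < e'].
  by exists (m / 2); [lra|split; lra].
have hed := he' d; have hemd := he' (- d).
exists d => //; exists k.
  split.
  - have ab2 : - b2 < - a2 by lra.
    have fin := realizer_finite hfin ab2 hr.
    by apply: (sub_realizer hr fin); lra.
  - move=> t t1 t2; apply: he3; last by rewrite /= in_itv /=; lra.
    by rewrite /ball /= sub0r normrN ltr_norml; lra.
  - by move=> u u0 ud; rewrite /k opprK hagree //; lra.
by move=> t; rewrite /= in_itv /= => ht; apply: abI; rewrite /= in_itv /=; lra.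
Qed.

Lemma real_between (p : \bar R) v : (0 <= p)%E -> (p < v%:E)%E ->
  exists2 w, 0 <= w < v & (p < w%:E)%E.
Proof.
case: p => [p| |] //; rewrite lee_fin lte_fin => p0 pv.
by exists ((p + v) / 2); rewrite ?lte_fin; lra.
Qed.

(** By [angle_bound_prolong] the angles of [al] and [ga] with the future
    directed prolongation of [be] are at most those with [be], so that
    [upper_angle_triangle_future] applies. *)
Lemma upper_angle_triangle_through K U x d al be ga k : curvature_comparison_set K U ->
  future_germ U x d al -> future_germ U x d ga -> past_germ U x d be -> prolongs U d be k ->
  (upper_angle al ga <= upper_angle al be + upper_angle be ga)%E.
Proof.
move=> hU hal hga hbe hk; have [_ Ufin Ucts _ _] := hU; rewrite leNgt; apply/negP => hlt.
have [p0 _] := mixed_angle_ge0 Ufin hal hbe.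
have [_ q0] := mixed_angle_ge0 Ufin hga hbe.
have [w1 [w2 [w10 w20 h1 h2 h3]]] := split_gap p0 q0 hlt.
have [v1 /andP[v10 v11] hv1] := real_between p0 h1.
have [v2 /andP[v20 v21] hv2] := real_between q0 h2.
have [d1 /andP[d10 d1d] b1] := mixed_bound_lt Ufin hal hbe v10 (or_introl hv1).
have [d2 /andP[d20 d2d] b2] := mixed_bound_lt Ufin hga hbe v20 (or_intror hv2).
have [e e0 [e1 e2]] := pos_below2 d10 d20.
have ed : e <= d by lra.
have hal' := germ_shrink e0 ed hal; have hga' := germ_shrink e0 ed hga.
have hbe' := past_germ_shrink e0 ed hbe.
have hk' := prolongs_shrink Ufin e0 ed hk.
have hkg := prolongs_germ hU hbe' hk'.
have [|e3 /andP[e30 e3e] b3] := angle_bound_prolong hU hal' hbe' hk' v10 v11.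
  by move=> s u *; apply: b1 => //; lra.
have [|e4 /andP[e40 e4e] b4] := angle_bound_prolong hU hga' hbe' hk' v20 v21.
  by move=> s u *; apply: b2 => //; lra.
have [f f0 [f1 f2]] := pos_below2 e30 e40.
have fe : f <= e by lra.
have := upper_angle_triangle_future Ufin Ucts (germ_shrink f0 fe hal') (germ_shrink f0 fe hkg)
  (germ_shrink f0 fe hga') w10 w20.
rewrite leNgt h3 => h; suff : false by []; apply: h => s t *.
  by apply: b3 => //; lra.
by apply: (angle_boundC b4) => //; lra.
Qed.

End prolonged_curves.

(** * The triangle inequality for angles *)

Theorem theorem4p5 (R : realType) (X : lorentzian_prelength_space R)
    (hsc : strongly_causal X) (hfin : locally_finite_valued X)
    (hcont : locally_continuous X)
    (B : \bar R) (hB : (0 < B)%E) (alpha beta gamma : R -> X)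
    (hab : alpha 0 = beta 0) (hbg : beta 0 = gamma 0) :
  let D : set R := [set t | 0 <= t /\ (t%:E < B)%E] in
  (fd_timelike D alpha -> fd_timelike D beta -> pd_timelike D gamma ->
   angle_exists alpha gamma ->
   (upper_angle alpha gamma <=
      upper_angle alpha beta + upper_angle beta gamma)%E)
  /\
  (locally_causally_closed X -> timelike_curvature_bounded_below X ->
   geodesic_prolongation X ->
   fd_timelike D alpha -> fd_timelike D gamma ->
   pd_timelike D beta -> pd_geodesic D beta ->
   (upper_angle alpha gamma <=
      upper_angle alpha beta + upper_angle beta gamma)%E).
Proof.
move=> D; have [b b0 bD] := initial_segment hB; split.
- move=> ha hb hg hex; have [W [nW Wfin Wcts]] := tame_neighbourhood (beta 0) hfin hcont.
  have nWa : nbhs (alpha 0) W by rewrite hab.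
  have nWg : nbhs (gamma 0) W by rewrite -hbg.
  have [d1 d1b ga] := future_curve_germ b0 ha bD nWa; rewrite hab in ga.
  have [d2 d2b gb] := future_curve_germ b0 hb bD nW.
  have [d3 d3b gg] := past_curve_germ b0 hg bD nWg; rewrite -hbg in gg.
  have [[d10 _ _ _ _] [d20 _ _ _ _] [d30 _ _ _ _]] := And3 ga gb gg.
  have [d d0 [dd1 dd2 dd3]] := pos_below3 d10 d20 d30.
  exact: (upper_angle_triangle_past Wfin Wcts (germ_shrink d0 dd1 ga) (germ_shrink d0 dd2 gb)
    (past_germ_shrink d0 dd3 gg) hex).
- move=> _ [K /(_ (beta 0))[U Ux hU]] hpr ha hg hb hgeo; have [Uo Ufin _ _ _] := hU.
  have nU : nbhs (beta 0) U by exact: open_nbhs_nbhs.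
  have D0 : D 0 by split.
  have [|d4 d40 [k hk dD]] := prolongation_exists hfin hpr D0 _ hgeo hb erefl nU.
    by move=> t [].
  have nUa : nbhs (alpha 0) U by rewrite hab.
  have nUg : nbhs (gamma 0) U by rewrite -hbg.
  have [d1 d1b ga] := future_curve_germ d40 ha dD nUa; rewrite hab in ga.
  have [d2 d2b gb] := past_curve_germ d40 hb dD nU.
  have [d3 d3b gg] := future_curve_germ d40 hg dD nUg; rewrite -hbg in gg.
  have [[d10 _ _ _ _] [d20 _ _ _ _] [d30 _ _ _ _]] := And3 ga gb gg.
  have [d d0 [dd1 dd2 dd3]] := pos_below3 d10 d20 d30.
  have dd4 : d <= d4 by lra.
  exact: (upper_angle_triangle_through hU (germ_shrink d0 dd1 ga) (germ_shrink d0 dd3 gg)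
    (past_germ_shrink d0 dd2 gb) (prolongs_shrink Ufin d0 dd4 hk)).
Qed.
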